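(* Let $A\in\mathbb{R}^{n\times n}$ be symmetric with eigenvalues $\lambda_1\ge\lambda_2\ge\cdots\ge\lambda_n$, and let $\Lambda_{n\setminus k}=\mathrm{diag}(\lambda_{k+1},\dots,\lambda_n)$. Let $\Omega\in\mathbb{R}^{n\times\ell}$ be a standard Gaussian matrix and let $\mathrm{ALG}_k(s,r;\exp(x))$ be the output of the Krylov-aware low-rank approximation algorithm for $f(x)=\exp(x)$ with starting block $\Omega$ (see context). Let $\gamma_{1,n}=\lambda_1-\lambda_n$. If $\ell-k\ge2$ and $s\ge e\gamma_{1,n}$, then $$\mathbb{E}\|\exp(A)-\mathrm{ALG}_k(s,r;\exp(x))\|_F\le\frac{\sqrt{\ell s}\,\gamma_{1,n}^{2r+2}}{2^{4r+1}(2r+2)!}\|\exp(A)\|_2+\sqrt{1+\frac{1}{\left(1-\frac{\gamma_{1,n}^s}{s!}\right)^2}\,\frac{5k}{\ell-k-1}}\;\|\exp(\Lambda_{n\setminus k})\|_F.$$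
   Context: $\|\cdot\|_F$ and $\|\cdot\|_2$ are the Frobenius and spectral norms. A standard Gaussian matrix has i.i.d. $N(0,1)$ entries. $[\![B]\!]_k$ denotes a best rank-(at most)-$k$ approximation of $B$ obtained by truncating the SVD. For symmetric $M$ and $f:\mathbb{R}\to\mathbb{R}$, $f(M)$ is defined by applying $f$ to the eigenvalues in an eigendecomposition. Here $s\ge1$, $r\ge0$, $k\ge1$ are integers. Krylov subspace: $\mathcal{K}_i(A,\Omega)=\mathrm{range}([\Omega\ A\Omega\ \cdots\ A^{i-1}\Omega])$ and $d_{i,\ell}=\dim\mathcal{K}_i(A,\Omega)$. Block-Lanczos (exact arithmetic): applied to $A$ with starting block $\Omega$ for $q$ iterations it produces matrices $V_0,\dots,V_{q-1}$ (possibly with fewer than $\ell$, even zero, columns) such that for every $1\le i\le q$ the matrix $Q_i=[V_0\ \cdots\ V_{i-1}]$ has orthonormal columns forming a basis of $\mathcal{K}_i(A,\Omega)$, and the block tridiagonal matrix $T_q=Q_q^TAQ_q$. Krylov-aware low-rank approximation: with $q=s+r$, run block-Lanczos for $q$ iterations with starting block $\Omega$, set $X=f(T_q)_{1:d_{s,\ell},\,1:d_{s,\ell}}$ (the leading principal $d_{s,\ell}\times d_{s,\ell}$ submatrix of $f(T_q)$), and output $\mathrm{ALG}_k(s,r;f)=Q_s[\![X]\!]_kQ_s^T$. *)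

(* Defs.v *)
From mathcomp Require Import all_boot all_order all_algebra.
From mathcomp Require Import all_classical all_reals all_analysis.
Set Implicit Arguments.
Unset Strict Implicit.
Unset Printing Implicit Defensive.
Import Order.TTheory GRing.Theory Num.Theory.
Local Open Scope classical_set_scope.
Local Open Scope ring_scope.

Section Norms.
Context {R : realType}.

Definition frobenius_norm m n (M : 'M[R]_(m, n)) : R :=
  Num.sqrt (\sum_i \sum_j M i j ^+ 2).

(* On column vectors the Frobenius norm is the Euclidean norm. *)
Definition spectral_norm m n (M : 'M[R]_(m, n)) : R :=
  sup [set frobenius_norm (M *m x) |
        x in [set x : 'cV[R]_n | frobenius_norm x <= 1]].

End Norms.

Section MatrixFunctions.
Context {R : realType}.

Definition orthonormal_cols m n (U : 'M[R]_(m, n)) : Prop := U^T *m U = 1%:M.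

(* Eigenvalues are indexed from 1 to n and counted with multiplicity;
   the values of lambda outside this range are irrelevant. *)
Definition sorted_eigenvalues n (A : 'M[R]_n) (lambda : nat -> R) : Prop :=
  char_poly A = \prod_(1 <= i < n.+1) ('X - (lambda i)%:P) /\
  (forall i j, (1 <= i)%N -> (i <= j)%N -> (j <= n)%N -> lambda j <= lambda i).

(* diag (lambda_(k+1), ..., lambda_n), empty when n <= k *)
Definition tail_eigenvalues n k (lambda : nat -> R) : 'M[R]_(n - k) :=
  diag_mx (\row_(i < n - k) lambda (k.+1 + i)%N).

Definition is_matrix_fun (f : R -> R) n (M N : 'M[R]_n) : Prop :=
  exists (U : 'M[R]_n) (d : 'rV[R]_n),
    [/\ orthonormal_cols U,
        M = U *m diag_mx d *m U^T &
        N = U *m diag_mx (map_mx f d) *m U^T].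

(* For symmetric M there is exactly one N such that is_matrix_fun f M N;
   the default value 0 is only taken when M is not symmetric. *)
Definition matrix_fun (f : R -> R) n (M : 'M[R]_n) : 'M[R]_n :=
  xget 0 [set N | is_matrix_fun f M N].

(* The inner dimension t is free: thin, compact and full SVDs have the same
   truncations. As truncations need not be unique, this is a relation. *)
Definition truncated_svd k m n (B C : 'M[R]_(m, n)) : Prop :=
  exists t (U : 'M[R]_(m, t)) (sigma : 'rV[R]_t) (V : 'M[R]_(n, t)),
    [/\ orthonormal_cols U, orthonormal_cols V,
        forall i, 0 <= sigma 0 i,
        forall i j : 'I_t, (i <= j)%N -> sigma 0 j <= sigma 0 i &
        B = U *m diag_mx sigma *m V^T /\
        C = U *m diag_mx (\row_i if (i < k)%N then sigma 0 i else 0) *m V^T].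

End MatrixFunctions.

Section BlockLanczos.
Context {R : realType}.

Definition krylov_mx n l (A : 'M[R]_n) (Omega : 'M[R]_(n, l)) (i : nat) :=
  \mxrow_(j < i) (A ^+ j *m Omega).

(* Block number i has b i columns. *)
Fixpoint ncols (b : nat -> nat) (i : nat) : nat :=
  if i is j.+1 then (ncols b j + b j)%N else 0%N.

Fixpoint concat_blocks n (b : nat -> nat) (V : forall i, 'M[R]_(n, b i))
    (i : nat) : 'M[R]_(n, ncols b i) :=
  if i is j.+1 then row_mx (concat_blocks V j) (V j) else 0.

Lemma leq_ncols b s r : (ncols b s <= ncols b (s + r))%N.
Proof.
elim: r => [|r IHr]; first by rewrite addn0.
by rewrite addnS; apply: leq_trans IHr (leq_addr _ _).
Qed.

(* Column spaces are compared as row spaces of transposes. *)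
Definition block_lanczos n l (A : 'M[R]_n) (Omega : 'M[R]_(n, l)) (q : nat)
    (b : nat -> nat) (V : forall i, 'M[R]_(n, b i)) : Prop :=
  forall i, (1 <= i)%N -> (i <= q)%N ->
    orthonormal_cols (concat_blocks V i) /\
    ((concat_blocks V i)^T :=: (krylov_mx A Omega i)^T)%MS.

(* So ncols b s is d_(s,l), the dimension of the Krylov subspace. *)
Lemma block_lanczos_ncols n l (A : 'M[R]_n) (Omega : 'M[R]_(n, l)) q b
    (V : forall i, 'M[R]_(n, b i)) i :
  block_lanczos A Omega q V -> (1 <= i)%N -> (i <= q)%N ->
  ncols b i = \rank (krylov_mx A Omega i).
Proof.
move=> lan i1 iq; have [orth eqK] := lan i i1 iq.
rewrite -mxrank_tr -eqK; apply/esym/eqP.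
by apply/row_freeP; exists (concat_blocks V i).
Qed.

Definition lanczos_T n (A : 'M[R]_n) b (V : forall i, 'M[R]_(n, b i)) q :
    'M[R]_(ncols b q) :=
  (concat_blocks V q)^T *m A *m concat_blocks V q.

Definition leading_submx m p (h : (m <= p)%N) (M : 'M[R]_p) : 'M[R]_m :=
  mxsub (widen_ord h) (widen_ord h) M.

(* The output is only determined up to the choice of the blocks V and of the
   singular value decomposition, hence a relation. *)
Definition krylov_aware_output n l (A : 'M[R]_n) (Omega : 'M[R]_(n, l))
    (k s r : nat) (f : R -> R) (ALG : 'M[R]_n) : Prop :=
  exists (b : nat -> nat) (V : forall i, 'M[R]_(n, b i))
         (Y : 'M[R]_(ncols b s)),
    [/\ block_lanczos A Omega (s + r) V,
        truncated_svd k
          (leading_submx (leq_ncols b s r)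
             (matrix_fun f (lanczos_T A V (s + r)))) Y &
        ALG = concat_blocks V s *m Y *m (concat_blocks V s)^T].

End BlockLanczos.

Section Gaussian.
Context {R : realType} {d : measure_display} {T : measurableType d}.
Variable P : probability T R.

Definition mutually_independent (I : finType) (X : I -> {RV P >-> R}) : Prop :=
  forall (J : {set I}) (B : I -> set R), (forall i, measurable (B i)) ->
    P (\bigcap_(i in [set i | i \in J]) (X i @^-1` B i)) =
    (\prod_(i in J) P (X i @^-1` B i))%E.

Definition standard_gaussian_matrix m n
    (Omega : 'I_m -> 'I_n -> {RV P >-> R}) : Prop :=
  (forall i j (B : set R), measurable B ->
     distribution P (Omega i j) B = normal_prob 0 1 B) /\
  mutually_independent (fun ij : 'I_m * 'I_n => Omega ij.1 ij.2).

Definition realization m n (Omega : 'I_m -> 'I_n -> {RV P >-> R}) (w : T) :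
    'M[R]_(m, n) :=
  \matrix_(i, j) Omega i j w.

End Gaussian.

(* Main.v *)
(* The output is compared with C = S B1 S, where exp(A) = B1 + B2 splits off the k dominant eigenvectors G
   and S is the orthogonal projector onto the range of Z = p(A) Omega H. Here p is a Taylor polynomial of
   degree < s with (1 - gamma^s / s!) exp <= p <= exp on the spectrum, so that the range of Z lies in the
   Krylov space of Q_s, and H = Omega^T G (G^T Omega Omega^T G + e)^-1 is a regularized right inverse of
   G^T Omega. Truncating X = f(T_q)_{1:d,1:d} instead of Q_s^T exp(A) Q_s costs twice the distance between
   them (Eckart-Young), and this distance is controlled by the exactness of Lanczos on polynomials of degree
   <= 2r+1 together with Chebyshev interpolation of exp; this gives the first term.
   For the second term, |exp(A) - C|^2 <= |B2|^2 + 2 |B1 - S B1|^2, and B1 - S B1 is bounded by the tail of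
   exp(A) applied to Omega H, up to an error that vanishes with e. Stein's identity, which needs no density of
   the Wishart distribution, yields E |u^T Omega H|^2 <= E tr (G^T Omega Omega^T G + e)^-1 <= k / (l - k - 1)
   for unit vectors u orthogonal to G. One concludes with sqrt(x) <= (x / c + c) / 2 and e -> 0. When k > n,
   k is replaced by min(k, n). *)

Require Import Defs.
From HB Require Import structures.
From mathcomp Require Import all_boot all_order all_algebra.
From mathcomp Require Import all_classical all_reals all_analysis.
From mathcomp Require Import measurable_realfun complex ring lra.
Set Implicit Arguments.
Unset Strict Implicit.
Unset Printing Implicit Defensive.
Import Order.TTheory GRing.Theory Num.Theory.
Import numFieldNormedType.Exports.
Local Open Scope classical_set_scope.
Local Open Scope ring_scope.

(** * Stein's identity *)

Section NormalIntegral.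
Context {R : realType}.
Local Notation mu := (@lebesgue_measure R).
Local Notation phi := (@normal_pdf R 0 1).

(** The bound behind the expectation holds for every realization of Omega, full rank or not, and for
    every admissible choice of blocks and singular vectors; only tr K and |u_j^T Omega H|^2 remain
    random, with K = (G^T Omega Omega^T G + e)^-1 and u_j the eigenvectors of the tail. For fixed e
    > 0 the entries of K and H are bounded, which gives Stein's identity its integrability; the
    bounds uniform in e come out of the identity itself. The error need not be a measurable function
    of the sample, so its expectation is bounded through a measurable majorant. The Taylor
    polynomial is chosen for its relative accuracy: p <= exp keeps the tail of p(A) below that of
    exp(A), and p >= c exp with c = 1 - gamma^s / s! allows p(A) to be undone on the dominant
    eigenvectors at the price 1 / c, the source of the factor 1 / c^2. The argument yields 2 k / (l
    - k - 1) where the statement has 5 k / (l - k - 1). In the first term the factor 2 of the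
    truncation meets another 2, as the interpolant is compared with exp both on A and on T_q; the
    resulting 4 turns the 2^(4r+3) of Chebyshev interpolation at 2r+2 nodes into 2^(4r+1). *)

Lemma integral_normal_prob (f : R -> \bar R) :
  measurable_fun setT f ->
  (\int[normal_prob 0 1]_x `|f x| < +oo)%E ->
  (\int[normal_prob 0 1]_x f x = \int[mu]_x (f x * (phi x)%:E))%E.
Proof.
move=> mf finf.
have dom := @normal_prob_dominates R 0 1.
rewrite -(Radon_Nikodym_change_of_variables dom)//=; last first.
  by apply/integrableP; split.
apply: ae_eq_integral => //.
- apply: emeasurable_funM => //.
- apply: emeasurable_funM => //=; apply/measurableT_comp => //=.
  exact: measurable_normal_pdf.
- apply: ae_eqe_mul2l => /=.
  rewrite Radon_NikodymE//=.
  case: cid => /= h [h1 h2 h3].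
  apply: integral_ae_eq => //=.
  + by apply/measurableT_comp =>//; exact: measurable_normal_pdf.
  + by move=> E E01 mE; rewrite -h3//=.
Qed.

Lemma ge0_integral_normal_prob (f : R -> \bar R) :
  measurable_fun setT f -> (forall x, 0 <= f x)%E ->
  (\int[normal_prob 0 1]_x f x = \int[mu]_x (f x * (phi x)%:E))%E.
Proof.
move=> mf f0; have dom := @normal_prob_dominates R 0 1.
rewrite -(Radon_Nikodym_SigmaFinite.change_of_variables dom)//=.
have fi := Radon_Nikodym_SigmaFinite.f_integrable dom.
apply: ae_eq_integral => //.
- by apply: emeasurable_funM => //; apply: (measurable_int mu).
- apply: emeasurable_funM => //=; apply/measurableT_comp => //=.
  exact: measurable_normal_pdf.
- apply: ae_eqe_mul2l => /=.
  apply: integral_ae_eq => //=.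
  + by apply/measurableT_comp =>//; exact: measurable_normal_pdf.
  + by move=> E E01 mE; rewrite -Radon_Nikodym_SigmaFinite.f_integral.
Qed.

(** Half of the Gaussian exponent absorbs the weight and the other half is the density of variance
    2, which is integrable. With u = x^2 / 4 the 64 comes from 1 + 4 u <= 8 (1 + u / 2), squared,
    and 1 + u / 2 <= exp (u / 2). *)
Lemma sqr_normal_pdf_le (x : R) :
  (1 + x ^+ 2) ^+ 2 * phi x <=
  64 * normal_peak 1 / normal_peak (Num.sqrt 2) * normal_pdf 0 (Num.sqrt 2) x.
Proof.
have s2 : Num.sqrt 2 != 0 :> R by rewrite gt_eqF// sqrtr_gt0.
rewrite !normal_pdfE ?oner_neq0//.
have pk : normal_peak (Num.sqrt 2) != 0 :> R by rewrite gt_eqF// normal_peak_gt0.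
have pk1 := normal_peak_gt0 (oner_neq0 R).
rewrite /normal_fun !subr0 sqr_sqrtr// expr1n.
set p1 := normal_peak 1; set p2 := normal_peak _.
pose u := x ^+ 2 / 4.
have u0 : 0 <= u by rewrite /u divr_ge0 ?sqr_ge0.
rewrite (_ : x ^+ 2 = 4 * u); last by rewrite /u; field.
rewrite (_ : - (4 * u) / (1 *+ 2) = - u - u); last by field.
rewrite (_ : - (4 * u) / (2 *+ 2) = - u); last by field.
rewrite expRD.
have e1 : 1 + u / 2 <= expR (u / 2) by exact: expR_ge1Dx.
have e2 : expR (u / 2) ^+ 2 = expR u by rewrite -expRM_natl; congr expR; field.
have e3 : (1 + 4 * u) ^+ 2 <= 64 * expR u by rewrite -e2; nra.
have e4 : expR u * expR (- u) = 1 by rewrite -expRD subrr expR0.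
have e0 := expR_ge0 (- u).
have -> : 64 * p1 / p2 * (p2 * expR (- u)) = p1 * (64 * expR (- u)) by field.
rewrite mulrCA ler_pM2l//.
have -> : 64 * expR (- u) = 64 * expR u * (expR (- u) * expR (- u)).
  by rewrite !mulrA -(mulrA 64) e4 mulr1.
by rewrite ler_wpM2r// mulr_ge0.
Qed.

Lemma integrable_sqr_normal_pdf (g : R -> R) (C : R) :
  measurable_fun setT g -> (forall x, `|g x| <= C * (1 + x ^+ 2) ^+ 2) ->
  mu.-integrable setT (fun x => (g x * phi x)%:E).
Proof.
move=> mg gC.
have C0 : 0 <= C.
  by have := le_trans (normr_ge0 _) (gC 0); rewrite expr0n addr0 expr1n mulr1.
pose D : R := C * (64 * normal_peak 1 / normal_peak (Num.sqrt 2)).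
apply: (@le_integrable _ _ _ mu setT _ _
   (fun x => (D * normal_pdf 0 (Num.sqrt 2) x)%:E)) => //.
- apply/measurable_EFinP; apply: measurable_funM => //.
  exact: measurable_normal_pdf.
- move=> x _; rewrite /= lee_fin normrM (ger0_norm (normal_pdf_ge0 _ _ _)).
  rewrite [leRHS]ger0_norm; last first.
    by rewrite mulr_ge0 ?normal_pdf_ge0// mulr_ge0// divr_ge0 ?mulr_ge0 ?normal_peak_ge0.
  rewrite (le_trans (ler_wpM2r (normal_pdf_ge0 _ _ _) (gC x)))//.
  by rewrite /D -!mulrA ler_wpM2l// !mulrA sqr_normal_pdf_le.
- under eq_fun do rewrite EFinM.
  by apply: integrableZl => //; exact: integrable_normal_pdf.
Qed.

Lemma integrable_normal_prob (g : R -> R) (C : R) :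
  measurable_fun setT g -> (forall x, `|g x| <= C * (1 + x ^+ 2) ^+ 2) ->
  (normal_prob 0 1).-integrable setT (EFin \o g).
Proof.
move=> mg gC; apply/integrableP; split; first exact/measurable_EFinP.
rewrite ge0_integral_normal_prob//=; last first.
  by apply/measurable_EFinP; exact: measurableT_comp.
have /integrableP[_] : mu.-integrable setT (fun x => (`|g x| * phi x)%:E).
  apply: (@integrable_sqr_normal_pdf _ C); first exact: measurableT_comp.
  by move=> x; rewrite normr_id.
apply: le_lt_trans; apply: ge0_le_integral => //=.
- by move=> x _; rewrite -EFinM lee_fin mulr_ge0// normal_pdf_ge0.
- apply: emeasurable_funM.
    by apply/measurable_EFinP; exact: measurableT_comp.
  by apply/measurable_EFinP; exact: measurable_normal_pdf.
- apply/measurable_EFinP; apply: measurableT_comp => //; apply: measurable_funM.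
    exact: measurableT_comp.
  exact: measurable_normal_pdf.
- by move=> x _; rewrite -EFinM lee_fin ler_norm.
Qed.

Lemma Rintegral_normal_prob (g : R -> R) (C : R) :
  measurable_fun setT g -> (forall x, `|g x| <= C * (1 + x ^+ 2) ^+ 2) ->
  (\int[normal_prob 0 1]_x g x = \int[mu]_x (g x * phi x))%R.
Proof.
move=> mg gC; rewrite /Rintegral integral_normal_prob//.
- exact/measurable_EFinP.
- by have /integrableP[] := integrable_normal_prob mg gC.
Qed.

(** The fundamental theorem of calculus gives the integral over [-n, n] as a difference of values of
    [G]; dominated convergence, with |g| as majorant, passes to the whole line. *)
Lemma integral_is_derive_cvg0 (G g : R -> R) :
  (forall x : R, is_derive x 1 G (g x)) -> continuous g ->
  mu.-integrable setT (EFin \o g) ->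
  G n%:R @[n --> \oo] --> 0 -> G (- n%:R) @[n --> \oo] --> 0 ->
  (\int[mu]_x g x = 0)%R.
Proof.
move=> dG cg ig Gp Gm.
have cG : continuous G.
  by move=> x; apply: differentiable_continuous; apply/derivable1_diffP; case: (dG x).
pose g_ (n : nat) : R -> \bar R := (EFin \o g) \_ `[- n%:R, n%:R].
have mg : measurable_fun setT (EFin \o g) by exact: measurable_int ig.
have mg_ n : measurable_fun setT (g_ n).
  by apply/measurable_restrict => //; rewrite setTI; exact: measurable_funS mg.
have [_ _] : [/\ mu.-integrable setT (EFin \o g),
   [sequence (\int[mu]_x (`|g_ n x - (EFin \o g) x|))%E]_n @ \oo --> 0%E &
   [sequence (\int[mu]_x (g_ n x))%E]_n @ \oo --> (\int[mu]_x (EFin \o g) x)%E ].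
  apply: (@dominated_convergence _ _ R mu setT measurableT g_
    (EFin \o g) (abse \o (EFin \o g))) => //.
  - apply: aeW => /= x _; apply: cvg_near_cst.
    have [N xN] : exists N : nat, `|x| <= N%:R.
      by exists (Num.truncn `|x|).+1; rewrite ltW// truncnS_gt.
    exists N => // n /= Nn; rewrite /g_ patchE mem_set//= in_itv/= -ler_norml.
    by rewrite (le_trans xN)// ler_nat.
  - exact: integrable_abse.
  - apply: aeW => /= x n _; rewrite /g_ patchE; case: ifPn => // _.
    by rewrite /= normr0 lee_fin.
have -> : [sequence (\int[mu]_x g_ n x)%E]_n = (fun n => (G n%:R - G (- n%:R))%:E).
  apply/funext => n /=; rewrite /g_ -integral_mkcond.
  have [->|n0] := eqVneq n 0.
    by rewrite oppr0 subrr set_itv1 integral_set1.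
  rewrite EFinB -(@continuous_FTC2 _ g)//.
  - by rewrite gtrN// ltr0n lt0n.
  - by apply: continuous_subspaceT.
  - split.
    + by move=> x _; case: (dG x).
    + by apply: cvg_at_right_filter; exact: cG.
    + by apply: cvg_at_left_filter; exact: cG.
  - by move=> x _; rewrite derive1E; apply: derive_val.
move=> H; rewrite /Rintegral.
have H0 : ((G n%:R - G (- n%:R))%:E @[n --> \oo] --> (0 - 0)%:E)%E.
  by apply: cvg_EFin; [exact: nearW|apply: cvgB].
rewrite /Rintegral (_ : integral _ _ _ = integral mu setT (EFin \o g))//.
by rewrite -(cvg_lim (@ereal_hausdorff R) H) (cvg_lim (@ereal_hausdorff R) H0) subrr.
Qed.

(** Integration by parts: as phi' = - x phi, the difference of the integrands is the derivative of -
    f phi. The boundary terms are O(1 / (n + 1)), because (1 + x^2)^2 phi is bounded, f costs one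
    factor 1 + x^2, and n + 1 <= 1 + n^2. *)
Lemma stein_identity (f f' : R -> R) (C : R) :
  (forall x : R, is_derive x 1 f (f' x)) -> continuous f' ->
  (forall x, `|f x| <= C * (1 + x ^+ 2)) ->
  (forall x, `|f' x| <= C * (1 + x ^+ 2)) ->
  (\int[normal_prob 0 1]_x (x * f x)%:E = \int[normal_prob 0 1]_x (f' x)%:E)%E.
Proof.
move=> df cf' fC f'C.
have cf : continuous f.
  by move=> x; apply: differentiable_continuous; apply/derivable1_diffP; case: (df x).
have mf : measurable_fun setT f by exact: continuous_measurable_fun.
have mf' : measurable_fun setT f' by exact: continuous_measurable_fun.
have C0 : 0 <= C.
  by have := le_trans (normr_ge0 _) (fC 0); rewrite expr0n addr0 mulr1.
have f'C2 x : `|f' x| <= C * (1 + x ^+ 2) ^+ 2.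
  rewrite (le_trans (f'C x))// ler_wpM2l// expr2 ler_peMr ?lerDl ?sqr_ge0//.
  by rewrite addr_ge0 ?sqr_ge0.
have xfC2 x : `|x * f x| <= C * (1 + x ^+ 2) ^+ 2.
  rewrite normrM expr2 mulrA mulrC ler_pM//.
  by rewrite -(real_normK (num_real x)); have := sqr_ge0 (`|x| - 1); nra.
have mxf : measurable_fun setT (fun x : R => x * f x) by exact: measurable_funM.
have ixf := integrable_normal_prob mxf xfC2.
have if' := integrable_normal_prob mf' f'C2.
rewrite -[LHS]fineK; last exact: integrable_fin_num ixf.
rewrite -[RHS]fineK; last exact: integrable_fin_num if'.
congr (_%:E).
rewrite -/(Rintegral (normal_prob 0 1) setT (fun x : R => x * f x)).
rewrite -/(Rintegral (normal_prob 0 1) setT f').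
rewrite (Rintegral_normal_prob mxf xfC2) (Rintegral_normal_prob mf' f'C2).
apply/eqP; rewrite -subr_eq0.
rewrite -RintegralB//; [|exact: integrable_sqr_normal_pdf xfC2|exact: integrable_sqr_normal_pdf f'C2].
have fphi_le (x : R) (n : nat) : x ^+ 2 = n%:R ^+ 2 ->
    `|- (f x * phi x)| <= 64 * C * normal_peak 1 * harmonic n.
  move=> xn; rewrite normrN normrM (ger0_norm (normal_pdf_ge0 _ _ _)) /=.
  have pub : (1 + x ^+ 2) ^+ 2 * phi x <= 64 * normal_peak 1.
    have pk : 0 < normal_peak (Num.sqrt 2) :> R.
      by rewrite normal_peak_gt0// gt_eqF// sqrtr_gt0.
    rewrite (le_trans (sqr_normal_pdf_le x))// -mulrA mulrC.
    rewrite ler_piMl ?mulr_ge0 ?normal_peak_ge0// mulrC.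
    by rewrite ler_pdivrMr// mul1r normal_pdf_ub// gt_eqF// sqrtr_gt0.
  rewrite ler_pdivlMr// (le_trans (ler_wpM2r _ (ler_wpM2r _ (fC x))))//.
    by rewrite normal_pdf_ge0.
  rewrite -!mulrA [leRHS]mulrCA ler_wpM2l//.
  apply: le_trans pub; rewrite (expr2 (1 + _)) -mulrA ler_wpM2l ?addr_ge0 ?sqr_ge0//.
  rewrite mulrC ler_wpM2r ?normal_pdf_ge0// xn -natr1 addrC lerD2l.
  by rewrite -natrX ler_nat; case: (n) => // m; rewrite expnS expn1 leq_pmulr.
have cvg0 (u : nat -> R) :
    (forall n, `|u n| <= 64 * C * normal_peak 1 * harmonic n) -> u n @[n --> \oo] --> 0.
  move=> uh; have h0 : 64 * C * normal_peak 1 * harmonic n @[n --> \oo] --> 0.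
    by rewrite -[X in _ --> X](mulr0 (64 * C * normal_peak 1)); apply: cvgMr; exact: cvg_harmonic.
  have h0N : - (64 * C * normal_peak 1 * harmonic n) @[n --> \oo] --> 0.
    by rewrite -[X in _ --> X]oppr0; exact: cvgN.
  by apply: (squeeze_cvgr _ h0N h0); apply: nearW => n; rewrite -ler_norml.
have dphi (x : R) : is_derive x 1 phi (- x * phi x).
  rewrite normal_pdfE ?oner_neq0//.
  apply: is_derive_eq.
  rewrite /GRing.scale/= /normal_fun !subr0.
  by set E := expR _; field.
apply/eqP.
apply: (@integral_is_derive_cvg0 (fun x => - (f x * phi x)) (fun x => x * f x * phi x - f' x * phi x)).
- move=> x; apply: is_derive_eq.
  by rewrite /GRing.scale/=; ring.
- move=> x; apply: cvgB; apply: cvgM => //.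
  + by apply: cvgM; [exact: cvg_id|exact: cf].
  + exact: continuous_normal_pdf (oner_neq0 R) x.
  + exact: cf'.
  + exact: continuous_normal_pdf (oner_neq0 R) x.
- have := integrableB measurableT (integrable_sqr_normal_pdf mxf xfC2)
    (integrable_sqr_normal_pdf mf' f'C2).
  by apply: eq_integrable => // x _ /=; rewrite EFinB.
- by apply: (cvg0 (fun n => - (f n%:R * phi n%:R))) => n; exact: fphi_le.
- apply: (cvg0 (fun n => - (f (- n%:R) * phi (- n%:R)))) => n.
  by apply: fphi_le; rewrite sqrrN.
Qed.

End NormalIntegral.

(** * One coordinate of an independent Gaussian family *)

Definition update {I : eqType} {V : Type} (v : I -> V) (i : I) (x : V) : I -> V :=
  fun j => if j == i then x else v j.

Lemma update_id {I : eqType} {V : Type} (v : I -> V) i : update v i (v i) = v.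
Proof. by apply/funext => j; rewrite /update; case: eqP => // ->. Qed.

Lemma updateK {I : eqType} {V : Type} (v : I -> V) i x y :
  update (update v i x) i y = update v i y.
Proof. by apply/funext => j; rewrite /update; case: eqP. Qed.

(* F (Y_j)_j is a measurable function of the finitely many real variables Y_j *)
Definition measurable_functional {R : realType} {I : Type} (F : (I -> R) -> R) :=
  forall d (T : measurableType d) (Y : I -> T -> R),
    (forall j, measurable_fun setT (Y j)) ->
    measurable_fun setT (fun t => F (fun j => Y j t)).

Section OneCoordinate.
Context {R : realType} {d : measure_display} {T : measurableType d}.
Variables (P : probability T R) (I : finType) (X : I -> {RV P >-> R}).
Hypothesis gaussX : forall i (B : set R), measurable B ->
  distribution P (X i) B = normal_prob 0 1 B.
Hypothesis indepX : mutually_independent X.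
Variable i : I.

(** A pi-system of events that depend only on the variables other than [X i]. The sigma-algebra it
    generates is the second factor of a product whose first factor carries [X i]. *)
Let cyl : set (set T) := [set C | exists2 B : I -> set R,
  forall j, measurable (B j) &
  C = \bigcap_(j in [set j | j \in [set~ i]%SET]) (X j @^-1` B j)].

Let mpreX j (B : set R) : measurable B -> measurable (X j @^-1` B).
Proof. by move=> mB; rewrite -[X in measurable X]setTI; exact: measurable_funPT. Qed.

Let sub_cyl : cyl `<=` measurable.
Proof.
move=> _ [B mB ->]; apply: fin_bigcap_measurable => // j _; exact: mpreX.
Qed.

Let setI_closed_cyl : setI_closed cyl.
Proof.
move=> _ _ [B mB ->] [C mC ->]; exists (fun j => B j `&` C j).
  by move=> j; apply: measurableI.
rewrite -bigcapI; apply: eq_bigcapr => j _; by rewrite preimage_setI.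
Qed.

Let cylT : cyl setT.
Proof.
by exists (fun=> setT) => //; apply/esym/seteqP; split.
Qed.

Let T' := g_sigma_algebraType cyl.

(** For fixed [B] both sides are finite measures in [E], so equality on the pi-system suffices.
    There it follows from independence applied twice: to the other indices, and to all indices with
    [B] at place [i]. *)
Lemma cyl_independent (B : set R) (E : set T) : measurable B -> <<s cyl >> E ->
  P (E `&` X i @^-1` B) = (P (X i @^-1` B) * P E)%E.
Proof.
move=> mB sE; have mD := mpreX i mB.
pose c : {nonneg R} := NngNum (fine_ge0 (measure_ge0 P (X i @^-1` B))).
have cE : (c%:num)%:E = P (X i @^-1` B).
  by rewrite /= fineK// fin_num_measure.
rewrite -cE; pose m1 : {measure set T -> \bar R} := mrestr P mD.
pose m2 : {measure set T -> \bar R} := mscale c P.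
rewrite -[LHS]/(m1 E) -[RHS]/(m2 E).
apply: (@g_sigma_algebra_measure_unique _ R T cyl sub_cyl (fun=> setT) (fun=> cylT)
   _ m1 m2 setI_closed_cyl) sE => //.
- by rewrite bigcup_const//; exists 0%N.
- move=> _ [C mC ->]; rewrite /m1 /m2 /= /mrestr /mscale cE.
  set PC := (X in (_ * X)%E); have {PC}-> : PC = _ := indepX [set~ i]%SET mC.
  pose C' j := if j == i then B else C j.
  have mC' j : measurable (C' j) by rewrite /C'; case: ifP.
  have := indepX [set: I]%SET mC'; rewrite (bigD1 i)//= {2}/C' eqxx => E1.
  transitivity (P (\bigcap_(i0 in [set i1 | i1 \in [set: I]%SET]) X i0 @^-1` C' i0)).
    congr (P _); apply/seteqP; split => [x [/= H1 H2] j _|x H].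
      by rewrite /C'; case: eqP => [->//|/eqP ji]; apply: H1; rewrite /= !inE.
    split; last by have := H i; rewrite /C' eqxx; apply; rewrite /= inE.
    move=> j /=; rewrite !inE => ji; have := H j; rewrite /C' (negbTE ji).
    by apply; rewrite /= inE.
  apply: etrans E1 _; congr (_ * _)%E; apply: eq_big => j; first by rewrite !inE.
  by rewrite /C' => /andP[_ /negbTE ->].
- by move=> _; rewrite /m1 /= /mrestr setTI (le_lt_trans (probability_le1 P mD))// ltry.
Qed.

Let mid : measurable_fun setT (fun w : T => (w : T')).
Proof.
move=> _ E mE; rewrite setTI.
exact: (smallest_sub (sigma_algebra_measurable T) sub_cyl).
Qed.

(** The identity, seen as a map to the coarser sigma-algebra; its law [P'] is the restriction of [P]
    to the events in the other variables. *)
Let idT' : {mfun T >-> T'} :=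
  MeasurableFun.Pack (MeasurableFun.Class (isMeasurableFun.Build _ _ _ _ _ mid)).

Let P' : probability T' R := distribution P idT'.

Let RR := measurableTypeR R.

Let mXi : measurable_fun setT (fun w : T => (X i w : RR)).
Proof. by move=> _ B mB; exact: (@measurable_funPT _ _ _ _ (X i)). Qed.

Let mpair : measurable_fun setT (fun w : T => (X i w : RR, (w : T'))).
Proof. exact: measurable_fun_pair. Qed.

Let pairX : {mfun T >-> (RR * T')%type} :=
  MeasurableFun.Pack (MeasurableFun.Class (isMeasurableFun.Build _ _ _ _ _ mpair)).

Let distr_pairX (E : set (RR * T')) : measurable E ->
  (normal_prob 0 1 \x P')%E E = distribution P pairX E.
Proof.
move=> mE; apply: (@product_measure_unique _ _ _ _ R (normal_prob 0 1) P' (distribution P pairX)) => // B C mB mC.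
transitivity (P (X i @^-1` B) * P C)%E; last by congr (_ * _)%E; exact: gaussX.
transitivity (P (C `&` X i @^-1` B)); last exact: cyl_independent.
by congr (P _); apply/seteqP; split => [x []|x []].
Qed.

(** The law of [X i] paired with the other variables is a product by [distr_pairX], so Fubini's
    theorem integrates [X i] first, with the other variables frozen. *)
Lemma integral_coordinate (g : RR * T' -> \bar R) :
  measurable_fun setT g -> P.-integrable setT (g \o pairX) ->
  (\int[P]_w g (X i w, w) = \int[P']_w \int[normal_prob 0 1]_x g (x, w))%E.
Proof.
move=> mg ig.
have E (h : RR * T' -> \bar R) :
    (\int[distribution P pairX]_z h z = \int[normal_prob 0 1 \x P']_z h z)%E.
  by apply: eq_measure_integral => A mA _; exact/esym/distr_pairX.
transitivity (\int[distribution P pairX]_z g z)%E; first by rewrite integral_distribution.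
rewrite E -integral21_prod_meas1//.
apply/integrableP; split => //; rewrite -E ge0_integral_distribution//.
  by have /integrableP[] := ig.
exact: measurableT_comp.
Qed.

Let mX j : j != i -> measurable_fun setT (fun w : T' => X j w).
Proof.
move=> ji _ B mB; rewrite setTI; apply: sub_sigma_algebra.
exists (fun j' => if j' == j then B else setT) => [j'|]; first by case: ifP.
apply/seteqP; split => [x Bx j' _|x H]; first by case: eqP => [->|].
by have := H j; rewrite eqxx; apply; rewrite /= !inE.
Qed.

(** [X i] need not be measurable for [T'], but [update] overwrites exactly that coordinate. *)
Lemma measurable_functional_coordinate (F : (I -> R) -> R) :
  measurable_functional F ->
  measurable_fun setT (fun z : RR * T' => F (update (fun j => X j z.2) i z.1)).
Proof.
move=> mF; apply: (mF _ _ (fun j (z : RR * T') => if j == i then z.1 else X j z.2)) => j.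
have [ji|ji] := boolP (j == i); first exact: measurable_fst.
by apply: measurableT_comp; [exact: mX|exact: measurable_snd].
Qed.

Lemma stein_coordinate (F dF : (I -> R) -> R) (C : R) :
  measurable_functional F -> measurable_functional dF ->
  (forall v : I -> R, is_derive (v i) 1 (fun x : R => F (update v i x)) (dF v)) ->
  (forall v : I -> R, continuous (fun x : R => dF (update v i x))) ->
  (forall v, `|F v| <= C * (1 + \sum_j `|v j|) ^+ 2) ->
  (forall v, `|dF v| <= C * (1 + \sum_j `|v j|) ^+ 2) ->
  P.-integrable setT (EFin \o (fun w => X i w * F (X ^~ w))) ->
  P.-integrable setT (EFin \o (fun w => dF (X ^~ w))) ->
  (\int[P]_w (X i w * F (X ^~ w)) = \int[P]_w dF (X ^~ w))%R.
Proof.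
move=> mF mdF DF cdF FC dFC iXF idF; rewrite /Rintegral; congr (fine _).
have E w : update (X ^~ w) i (X i w) = X ^~ w by rewrite update_id.
transitivity (\int[P']_w \int[normal_prob 0 1]_x (x * F (update (X ^~ w) i x))%:E)%E.
  rewrite -(@integral_coordinate (fun z => (z.1 * F (update (X ^~ z.2) i z.1))%:E)).
  - by apply: eq_integral => w _; rewrite /= E.
  - apply/measurable_EFinP; apply: measurable_funM; first exact: measurable_fst.
    exact: measurable_functional_coordinate.
  - by apply: eq_integrable iXF => // w _; rewrite /= E.
transitivity (\int[P']_w \int[normal_prob 0 1]_x (dF (update (X ^~ w) i x))%:E)%E; last first.
  rewrite -(@integral_coordinate (fun z => (dF (update (X ^~ z.2) i z.1))%:E)).
  - by apply: eq_integral => w _; rewrite /= E.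
  - by apply/measurable_EFinP; exact: measurable_functional_coordinate.
  - by apply: eq_integrable idF => // w _; rewrite /= E.
apply: eq_integral => w _; set v := X ^~ w.
have bnd x : C * (1 + \sum_j `|update v i x j|) ^+ 2 <=
    2 * `|C| * (1 + \sum_j `|v j|) ^+ 2 * (1 + x ^+ 2).
  have S0 : 0 <= \sum_j `|v j| by exact: sumr_ge0.
  have Sx : \sum_j `|update v i x j| <= `|x| + \sum_j `|v j|.
    rewrite (bigD1 i)//= [X in _ <= _ + X](bigD1 i)//= /update eqxx lerD2l.
    rewrite (eq_bigr (fun j => `|v j|)) ?lerDr// => j /negbTE -> //.
  have Su : 0 <= \sum_j `|update v i x j| by exact: sumr_ge0.
  apply: (@le_trans _ _ (`|C| * (1 + \sum_j `|update v i x j|) ^+ 2)).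
    by rewrite ler_wpM2r ?sqr_ge0// ler_norm.
  rewrite mulrAC -!mulrA mulrCA ler_wpM2l// -(real_normK (num_real x)).
  set a := \sum_j _ in S0 Sx *; set b := \sum_j _ in Sx Su *; set c := `|x| in Sx *.
  have c0 : 0 <= c by exact: normr_ge0.
  have : (1 + b) ^+ 2 <= (1 + a + c) ^+ 2.
    by rewrite ler_sqr ?nnegrE; lra.
  have : 0 <= (1 + a - c) ^+ 2 by exact: sqr_ge0.
  have : 0 <= c ^+ 2 * (a * (2 + a)) by rewrite mulr_ge0 ?sqr_ge0// mulr_ge0//; lra.
  nra.
have dFx (x : R) : is_derive x 1 (fun y => F (update v i y)) (dF (update v i x)).
  have := DF (update v i x); rewrite {1}/update eqxx.
  by under eq_fun do rewrite updateK.
exact: stein_identity dFx (cdF v) (fun x => le_trans (FC _) (bnd x))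
  (fun x => le_trans (dFC _) (bnd x)).
Qed.

End OneCoordinate.

Section GaussianFamily.
Context {R : realType} {d : measure_display} {T : measurableType d}.
Variables (P : probability T R) (I : finType) (X : I -> {RV P >-> R}).
Hypothesis gaussX : forall i (B : set R), measurable B ->
  distribution P (X i) B = normal_prob 0 1 B.
Hypothesis indepX : mutually_independent X.

Let mX (j : I) : measurable_fun setT (fun w => X j w).
Proof. exact: measurable_funPT. Qed.

Lemma integrable_sqr_gaussian j : P.-integrable setT (EFin \o (fun w => X j w ^+ 2)).
Proof.
have mX2 : measurable_fun setT (fun x : measurableTypeR R => x ^+ 2) by exact: measurable_funX.
have /integrableP[m2 fin2] : (normal_prob 0 1).-integrable setT (EFin \o (fun x : measurableTypeR R => x ^+ 2)).
  apply: (@integrable_normal_prob _ _ 1) => // x; rewrite mul1r ger0_norm ?sqr_ge0//.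
  rewrite -subr_ge0 (_ : _ - _ = 1 + x ^+ 2 + x ^+ 2 ^+ 2); last by ring.
  by rewrite !addr_ge0 ?sqr_ge0.
have mXj : measurable_fun setT (fun w : T => (X j w : measurableTypeR R)).
  by move=> _ B mB; exact: (@measurable_funPT _ _ _ _ (X j)).
pose Xj : {mfun T >-> measurableTypeR R} :=
  MeasurableFun.Pack (MeasurableFun.Class (isMeasurableFun.Build _ _ _ _ _ mXj)).
apply/integrableP; split.
  by apply/measurable_EFinP; exact: measurable_funX.
have <- : (\int[distribution P Xj]_x `|(x ^+ 2)%:E| = \int[P]_w `|(X j w ^+ 2)%:E|)%E.
  by rewrite ge0_integral_distribution//; exact: measurableT_comp.
apply: le_lt_trans fin2; rewrite le_eqVlt; apply/orP; left; apply/eqP.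
by apply: eq_measure_integral => A mA _; exact: gaussX.
Qed.

(** Second moments are enough: (1 + b + a)^2 <= 2 (1 + b)^2 + 2 a^2 adds one variable at a time. *)
Lemma integrable_gaussian_growth (F : (I -> R) -> R) (C : R) :
  measurable_functional F ->
  (forall v, `|F v| <= C * (1 + \sum_j `|v j|) ^+ 2) ->
  P.-integrable setT (EFin \o (fun w => F (X ^~ w))).
Proof.
move=> mF FC; have mFX : measurable_fun setT (fun w => F (X ^~ w)) by exact: mF.
suff H : P.-integrable setT (EFin \o (fun w => (1 + \sum_j `|X j w|) ^+ 2)).
  apply: (@le_integrable _ _ _ P setT _ _ (fun w => (C%:E * ((1 + \sum_j `|X j w|) ^+ 2)%:E)%E)) => //.
  - exact/measurable_EFinP.
  - by move=> w _; rewrite -EFinM /= lee_fin (le_trans (FC _))// ler_norm.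
  - exact: integrableZl.
suff H (s : seq I) : measurable_fun setT (fun w => \sum_(j <- s) `|X j w|) /\
    P.-integrable setT (EFin \o (fun w => (1 + \sum_(j <- s) `|X j w|) ^+ 2)).
  by case: (H (index_enum I)).
elim: s => [|j s [ms Hs]].
  under eq_fun do rewrite big_nil.
  under [X in _ .-integrable _ (EFin \o X)]eq_fun do rewrite big_nil.
  split=> //; exact: finite_measure_integrable_cst.
have mj : measurable_fun setT (fun w => \sum_(j <- j :: s) `|X j w|).
  under eq_fun do rewrite big_cons.
  by apply: measurable_funD => //; exact: measurableT_comp.
split=> //.
apply: (@le_integrable _ _ _ P setT _ _ (fun w =>
  (2%:E * ((1 + \sum_(j <- s) `|X j w|) ^+ 2)%:E + 2%:E * (X j w ^+ 2)%:E)%E)) => //.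
- by apply/measurable_EFinP; apply: measurable_funX; exact: measurable_funD.
- move=> w _; rewrite -!EFinM -EFinD /= lee_fin ger0_norm ?sqr_ge0//.
  rewrite [leRHS]ger0_norm; last by rewrite addr_ge0// mulr_ge0// sqr_ge0.
  rewrite big_cons.
  rewrite -(real_normK (num_real (X j w))).
  set a := `|_|; set b := \sum_(_ <- _) _; have := sqr_ge0 (1 + b - a); nra.
- by apply: integrableD => //; apply: integrableZl => //; exact: integrable_sqr_gaussian.
Qed.

Lemma stein_gaussian (i : I) (F dF : (I -> R) -> R) (C : R) :
  measurable_functional F -> measurable_functional dF ->
  (forall v : I -> R, is_derive (v i) 1 (fun x : R => F (update v i x)) (dF v)) ->
  (forall v : I -> R, continuous (fun x : R => dF (update v i x))) ->
  (forall v, `|F v| <= C * (1 + \sum_j `|v j|)) ->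
  (forall v, `|dF v| <= C * (1 + \sum_j `|v j|) ^+ 2) ->
  (\int[P]_w (X i w * F (X ^~ w)) = \int[P]_w dF (X ^~ w))%R.
Proof.
move=> mF mdF DF cdF FC dFC.
have C0 : 0 <= C.
  have := le_trans (normr_ge0 _) (FC (fun=> 0)).
  by rewrite big1 ?addr0 ?mulr1// => j _; rewrite normr0.
have S1 (v : I -> R) : 1 <= 1 + \sum_j `|v j| by rewrite lerDl sumr_ge0.
apply: (@stein_coordinate _ _ _ _ _ _ _ _ _ _ _ C) => //.
- move=> v; rewrite (le_trans (FC v))// ler_wpM2l// expr2 ler_peMr//.
  exact: le_trans (S1 v).
- apply: (@integrable_gaussian_growth (fun v => v i * F v) C).
    by move=> d' T' Y mY; apply: measurable_funM => //; exact: mF.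
  move=> v; rewrite normrM (le_trans (ler_wpM2l (normr_ge0 _) (FC v)))//.
  rewrite mulrCA ler_wpM2l// expr2; apply: ler_wpM2r; first exact: le_trans (S1 v).
  by rewrite (bigD1 i)//= addrCA lerDl addr_ge0// sumr_ge0.
- exact: integrable_gaussian_growth dFC.
Qed.

End GaussianFamily.

(** * Frobenius norm, spectral theorem and truncated SVD *)

Section Frobenius.
Context {R : realType}.

Definition sqnorm m n (A : 'M[R]_(m, n)) : R := \sum_i \sum_j A i j ^+ 2.

Definition frobdot m n (A B : 'M[R]_(m, n)) : R := \sum_i \sum_j A i j * B i j.

Lemma sqnormE m n (A : 'M[R]_(m, n)) : sqnorm A = \tr (A^T *m A).
Proof.
rewrite /mxtrace /sqnorm exchange_big; apply: eq_bigr => j _; rewrite mxE.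
by apply: eq_bigr => i _; rewrite !mxE expr2.
Qed.

Lemma frobdotE m n (A B : 'M[R]_(m, n)) : frobdot A B = \tr (A^T *m B).
Proof.
rewrite /mxtrace /frobdot exchange_big; apply: eq_bigr => j _; rewrite mxE.
by apply: eq_bigr => i _; rewrite !mxE.
Qed.

Lemma sqnorm_ge0 m n (A : 'M[R]_(m, n)) : 0 <= sqnorm A.
Proof. by apply: sumr_ge0 => i _; apply: sumr_ge0 => j _; exact: sqr_ge0. Qed.

Lemma sqnorm_eq0 m n (A : 'M[R]_(m, n)) : sqnorm A = 0 -> A = 0.
Proof.
move/eqP; rewrite psumr_eq0 => [/allP A0|i _]; last first.
  by apply: sumr_ge0 => j _; exact: sqr_ge0.
apply/matrixP => i j; have := A0 i; rewrite mem_index_enum => /(_ isT) /=.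
rewrite psumr_eq0 => [/allP /(_ j)|k _]; last exact: sqr_ge0.
by rewrite mem_index_enum => /(_ isT); rewrite /= sqrf_eq0 mxE => /eqP.
Qed.

Lemma sqnorm_tr m n (A : 'M[R]_(m, n)) : sqnorm A^T = sqnorm A.
Proof.
rewrite /sqnorm exchange_big; apply: eq_bigr => i _; apply: eq_bigr => j _.
by rewrite mxE.
Qed.

Lemma sqnormZ m n c (A : 'M[R]_(m, n)) : sqnorm (c *: A) = c ^+ 2 * sqnorm A.
Proof.
rewrite /sqnorm mulr_sumr; apply: eq_bigr => i _; rewrite mulr_sumr.
by apply: eq_bigr => j _; rewrite mxE exprMn.
Qed.

Lemma sqnormD m n (A B : 'M[R]_(m, n)) :
  sqnorm (A + B) = sqnorm A + 2 * frobdot A B + sqnorm B.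
Proof.
rewrite /sqnorm /frobdot mulr_sumr -!big_split /=; apply: eq_bigr => i _.
rewrite mulr_sumr -!big_split /=; apply: eq_bigr => j _.
by rewrite mxE; ring.
Qed.

Lemma sqnormN m n (A : 'M[R]_(m, n)) : sqnorm (- A) = sqnorm A.
Proof. by rewrite -scaleN1r sqnormZ sqrrN expr1n mul1r. Qed.

Lemma frobdotNr m n (A B : 'M[R]_(m, n)) : frobdot A (- B) = - frobdot A B.
Proof.
rewrite /frobdot -sumrN; apply: eq_bigr => i _; rewrite -sumrN.
by apply: eq_bigr => j _; rewrite mxE mulrN.
Qed.

Lemma frobdotZr m n c (A B : 'M[R]_(m, n)) : frobdot A (c *: B) = c * frobdot A B.
Proof.
rewrite /frobdot mulr_sumr; apply: eq_bigr => i _; rewrite mulr_sumr.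
by apply: eq_bigr => j _; rewrite mxE mulrCA.
Qed.

Lemma frobdot_sqr_le m n (A B : 'M[R]_(m, n)) :
  frobdot A B ^+ 2 <= sqnorm A * sqnorm B.
Proof.
have [B0|B0] := eqVneq (sqnorm B) 0.
  rewrite (sqnorm_eq0 B0) /frobdot big1 ?expr0n ?mulr_ge0 ?sqnorm_ge0// => i _.
  by rewrite big1// => j _; rewrite mxE mulr0.
have Bgt0 : 0 < sqnorm B by rewrite lt_neqAle eq_sym B0 sqnorm_ge0.
have := sqnorm_ge0 (sqnorm B *: A - frobdot A B *: B).
rewrite sqnormD sqnormN frobdotNr frobdotZr !sqnormZ.
rewrite (_ : frobdot (sqnorm B *: A) B = sqnorm B * frobdot A B); last first.
  rewrite /frobdot mulr_sumr; apply: eq_bigr => i _; rewrite mulr_sumr.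
  by apply: eq_bigr => j _; rewrite mxE mulrA.
rewrite (_ : _ + _ + _ = sqnorm B * (sqnorm A * sqnorm B - frobdot A B ^+ 2)); last by ring.
by rewrite pmulr_rge0// subr_ge0.
Qed.

Lemma frobenius_normE m n (A : 'M[R]_(m, n)) : frobenius_norm A = Num.sqrt (sqnorm A).
Proof. by []. Qed.

Lemma frobenius_norm_ge0 m n (A : 'M[R]_(m, n)) : 0 <= frobenius_norm A.
Proof. exact: sqrtr_ge0. Qed.

Lemma sqr_frobenius_norm m n (A : 'M[R]_(m, n)) : frobenius_norm A ^+ 2 = sqnorm A.
Proof. by rewrite frobenius_normE sqr_sqrtr// sqnorm_ge0. Qed.

Lemma frobenius_normN m n (A : 'M[R]_(m, n)) : frobenius_norm (- A) = frobenius_norm A.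
Proof. by rewrite !frobenius_normE sqnormN. Qed.

Lemma frobenius_normD m n (A B : 'M[R]_(m, n)) :
  frobenius_norm (A + B) <= frobenius_norm A + frobenius_norm B.
Proof.
rewrite -ler_sqr ?nnegrE ?addr_ge0 ?frobenius_norm_ge0// sqrrD !sqr_frobenius_norm.
rewrite sqnormD lerD2r lerD2l -[leRHS]mulr_natl ler_wpM2l//.
rewrite (le_trans (ler_norm _))// -ler_sqr ?nnegrE ?mulr_ge0 ?frobenius_norm_ge0//.
by rewrite real_normK ?num_real// exprMn !sqr_frobenius_norm frobdot_sqr_le.
Qed.

Lemma sqnormM_le m n p (A : 'M[R]_(m, n)) (B : 'M[R]_(n, p)) :
  sqnorm (A *m B) <= sqnorm A * sqnorm B.
Proof.
rewrite -(sqnorm_tr B) /sqnorm mulr_suml; apply: ler_sum => i _.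
rewrite mulr_sumr; apply: ler_sum => j _.
have := frobdot_sqr_le (row i A) (col j B)^T.
rewrite /frobdot /sqnorm !big_ord1 mxE.
under eq_bigr do rewrite !mxE.
under [X in _ <= X * _]eq_bigr do rewrite !mxE.
by under [X in _ <= _ * X]eq_bigr do rewrite !mxE; under [X in _ -> _ <= _ * X]eq_bigr do rewrite mxE.
Qed.

Lemma sqnorm_orthonormal_l m n p (Q : 'M[R]_(m, n)) (A : 'M[R]_(n, p)) :
  orthonormal_cols Q -> sqnorm (Q *m A) = sqnorm A.
Proof.
by move=> oQ; rewrite !sqnormE trmx_mul -mulmxA (mulmxA Q^T) oQ mul1mx.
Qed.

Lemma sqnorm_orthonormal_r m n p (Q : 'M[R]_(m, n)) (A : 'M[R]_(p, n)) :
  orthonormal_cols Q -> sqnorm (A *m Q^T) = sqnorm A.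
Proof. by move=> oQ; rewrite -sqnorm_tr trmx_mul trmxK sqnorm_orthonormal_l// sqnorm_tr. Qed.

Lemma sqnorm_diag n (d : 'rV[R]_n) : sqnorm (diag_mx d) = \sum_i d 0 i ^+ 2.
Proof.
apply: eq_bigr => i _; rewrite (bigD1 i)//= big1 ?addr0 => [|j ji].
  by rewrite mxE eqxx mulr1n.
by rewrite mxE eq_sym (negbTE ji) mulr0n expr0n.
Qed.

End Frobenius.

(** * Spectral theorem for real symmetric matrices *)

Section Householder.
Context {R : realType}.

Lemma orthonormal_square n (U : 'M[R]_n) : orthonormal_cols U -> U *m U^T = 1%:M.
Proof. by move=> oU; exact: mulmx1C. Qed.

(** The reflection along u - e, with e the first basis vector, exchanges u and e. For u = e there is
    no such direction and the identity serves. *)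
Lemma householder n (u : 'cV[R]_n.+1) : sqnorm u = 1 ->
  exists2 Q : 'M[R]_n.+1, orthonormal_cols Q & col 0 Q = u.
Proof.
move=> u1; pose e : 'cV[R]_n.+1 := delta_mx 0 0.
have e1 : sqnorm e = 1.
  rewrite /sqnorm (bigD1 0)//= [X in _ + X]big1 ?addr0 => [|i i0].
    by rewrite big_ord1 mxE !eqxx expr1n.
  by rewrite big_ord1 mxE (negbTE i0) expr0n.
have [ue|ue] := eqVneq u e.
  exists 1%:M; first by rewrite /orthonormal_cols trmx1 mulmx1.
  by rewrite col1 ue.
pose w := u - e; pose c := sqnorm w.
have c0 : c != 0.
  by apply: contra ue => /eqP /sqnorm_eq0 /eqP; rewrite subr_eq0.
have cE : c = 2 - 2 * u 0 0.
  rewrite /c /w sqnormD sqnormN frobdotNr u1 e1.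
  have -> : frobdot u e = u 0 0.
    rewrite /frobdot (bigD1 0)//= [X in _ + X]big1 ?addr0 => [|i i0].
      by rewrite big_ord1 mxE !eqxx mulr1.
    by rewrite big_ord1 mxE (negbTE i0) mulr0.
  by ring.
have ww : w^T *m w = c%:M.
  by apply/matrixP => i j; rewrite !ord1 [in RHS]mxE /c sqnormE /mxtrace big_ord1 mulr1n.
pose Q : 'M[R]_n.+1 := 1%:M - (2 / c) *: (w *m w^T).
have Qt : Q^T = Q by rewrite /Q linearB linearZ /= trmx1 trmx_mul trmxK.
exists Q.
  rewrite /orthonormal_cols Qt /Q mulmxBl mul1mx mulmxBr mulmx1 -scalemxAl -scalemxAr.
  rewrite -mulmxA (mulmxA w^T) ww mul_scalar_mx -scalemxAr !scalerA.
  have -> : 2 / c * (2 / c * c) = 2 / c + 2 / c by field.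
  by rewrite scalerDl opprB addrK subrK.
apply/matrixP => i j; rewrite ord1 !mxE big_ord1 !mxE /= cE.
have c0' : 2 - 2 * u 0 0 != 0 by rewrite -cE.
by rewrite eqxx /=; case: eqP => [->|_] /=; field.
Qed.

End Householder.

Section Spectral.
Context {R : realType}.

(** Over the complex numbers there is an eigenvalue a + i b with eigenvector x + i y. Symmetry gives
    x A y^T = y A x^T, that is b (|x|^2 + |y|^2) = 0, hence b = 0. *)
Lemma symmetric_eigenvalue n (A : 'M[R]_n.+1) : A^T = A -> exists a, eigenvalue A a.
Proof.
move=> sA; pose f := real_complex R.
have [z] := eigenvalue_closed (map_mx f A) (ltn0Sn n).
case: z => a b /eigenvalueP [v vA v0]; exists a.
rewrite -(eigenvalue_map f); apply/eigenvalueP; exists v => //.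
suff b0 : b = 0 by rewrite vA b0.
pose x := map_mx (@complex.Re R) v; pose y := map_mx (@complex.Im R) v.
have ReM (c : R[i]) (r : R) : complex.Re (c * f r) = complex.Re c * r.
  by case: c => p q; rewrite /f /=; ring.
have ImM (c : R[i]) (r : R) : complex.Im (c * f r) = complex.Im c * r.
  by case: c => p q; rewrite /f /=; ring.
have Resum (s : seq 'I_n.+1) (F : 'I_n.+1 -> R[i]) :
    complex.Re (\sum_(i <- s) F i) = \sum_(i <- s) complex.Re (F i).
  by elim: s => [|i s IH]; rewrite ?big_nil// !big_cons -IH; case: (F i) => p q; case: (\sum_(_ <- _) _).
have Imsum (s : seq 'I_n.+1) (F : 'I_n.+1 -> R[i]) :
    complex.Im (\sum_(i <- s) F i) = \sum_(i <- s) complex.Im (F i).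
  by elim: s => [|i s IH]; rewrite ?big_nil// !big_cons -IH; case: (F i) => p q; case: (\sum_(_ <- _) _).
have xA : x *m A = a *: x - b *: y.
  apply/rowP => j; have /rowP/(_ j)/(congr1 (@complex.Re R)) := vA.
  rewrite !mxE Resum => E; transitivity (complex.Re ((a +i* b)%C * v 0 j)).
    by rewrite -E; apply: eq_bigr => i _; rewrite !mxE ReM.
  by case: (v 0 j).
have yA : y *m A = a *: y + b *: x.
  apply/rowP => j; have /rowP/(_ j)/(congr1 (@complex.Im R)) := vA.
  rewrite !mxE Imsum => E; transitivity (complex.Im ((a +i* b)%C * v 0 j)).
    by rewrite -E; apply: eq_bigr => i _; rewrite !mxE ImM.
  by case: (v 0 j).
have E : x *m A *m y^T = (y *m A *m x^T)^T by rewrite !trmx_mul trmxK sA mulmxA.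
have xy : x *m y^T = (y *m x^T)^T by rewrite trmx_mul trmxK.
have sc (M : 'M[R]_1) : M^T = M by apply/matrixP => i j; rewrite mxE !ord1.
move: E; rewrite sc xA yA mulmxBl mulmxDl -!scalemxAl xy sc => /eqP.
rewrite -subr_eq0 opprD addrACA subrr add0r -opprD oppr_eq0 -scalerDr scaler_eq0.
case/orP=> [/eqP //|/eqP S0].
have sqv (w : 'rV[R]_n.+1) : (w *m w^T) 0 0 = sqnorm w.
  by rewrite -sqnorm_tr sqnormE trmxK /mxtrace big_ord1.
have : sqnorm y + sqnorm x = 0 by rewrite -!sqv; have /matrixP/(_ 0 0) := S0; rewrite !mxE.
move/eqP; rewrite paddr_eq0 ?sqnorm_ge0// => /andP[/eqP/sqnorm_eq0 y0 /eqP/sqnorm_eq0 x0].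
case/negP: v0; apply/eqP/rowP => j.
have := congr1 (fun M : 'rV[R]_n.+1 => M 0 j) x0; have := congr1 (fun M : 'rV[R]_n.+1 => M 0 j) y0.
by rewrite !mxE; case: (v 0 j) => p q /= -> ->.
Qed.

Lemma char_poly_orthonormal n (Q B : 'M[R]_n) : orthonormal_cols Q ->
  char_poly (Q *m B *m Q^T) = char_poly B.
Proof.
move=> oQ; have oQ' := orthonormal_square oQ.
pose Qp := map_mx polyC Q; pose Qtp := map_mx polyC Q^T.
have QQ : Qp *m Qtp = 1%:M by rewrite -map_mxM oQ' map_mx1.
have -> : char_poly (Q *m B *m Q^T) = \det (Qp *m char_poly_mx B *m Qtp).
  congr (\det _); rewrite /char_poly_mx mulmxBr mulmxBl !map_mxM; congr (_ - _).
  by rewrite mul_mx_scalar -scalemxAl QQ scale_scalar_mx mulr1.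
rewrite !det_mulmx mulrAC -det_mulmx QQ det1 mul1r.
by [].
Qed.

Lemma char_poly_block_diag m n (A : 'M[R]_m) (B : 'M[R]_n) :
  char_poly (block_mx A 0 0 B) = char_poly A * char_poly B.
Proof.
rewrite /char_poly /char_poly_mx map_block_mx !map_mx0 scalar_mx_block.
by rewrite opp_block_mx add_block_mx !oppr0 !addr0 det_ublock.
Qed.

(** A unit eigenvector is completed to an orthogonal matrix by a reflection, and symmetry clears the
    first row once the first column is clear. The factorization of the characteristic polynomial is
    kept because the diagonalization has to follow a prescribed list of roots. *)
Lemma symmetric_deflation n (A : 'M[R]_n.+1) a : A^T = A -> eigenvalue A a ->
  exists (Q : 'M[R]_n.+1) (B : 'M[R]_n),
    [/\ orthonormal_cols Q, B^T = B,
        A = Q *m (block_mx (a%:M : 'M[R]_1) 0 0 B : 'M[R]_(1 + n)) *m Q^T &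
        char_poly A = ('X - a%:P) * char_poly B].
Proof.
move=> sA /eigenvalueP[v vA v0].
have nv : 0 < sqnorm v^T.
  rewrite lt_neqAle sqnorm_ge0 andbT eq_sym; apply: contra v0 => /eqP /sqnorm_eq0.
  by move/(congr1 trmx); rewrite trmxK trmx0 => ->.
pose c := (Num.sqrt (sqnorm v^T))^-1; pose u := c *: v^T.
have u1 : sqnorm u = 1.
  by rewrite sqnormZ exprVn sqr_sqrtr ?sqnorm_ge0// mulVf// gt_eqF.
have Au : A *m u = a *: u.
  rewrite /u -scalemxAr scalerA mulrC -scalerA; congr (_ *: _).
  by rewrite -[A in LHS]sA -trmx_mul vA linearZ.
have [Q oQ Qu] := householder u1; have oQ' := orthonormal_square oQ.
have [M [sM colM AE]] : exists M : 'M[R]_(1 + n),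
    [/\ M^T = M, col 0 M = a *: delta_mx 0 0 & A = Q *m M *m Q^T].
  exists (Q^T *m A *m Q); split; first by rewrite !trmx_mul trmxK sA mulmxA.
    have -> : col 0 (Q^T *m A *m Q) = Q^T *m A *m u by rewrite -Qu !colE mulmxA.
    by rewrite -mulmxA Au -scalemxAr -Qu colE mulmxA oQ mul1mx.
  by rewrite !mulmxA oQ' mul1mx -mulmxA oQ' mulmx1.
have Ml (i : 'I_(1 + n)) : M i 0 = a * (i == 0)%:R.
  by have /colP/(_ i) := colM; rewrite !mxE andbT.
have l0 : lshift n (0 : 'I_1) = 0 :> 'I_(1 + n) by exact: val_inj.
have M0 : dlsubmx M = 0.
  by apply/matrixP => i j; rewrite !mxE ord1 l0 Ml mulr0.
have Mb : M = block_mx (a%:M : 'M[R]_1) 0 0 (drsubmx M).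
  rewrite -[LHS]submxK M0; congr block_mx.
    by apply/matrixP => i j; rewrite !ord1 !mxE l0 Ml eqxx mulr1.
  by rewrite -sM -trmx_dlsub M0 trmx0.
exists Q, (drsubmx M); split=> //.
- by rewrite trmx_drsub sM.
- by rewrite -Mb.
rewrite {1}AE char_poly_orthonormal// {1}Mb.
have -> : 'X - a%:P = char_poly (a%:M : 'M[R]_1).
  by rewrite /char_poly det_mx11 !mxE.
exact: (char_poly_block_diag (a%:M : 'M[R]_1) (drsubmx M)).
Qed.

Lemma symmetric_char_poly n (A : 'M[R]_n) : A^T = A ->
  exists d : 'I_n -> R, char_poly A = \prod_i ('X - (d i)%:P).
Proof.
elim: n A => [|n IH] A sA.
  by exists (fun=> 0); rewrite big_ord0 /char_poly det_mx00.
have [a aA] := symmetric_eigenvalue sA.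
have [Q [B [_ sB _ ->]]] := symmetric_deflation sA aA.
have [d ->] := IH B sB.
exists (fun i => if unlift 0 i is Some j then d j else a).
rewrite big_ord_recl unlift_none; congr (_ * _).
by apply: eq_bigr => i _; rewrite liftK.
Qed.

(** The diagonal may be prescribed in any order: deflating [d 0] leaves a block whose characteristic
    polynomial is the product of the remaining factors. This lets the sorted eigenvalues of the
    theorem appear in their own order. *)
Lemma symmetric_diagonalization n (A : 'M[R]_n) (d : 'I_n -> R) : A^T = A ->
  char_poly A = \prod_i ('X - (d i)%:P) ->
  exists2 U : 'M[R]_n, orthonormal_cols U & A = U *m diag_mx (\row_i d i) *m U^T.
Proof.
elim: n A d => [|n IH] A d sA cA.
  by exists 1%:M; [rewrite /orthonormal_cols trmx1 mulmx1|rewrite !flatmx0].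
have aA : eigenvalue A (d 0).
  by rewrite eigenvalue_root_char cA big_ord_recl rootM root_XsubC eqxx.
have [Q [B [oQ sB AE cB]]] := symmetric_deflation sA aA.
have [|U oU BE] := IH B (fun i => d (lift 0 i)) sB.
  by apply: (mulfI (negbT (polyXsubC_eq0 (d 0)))); rewrite -cB cA big_ord_recl.
pose U1 : 'M[R]_(1 + n) := block_mx 1%:M 0 0 U.
have oU1 : U1^T *m U1 = 1%:M.
  rewrite tr_block_mx mulmx_block !trmx0 !trmx1 !mul0mx !mulmx0 !addr0 add0r mulmx1 oU.
  by rewrite -scalar_mx_block.
pose D : 'rV[R]_(1 + n) := row_mx (\row_(i < 1) d 0) (\row_i d (lift 0 i)).
have key : U1 *m diag_mx D *m U1^T = block_mx ((d 0)%:M : 'M[R]_1) 0 0 B.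
  rewrite /U1 /D diag_mx_row tr_block_mx !mulmx_block !trmx0 !trmx1.
  rewrite !(mul0mx, mulmx0, addr0, add0r, mul1mx, mulmx1) [in RHS]BE; congr block_mx.
  by apply/matrixP => i j; rewrite !ord1 !mxE eqxx !mulr1n.
exists (Q *m U1).
  by rewrite /orthonormal_cols trmx_mul mulmxA -(mulmxA _ Q^T) oQ mulmx1.
rewrite {1}AE -key trmx_mul !mulmxA; congr (_ *m _ *m _ *m _).
congr diag_mx; apply/rowP => i; rewrite !mxE; case: split_ordP => j ->.
  by rewrite mxE ord1; congr d; exact: val_inj.
by rewrite mxE; congr d; exact: val_inj.
Qed.

Lemma symmetric_diagonalizable n (A : 'M[R]_n) : A^T = A ->
  exists (U : 'M[R]_n) (d : 'rV[R]_n),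
    orthonormal_cols U /\ A = U *m diag_mx d *m U^T.
Proof.
move=> sA; have [d dA] := symmetric_char_poly sA.
have [U oU UA] := symmetric_diagonalization sA dA.
by exists U, (\row_i d i).
Qed.

End Spectral.

Section MatrixFun.
Context {R : realType}.

(** Entrywise d_i W_ij = W_ij c_j, so either W_ij = 0 or d_i = c_j and f takes the same value on
    both. This is why f(M) does not depend on the diagonalization. *)
Lemma diag_intertwine (f : R -> R) n (d c : 'rV[R]_n) (W : 'M[R]_n) :
  diag_mx d *m W = W *m diag_mx c ->
  diag_mx (map_mx f d) *m W = W *m diag_mx (map_mx f c).
Proof.
move=> dW; apply/matrixP => i j; have /matrixP/(_ i j) := dW.
rewrite !mul_diag_mx !mul_mx_diag !mxE.
have [->|W0] := eqVneq (W i j) 0; first by rewrite !mulr0 !mul0r.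
by rewrite mulrC => /(mulfI W0) ->; exact: mulrC.
Qed.

Lemma is_matrix_fun_unique (f : R -> R) n (M N N' : 'M[R]_n) :
  is_matrix_fun f M N -> is_matrix_fun f M N' -> N = N'.
Proof.
move=> [U [d [oU MU ->]]] [V [c [oV MV ->]]].
have oU' := orthonormal_square oU; have oV' := orthonormal_square oV.
pose W := U^T *m V.
have dW : diag_mx d *m W = W *m diag_mx c.
  have : U^T *m M *m V = U^T *m M *m V by [].
  rewrite {1}MU {1}MV /W !mulmxA oU mul1mx => ->.
  by rewrite -[LHS]mulmxA oV mulmx1.
have fW := diag_intertwine f dW.
transitivity (U *m (diag_mx (map_mx f d) *m W) *m V^T).
  by rewrite /W !mulmxA -(mulmxA _ V) oV' mulmx1.
by rewrite fW /W !mulmxA oU' mul1mx.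
Qed.

Lemma matrix_funE (f : R -> R) n (U : 'M[R]_n) (d : 'rV[R]_n) :
  orthonormal_cols U ->
  matrix_fun f (U *m diag_mx d *m U^T) = U *m diag_mx (map_mx f d) *m U^T.
Proof.
move=> oU; have H : is_matrix_fun f (U *m diag_mx d *m U^T) (U *m diag_mx (map_mx f d) *m U^T).
  by exists U, d.
by apply: xget_unique => // N HN; exact: is_matrix_fun_unique HN H.
Qed.

Lemma matrix_fun_diag (f : R -> R) n (d : 'rV[R]_n) :
  matrix_fun f (diag_mx d) = diag_mx (map_mx f d).
Proof.
have o1 : orthonormal_cols (1%:M : 'M[R]_n) by rewrite /orthonormal_cols trmx1 mulmx1.
by have := matrix_funE f d o1; rewrite trmx1 !mul1mx !mulmx1.
Qed.

End MatrixFun.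

Section Projections.
Context {R : realType}.

Lemma sqnorm_orthonormal n p (Q : 'M[R]_(n, p)) : orthonormal_cols Q -> sqnorm Q = p%:R.
Proof. by move=> oQ; rewrite sqnormE oQ mxtrace1. Qed.

Lemma sqnorm_cols n p (A : 'M[R]_(n, p)) : sqnorm A = \sum_i sqnorm (col i A).
Proof.
rewrite /sqnorm exchange_big; apply: eq_bigr => j _; apply: eq_bigr => i _.
by rewrite big_ord1 mxE.
Qed.

Lemma sqnorm_col_orthonormal n p (Q : 'M[R]_(n, p)) i : orthonormal_cols Q ->
  sqnorm (col i Q) = 1.
Proof.
move=> oQ; rewrite sqnormE /mxtrace big_ord1; have /matrixP/(_ i i) := oQ.
rewrite [RHS]mxE eqxx mulr1n => <-.
by rewrite !mxE; apply: eq_bigr => j _; rewrite !mxE.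
Qed.

Lemma sqnorm_mul_diag_le n p (d : 'rV[R]_n) (A : 'M[R]_(n, p)) (c : R) :
  (forall i, `|d 0 i| <= c) -> sqnorm (diag_mx d *m A) <= c ^+ 2 * sqnorm A.
Proof.
move=> dc; rewrite /sqnorm mulr_sumr; apply: ler_sum => i _.
rewrite mulr_sumr; apply: ler_sum => j _.
rewrite mul_diag_mx mxE exprMn ler_wpM2r ?sqr_ge0//.
rewrite -(real_normK (num_real (d 0 i))) ler_sqr ?nnegrE//.
exact: le_trans (dc i).
Qed.

Definition projection n (S : 'M[R]_n) := S^T = S /\ S *m S = S.

Lemma sqnorm_projection n p (S : 'M[R]_n) (A : 'M[R]_(n, p)) : projection S ->
  sqnorm A = sqnorm (S *m A) + sqnorm (A - S *m A).
Proof.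
move=> [sS SS]; have -> : sqnorm A = sqnorm (S *m A + (A - S *m A)) by rewrite addrC subrK.
rewrite [LHS]sqnormD; suff -> : frobdot (S *m A) (A - S *m A) = 0 by rewrite mulr0 addr0.
by rewrite frobdotE trmx_mul sS mulmxBr !mulmxA -(mulmxA A^T S S) SS subrr linear0.
Qed.

Lemma projection_orthonormal n p (Q : 'M[R]_(n, p)) : orthonormal_cols Q ->
  projection (Q *m Q^T).
Proof.
by move=> oQ; split; rewrite ?trmx_mul ?trmxK// mulmxA -(mulmxA Q) oQ mulmx1.
Qed.

Lemma projection_compl n (S : 'M[R]_n) : projection S -> projection (1%:M - S).
Proof.
move=> [sS SS]; split; first by rewrite linearB /= trmx1 sS.
by rewrite mulmxBl mul1mx mulmxBr mulmx1 SS subrr subr0.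
Qed.

Lemma sqnorm_projection_le n p (S : 'M[R]_n) (A : 'M[R]_(n, p)) : projection S ->
  sqnorm (S *m A) <= sqnorm A.
Proof. by move=> pS; rewrite (sqnorm_projection A pS) lerDl sqnorm_ge0. Qed.

Lemma sqnorm_orthonormal_tr_le n p q (Q : 'M[R]_(n, p)) (A : 'M[R]_(n, q)) :
  orthonormal_cols Q -> sqnorm (Q^T *m A) <= sqnorm A.
Proof.
move=> oQ; rewrite -(sqnorm_orthonormal_l _ oQ) mulmxA.
exact: sqnorm_projection_le (projection_orthonormal oQ).
Qed.

(** The projector is C (C^T C)^-1 C^T for a basis C of the column space, so rank-deficient [Z] is
    covered. Its trace is its rank, which is how a rank of at most k is expressed below; the
    factorization through [Z] puts its range inside that of [Z]. *)
Lemma range_projection n k (Z : 'M[R]_(n, k)) : exists S : 'M[R]_n,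
  [/\ projection S, S *m Z = Z, \tr S <= k%:R & exists Y, S = Z *m Y].
Proof.
pose C := (row_base Z^T)^T.
have [M CM] : exists M, C = Z *m M.
  have /submxP[M ME] : (row_base Z^T <= Z^T)%MS by rewrite eq_row_base.
  by exists M^T; rewrite /C ME trmx_mul trmxK.
have [N ZN] : exists N, Z = C *m N.
  have /submxP[N NE] : (Z^T <= row_base Z^T)%MS by rewrite eq_row_base.
  by exists N^T; apply: trmx_inj; rewrite trmx_mul !trmxK.
have uC : C^T *m C \in unitmx.
  rewrite -row_free_unit -kermx_eq0; apply/eqP/row_matrixP => i; rewrite row0.
  have : row i (kermx (C^T *m C)) *m (C^T *m C) = 0 by rewrite -row_mul mulmx_ker row0.
  set y := row i _ => yC.
  have : sqnorm (C *m y^T) = 0.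
    by rewrite sqnormE trmx_mul trmxK -mulmxA (mulmxA C^T) mulmxA yC mul0mx linear0.
  move/sqnorm_eq0/(congr1 trmx); rewrite trmx_mul trmxK trmx0 /C trmxK => /eqP.
  by rewrite mulmx_free_eq0 ?row_base_free// => /eqP.
pose S := C *m invmx (C^T *m C) *m C^T.
have sym : (C^T *m C)^T = C^T *m C by rewrite trmx_mul trmxK.
have SC : S *m C = C by rewrite /S -mulmxA -mulmxA mulVmx ?mulmx1.
exists S; split.
- split; first by rewrite /S !trmx_mul trmxK trmx_inv sym mulmxA.
  by rewrite {2}/S !mulmxA SC.
- by rewrite ZN mulmxA SC.
- rewrite /S -mulmxA mxtrace_mulC -mulmxA mulVmx// mxtrace1 ler_nat.
  by rewrite mxrank_tr rank_leq_col.
- by exists (M *m invmx (C^T *m C) *m C^T); rewrite /S {1}CM !mulmxA.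
Qed.

End Projections.

(** * Optimality of the truncated SVD *)

Section EckartYoung.
Context {R : realType}.

(* applied with c i the squared norm of the projection of the i-th singular vector *)
Lemma top_weights_le t k (s c : 'I_t -> R) :
  (forall i, 0 <= s i) -> (forall i j : 'I_t, (i <= j)%N -> s j <= s i) ->
  (forall i, 0 <= c i <= 1) -> \sum_i c i <= k%:R ->
  \sum_i s i * c i <= \sum_(i : 'I_t | (i < k)%N) s i.
Proof.
move=> s0 sm c01 ck; rewrite [leRHS]big_mkcond /= -subr_le0 -sumrB.
have [tk|kt] := leqP t k.
  apply: sumr_le0 => i _; rewrite (leq_trans (ltn_ord i) tk) subr_le0.
  by rewrite ler_piMr//; case/andP: (c01 i).
pose tau := s (Ordinal kt).
apply: (@le_trans _ _ (\sum_i tau * (c i - (i < k)%N%:R))).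
  apply: ler_sum => i _; case/andP: (c01 i) => c0 c1; case: ltnP => ik.
    have : tau <= s i by apply: sm; rewrite /= ltnW.
    by rewrite mulr1n; nra.
  have : s i <= tau by apply: sm.
  by rewrite mulr0n; nra.
rewrite -mulr_sumr mulr_ge0_le0 ?s0// sumrB subr_le0 (le_trans ck)//.
rewrite -natr_sum ler_nat -big_mkcond /= -(big_ord_widen t (fun=> 1%N) (ltnW kt)).
by rewrite sum1_card card_ord.
Qed.

(** The rank condition on [D] takes the form S D = D, tr S <= k. Discarding the component of X - D
    in the range of S leaves |X|^2 - |S X|^2. Here |S X|^2 is the sum of sigma_i^2 |S u_i|^2, whose
    weights lie in [0, 1] and add up to at most k, so it is at most the sum of the first k of the
    sigma_i^2. *)
Lemma frobenius_truncated_svd_le m n k (X Y D : 'M[R]_(m, n)) (S : 'M[R]_m) :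
  truncated_svd k X Y -> projection S -> S *m D = D -> \tr S <= k%:R ->
  frobenius_norm (X - Y) <= frobenius_norm (X - D).
Proof.
move=> [t [U [sig [V [oU oV sig0 sigm [XE YE]]]]]] pS SD trS.
rewrite !frobenius_normE ler_sqrt ?sqnorm_ge0//.
have oU1 := sqnorm_orthonormal oU.
pose tail : 'rV[R]_t := \row_i if (i < k)%N then 0 else sig 0 i.
have -> : sqnorm (X - Y) = \sum_(i : 'I_t | ~~ (i < k)%N) sig 0 i ^+ 2.
  have -> : X - Y = U *m diag_mx tail *m V^T.
    rewrite XE YE -mulmxBl -mulmxBr; congr (_ *m _ *m _).
    apply/matrixP => i j; rewrite !mxE; case: eqP => [->|_]; last by rewrite !mulr0n subr0.
    by rewrite !mulr1n; case: ifP; rewrite ?subrr ?subr0.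
  rewrite sqnorm_orthonormal_r// sqnorm_orthonormal_l// sqnorm_diag [RHS]big_mkcond /=.
  by apply: eq_bigr => i _; rewrite mxE; case: ifP; rewrite ?expr0n.
have sX : sqnorm X = \sum_i sig 0 i ^+ 2.
  by rewrite XE sqnorm_orthonormal_r// sqnorm_orthonormal_l// sqnorm_diag.
have pC := projection_compl pS.
apply: le_trans (sqnorm_projection_le (X - D) pC).
have -> : (1%:M - S) *m (X - D) = X - S *m X.
  by rewrite mulmxBr !mulmxBl !mul1mx SD subrr subr0.
have -> : sqnorm (X - S *m X) = sqnorm X - sqnorm (S *m X).
  by rewrite (sqnorm_projection X pS) addrAC subrr add0r.
pose c i := sqnorm (col i (S *m U)).
have -> : sqnorm (S *m X) = \sum_i sig 0 i ^+ 2 * c i.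
  rewrite XE !mulmxA sqnorm_orthonormal_r// sqnorm_cols; apply: eq_bigr => i _.
  rewrite -sqnormZ; congr sqnorm; apply/colP => j; rewrite mxE mul_mx_diag [LHS]mxE.
  by rewrite [RHS]mxE [in RHS]mxE mulrC.
have c01 i : 0 <= c i <= 1.
  rewrite sqnorm_ge0 /=.
  by rewrite -(sqnorm_col_orthonormal i oU) /c colE -mulmxA -colE sqnorm_projection_le.
have sumc : \sum_i c i <= k%:R.
  apply: le_trans trS; rewrite -sqnorm_cols -sqnorm_tr trmx_mul.
  rewrite (le_trans (sqnorm_orthonormal_tr_le _ oU))// sqnorm_tr sqnormE.
  by case: pS => -> ->.
have H (i j : 'I_t) : (i <= j)%N -> sig 0 j ^+ 2 <= sig 0 i ^+ 2.
  by move=> ij; rewrite ler_sqr ?nnegrE ?sig0// sigm.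
have := @top_weights_le t k (fun i => sig 0 i ^+ 2) c (fun i => sqr_ge0 _) H c01 sumc.
move=> W; rewrite sX (bigID (fun i : 'I_t => (i < k)%N) predT (fun i => sig 0 i ^+ 2)) /=.
by rewrite lerBrDr [leLHS]addrC lerD2r.
Qed.

End EckartYoung.

(** * Polynomial approximation of the exponential *)

Section Interpolation.
Context {R : realType}.
Implicit Types (p : {poly R}) (a b x : R).

Lemma is_derive_exp_sub_poly p (x : R) :
  is_derive x 1 (fun y : R => expR y - p.[y]) (expR x - p^`().[x]).
Proof. exact: is_deriveB. Qed.

Lemma rolle_exp_sub_poly p a b x z : a <= x -> x < z -> z <= b ->
  expR x = p.[x] -> expR z = p.[z] ->
  exists w, [/\ x < w, w < z & expR w = p^`().[w]].
Proof.
move=> ax xz zb px pz; pose f (y : R) := expR y - p.[y].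
have df (y : R) : derivable f y 1 by case: (is_derive_exp_sub_poly p y).
have cf : continuous f.
  by move=> y; apply: differentiable_continuous; exact/derivable1_diffP.
have [||w] := @Rolle R f x z xz (fun y _ => df y).
- exact: continuous_subspaceT.
- by rewrite /f px pz !subrr.
rewrite in_itv /= => /andP[xw wz] [_ dw]; exists w; split=> //.
have [_ dw'] := is_derive_exp_sub_poly p w.
by apply/eqP; rewrite -subr_eq0 -dw' -[X in _ == X]dw.
Qed.

Lemma rolle_exp_sub_poly_seq p a b x (s : seq R) : a <= x -> all (fun z => z <= b) (x :: s) ->
  path <%R x s -> all (fun z => expR z == p.[z]) (x :: s) ->
  exists ws : seq R, [/\ size ws = size s, path <%R x ws,
    all (fun z => z <= b) ws & all (fun z => expR z == p^`().[z]) ws].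
Proof.
elim: s x => [|z s IH] x ax /=; first by exists [::].
case/and3P=> xb zb sb /andP[xz zs] /and3P[/eqP px pz ps].
have [||||ws [sw zw wb pw]] := IH z; rewrite /= ?zb ?pz//.
  by rewrite (le_trans ax)// ltW.
have [w [xw wz ew]] := rolle_exp_sub_poly ax xz zb px (eqP pz).
exists (w :: ws); split=> /=; first by rewrite sw.
- rewrite xw; case: ws zw {sw wb pw} => //= w' ws /andP[zw' ->].
  by rewrite (lt_trans wz zw').
- by rewrite wb (le_trans (ltW wz)).
- by rewrite ew eqxx.
Qed.

(** Each application of Rolle's theorem between consecutive points gives one point fewer, and since
    exp is its own derivative the new points solve the same problem for p'. *)
Lemma rolle_exp_sub_poly_iter p a b x (s : seq R) : a <= x -> all (fun z => z <= b) (x :: s) ->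
  path <%R x s -> all (fun z => expR z == p.[z]) (x :: s) ->
  exists2 w, w <= b & expR w = p^`(size s).[w].
Proof.
move sn : (size s) => n; elim: n p x s sn => [|n IH] p x s sn ax.
  by case: s sn => // _ /= /andP[xb _] _ /andP[/eqP px _]; exists x; rewrite ?derivn0.
move=> sb xs ps; have [ws [sw xw wb pw]] := rolle_exp_sub_poly_seq ax sb xs ps.
case: ws sw xw wb pw => [|w ws] /=; first by rewrite sn.
rewrite sn => -[sw] /andP[xw ww] wb pw.
have [||||v vb ev] := IH p^`() w ws sw; rewrite ?(le_trans ax) ?ltW//.
by exists v => //; rewrite ev -derivnS -derivSn.
Qed.

Lemma derivn_monic_lead p q (c : R) m : (size p <= m)%N -> q \is monic -> size q = m.+1 ->
  (p + c *: q)^`(m) = (c * m`!%:R)%:P.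
Proof.
move=> sp mq sq; apply/polyP => i; rewrite coef_derivn coefC coefD coefZ.
case: eqP => [->|/eqP i0].
  rewrite addn0 nth_default// add0r ffactnn.
  have -> : q`_m = 1 by move: mq; rewrite monicE lead_coefE sq => /eqP.
  by rewrite mulr1 mulr_natr.
have mi : (m < m + i)%N by rewrite -[X in (X < _)%N]addn0 ltn_add2l lt0n.
rewrite !nth_default ?mulr0 ?addr0 ?mul0rn//; first by rewrite sq.
by rewrite (leq_trans sp)// ltnW.
Qed.

(** Newton's scheme: a multiple of the product over the old nodes corrects the value at the new one
    without disturbing the others. *)
Lemma interpolation_exists (f : R -> R) (s : seq R) : uniq s ->
  exists2 p : {poly R}, (size p <= size s)%N & {in s, forall x, p.[x] = f x}.
Proof.
elim: s => [|x s IH] /=; first by exists 0; rewrite ?size_poly0.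
case/andP=> xs /IH [p sp pf]; pose q := \prod_(z <- s) ('X - z%:P).
have qx : q.[x] != 0 by have := root_prod_XsubC s x; rewrite /root => ->.
exists (p + ((f x - p.[x]) / q.[x]) *: q).
  rewrite (leq_trans (size_polyD _ _))// geq_max (leq_trans sp)//=.
  by rewrite (leq_trans (size_scale_leq _ _))// size_prod_XsubC.
move=> z; rewrite inE hornerD hornerZ => /predU1P[->|zs].
  by rewrite divfK// addrC subrK.
have /eqP -> : root q z by rewrite root_prod_XsubC.
by rewrite mulr0 addr0 pf.
Qed.

(** The multiple c of q is chosen so that P = p + c q also agrees with exp at x. With m nodes, the m
    + 1 points of agreement give a w with exp w = P^(m)(w) = c m!, as p has degree below m; the
    error is c q(x). The points are sorted because Rolle's theorem is applied between neighbours. *)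
Lemma exp_interpolation_error p a b (s : seq R) x : uniq s ->
  (size p <= size s)%N -> {in s, forall z, p.[z] = expR z} ->
  (forall z, z \in s -> a <= z <= b) -> a <= x <= b ->
  `|expR x - p.[x]| <= expR b / (size s)`!%:R * `|\prod_(z <- s) (x - z)|.
Proof.
move=> us sp ps sab xab; have [xs|xs] := boolP (x \in s).
  by rewrite ps// subrr normr0 mulr_ge0// divr_ge0 ?expR_ge0.
pose q := \prod_(z <- s) ('X - z%:P).
have qx : q.[x] != 0 by have := root_prod_XsubC s x; rewrite /root => ->.
have qE : q.[x] = \prod_(z <- s) (x - z).
  by rewrite horner_prod; apply: eq_bigr => z _; rewrite hornerXsubC.
pose c := (expR x - p.[x]) / q.[x]; pose P := p + c *: q.
have Pz : all (fun z => expR z == P.[z]) (x :: s).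
  apply/allP => z; rewrite inE /P hornerD hornerZ => /predU1P[->|zs].
    by rewrite divfK// addrC subrK.
  have /eqP -> : root q z by rewrite root_prod_XsubC.
  by rewrite mulr0 addr0 ps.
have [z0 [t zt]] : exists z0 t, sort <=%R (x :: s) = z0 :: t.
  case E: (sort <=%R (x :: s)) => [|z0 t]; last by exists z0, t.
  by have := congr1 size E; rewrite size_sort.
have mem_t z : (z \in z0 :: t) = (z \in x :: s) by rewrite -zt mem_sort.
have tab z : z \in z0 :: t -> a <= z <= b.
  by rewrite mem_t inE => /predU1P[->|/sab].
have lt_t : path <%R z0 t.
  have : sorted <%R (z0 :: t) by rewrite -zt sort_lt_sorted /= xs us.
  by [].
have [||||w wb] := @rolle_exp_sub_poly_iter P a b z0 t.
- by case/andP: (tab z0 (mem_head _ _)).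
- by apply/allP => z /tab /andP[].
- by [].
- by apply/allP => z zt'; move/allP: Pz; apply; rewrite -mem_t.
have st : size t = size s by have := congr1 size zt; rewrite size_sort => -[].
rewrite st derivn_monic_lead ?monic_prod_XsubC ?size_prod_XsubC// hornerC => ew.
have cE : c = expR w / (size s)`!%:R.
  by rewrite ew mulfK// pnatr_eq0 -lt0n fact_gt0.
have -> : expR x - p.[x] = c * q.[x] by rewrite divfK.
rewrite normrM -qE ler_wpM2r// cE ger0_norm ?divr_ge0 ?expR_ge0//.
by rewrite ler_wpM2r ?invr_ge0// ler_expR.
Qed.

End Interpolation.

(** * Chebyshev polynomials and interpolation at their zeros *)

Section Chebyshev.
Context {R : realType}.

Fixpoint chebyshev (m : nat) : {poly R} :=
  if m is k.+1 then
    if k is j.+1 then 2 *: ('X * chebyshev k) - chebyshev j else 'X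
  else 1.

Lemma chebyshev_cos m (t : R) : (chebyshev m).[cos t] = cos (m%:R * t).
Proof.
suff H k : (chebyshev k).[cos t] = cos (k%:R * t) /\
    (chebyshev k.+1).[cos t] = cos (k.+1%:R * t) by case: (H m).
elim: k => [|k [IH1 IH2]]; first by rewrite hornerC hornerX mul0r cos0 mul1r.
split=> //; rewrite [chebyshev _]/= -/(chebyshev k.+1) hornerD hornerN hornerZ hornerM hornerX.
rewrite IH2 IH1.
have -> : k%:R * t = k.+1%:R * t - t by rewrite -natr1; ring.
have -> : k.+2%:R * t = k.+1%:R * t + t by rewrite -[k.+2%:R]natr1; ring.
by rewrite cosB cosD; ring.
Qed.

Lemma size_lead_chebyshev m : size (chebyshev m.+1) = m.+2 /\
  lead_coef (chebyshev m.+1) = 2 ^+ m.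
Proof.
suff H k : [/\ size (chebyshev k) = k.+1, size (chebyshev k.+1) = k.+2 &
  lead_coef (chebyshev k.+1) = 2 ^+ k] by case: (H m).
elim: k => [|k [IH1 IH2 IH3]].
  by rewrite size_poly1 size_polyX lead_coefX.
have n2 : (2 : R) != 0 by [].
have E : chebyshev k.+2 = 2 *: ('X * chebyshev k.+1) - chebyshev k by [].
have C0 : chebyshev k.+1 != 0 by rewrite -size_poly_gt0 IH2.
have S : size (2 *: ('X * chebyshev k.+1)) = k.+3.
  by rewrite size_scale// mulrC size_mulX// IH2.
have L : (size (- chebyshev k) < size (2 *: ('X * chebyshev k.+1)))%N.
  by rewrite S size_polyN IH1.
split=> //; first by rewrite E size_polyDl.
by rewrite E lead_coefDl// lead_coefZ lead_coefM lead_coefX mul1r IH3 exprS.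
Qed.

Definition cheb_node (m j : nat) : R := cos ((2 * j + 1)%:R * pi / (2 * m)%:R).

Lemma cheb_angle m j : (j < m.+1)%N ->
  (2 * j + 1)%:R * pi / (2 * m.+1)%:R \in `[0, (pi : R)].
Proof.
move=> jm; rewrite in_itv /= divr_ge0 ?mulr_ge0 ?pi_ge0//=.
rewrite ler_pdivrMr ?ltr0n ?muln_gt0// mulrC ler_wpM2l ?pi_ge0// ler_nat.
by rewrite addn1 ltn_pmul2l.
Qed.

Lemma cheb_node_inj m (i j : nat) : (i < m.+1)%N -> (j < m.+1)%N ->
  cheb_node m.+1 i = cheb_node m.+1 j -> i = j.
Proof.
move=> im jm; move/(congr1 acos); rewrite /cheb_node !cosK ?cheb_angle//.
have D0 : (2 * m.+1)%:R != 0 :> R by rewrite pnatr_eq0.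
have pi0 : pi != 0 :> R by rewrite gt_eqF// pi_gt0.
move/(mulIf (invr_neq0 D0))/(mulIf pi0)/eqP.
by rewrite eqr_nat eqn_add2r eqn_pmul2l// => /eqP.
Qed.

(** At t = (2 j + 1) pi / (2 m + 2) one has cos ((m + 1) t) = 0. The m + 1 values cos t are
    distinct, cos being injective on [0, pi], so they exhaust the roots of a polynomial of degree m
    + 1 with leading coefficient 2^m. *)
Lemma chebyshev_prod m (y : R) :
  (chebyshev m.+1).[y] = 2 ^+ m * \prod_(j < m.+1) (y - cheb_node m.+1 j).
Proof.
have [sT lT] := size_lead_chebyshev m.
pose rs := [seq cheb_node m.+1 j | j <- iota 0 m.+1].
have uroots : uniq rs.
  rewrite map_inj_in_uniq ?iota_uniq// => i j; rewrite !mem_iota /= !add0n.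
  exact: cheb_node_inj.
have rT : all (root (chebyshev m.+1)) rs.
  apply/allP => _ /mapP[j _ ->]; apply/eqP; rewrite chebyshev_cos.
  have -> : m.+1%:R * ((2 * j + 1)%:R * pi / (2 * m.+1)%:R) = j%:R * pi + pi / 2 :> R.
    by rewrite natrD !natrM; field; rewrite /= nat1r pnatr_eq0.
  rewrite cosDpihalf; elim: j => [|j IH]; first by rewrite mul0r sin0 oppr0.
  by rewrite -natr1 mulrDl mul1r sinDpi IH oppr0.
have := all_roots_prod_XsubC _ rT.
rewrite sT size_map size_iota => /(_ erefl).
rewrite uniq_rootsE => /(_ uroots) ->.
rewrite lT hornerZ horner_prod big_map; congr (_ * _).
rewrite -(subn0 m.+1) -/(index_iota 0 m.+1) big_mkord.
by apply: eq_bigr => j _; rewrite hornerXsubC.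
Qed.

(** On [-1, 1] the Chebyshev polynomial is cos ((m + 1) acos y), of absolute value at most 1; the
    leading coefficient is the gain. *)
Lemma chebyshev_nodes_le m (y : R) : -1 <= y <= 1 ->
  `|\prod_(j < m.+1) (y - cheb_node m.+1 j)| <= (2 ^+ m)^-1.
Proof.
move=> y1; rewrite -(ler_pM2l (exprn_gt0 m (ltr0Sn R 1))) divff ?expf_neq0//.
rewrite -[X in X * _]ger0_norm ?exprn_ge0// -normrM -chebyshev_prod.
by rewrite -[y]acosK ?in_itv// chebyshev_cos ler_norml cos_geN1 cos_le1.
Qed.

(* interpolation at the Chebyshev nodes of [a, b] *)
Lemma exp_poly_approx (a b : R) m : a <= b -> (0 < m)%N ->
  exists2 p : {poly R}, (size p <= m)%N & forall x, a <= x <= b ->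
    `|expR x - p.[x]| <= expR b * (b - a) ^+ m / (2 ^+ (2 * m - 1) * m`!%:R).
Proof.
case: m => // m ab _; have [<-|ab'] := eqVneq a b.
  exists (expR a)%:P; first by rewrite (leq_trans (size_polyC_leq1 _)).
  move=> x; rewrite -eq_le => /eqP <-; rewrite hornerC subrr normr0.
  by rewrite mulr_ge0 ?mulr_ge0 ?expR_ge0 ?exprn_ge0 ?subrr// invr_ge0 mulr_ge0 ?exprn_ge0.
have {ab'}ab : a < b by rewrite lt_neqAle ab' ab.
pose h := (b - a) / 2; pose c := (a + b) / 2.
have h0 : 0 < h by rewrite divr_gt0 ?subr_gt0.
pose s := [seq c + h * cheb_node m.+1 j | j <- iota 0 m.+1].
have ss : size s = m.+1 by rewrite size_map size_iota.
have us : uniq s.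
  rewrite map_inj_in_uniq ?iota_uniq// => i j; rewrite !mem_iota /= !add0n => im jm.
  by move/addrI/(mulfI (lt0r_neq0 h0)); exact: cheb_node_inj.
have [p sp pf] := interpolation_exists expR us.
exists p; first by rewrite -ss.
move=> x xab; pose y := (x - c) / h.
have y1 : -1 <= y <= 1.
  rewrite /y ler_pdivlMr// ler_pdivrMr// /c /h; lra.
have xE : x = c + h * y by rewrite /y mulrCA divff ?gt_eqF// mulr1 addrC subrK.
have sab z : z \in s -> a <= z <= b.
  case/mapP => j _ ->; have := cos_geN1 ((2 * j + 1)%:R * pi / (2 * m.+1)%:R : R).
  have := cos_le1 ((2 * j + 1)%:R * pi / (2 * m.+1)%:R : R); rewrite -/(cheb_node m.+1 j).
  move: (cheb_node _ _) => t; rewrite /c /h; have := ab; nra.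
rewrite (le_trans (exp_interpolation_error us sp pf sab xab))// ss.
have -> : \prod_(z <- s) (x - z) = h ^+ m.+1 * \prod_(j < m.+1) (y - cheb_node m.+1 j).
  rewrite big_map -(subn0 m.+1) -/(index_iota 0 m.+1) big_mkord subn0.
  rewrite -[X in h ^+ X]card_ord -prodr_const -big_split /=; apply: eq_bigr => j _.
  by rewrite xE; ring.
rewrite normrM (ger0_norm (exprn_ge0 _ (ltW h0))).
have /(ler_wpM2l (exprn_ge0 m.+1 (ltW h0))) := chebyshev_nodes_le m y1.
move=> /(ler_wpM2l _)/le_trans; apply; first by rewrite divr_ge0 ?expR_ge0.
rewrite /h expr_div_n.
have -> : (2 * m.+1 - 1 = m.+1 + m)%N by rewrite mul2n -addnn addnS subn1.
have f0 : (m.+1`!)%:R != 0 :> R by rewrite pnatr_eq0 -lt0n fact_gt0.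
rewrite exprD le_eqVlt; apply/orP; left; apply/eqP; field.
by rewrite f0 !expf_neq0.
Qed.

End Chebyshev.

(** * Block Lanczos *)

Section PolynomialOfMatrix.
Context {R : realType}.

Definition poly_mx (p : {poly R}) n (A : 'M[R]_n) : 'M[R]_n :=
  \sum_(i < size p) p`_i *: A ^+ i.

Lemma expr_diagonalized n (U : 'M[R]_n) (d : 'rV[R]_n) i : orthonormal_cols U ->
  (U *m diag_mx d *m U^T) ^+ i = U *m diag_mx (map_mx (fun x => x ^+ i) d) *m U^T.
Proof.
move=> oU; have oU' := orthonormal_square oU; elim: i => [|i IH].
  rewrite expr0 (_ : diag_mx _ = 1%:M) ?mulmx1 ?oU'//.
  by apply/matrixP => a b; rewrite !mxE expr0.
rewrite exprS IH -mulmxE !mulmxA; congr (_ *m _).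
rewrite -!mulmxA; congr (_ *m _); rewrite !mulmxA -[_ *m U^T *m U]mulmxA oU mulmx1.
apply/matrixP => a b; rewrite mul_diag_mx !mxE exprS.
by rewrite mulrnAr.
Qed.

Lemma poly_mx_diagonalized p n (U : 'M[R]_n) (d : 'rV[R]_n) : orthonormal_cols U ->
  poly_mx p (U *m diag_mx d *m U^T) = U *m diag_mx (map_mx (horner p) d) *m U^T.
Proof.
move=> oU; rewrite /poly_mx; under eq_bigr do rewrite expr_diagonalized// scalemxAl scalemxAr.
rewrite -mulmx_suml -mulmx_sumr; congr (_ *m _ *m _).
apply/matrixP => a b; rewrite summxE !mxE horner_coef -sumrMnl.
by apply: eq_bigr => i _; rewrite !mxE mulrnAr.
Qed.

End PolynomialOfMatrix.

Section LanczosExactness.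
Context {R : realType} {n l : nat}.
Variables (A : 'M[R]_n) (Omega : 'M[R]_(n, l)) (s r : nat).
Variables (b : nat -> nat) (V : forall i, 'M[R]_(n, b i)).
Hypothesis s0 : (0 < s)%N.
Hypothesis sA : A^T = A.
Hypothesis lanczos : block_lanczos A Omega (s + r) V.
Local Notation Q := (concat_blocks V).

Let s_sr : (s <= s + r)%N. Proof. exact: leq_addr. Qed.

Lemma lanczos_orthonormal i : (0 < i)%N -> (i <= s + r)%N -> orthonormal_cols (Q i).
Proof. by move=> i0 iq; case: (lanczos i0 iq). Qed.

Lemma lanczos_proj_krylov i j : (j < i)%N -> (i <= s + r)%N ->
  Q i *m (Q i)^T *m (A ^+ j *m Omega) = A ^+ j *m Omega.
Proof.
move=> ji iq; have [oQ eqK] := lanczos (leq_ltn_trans (leq0n _) ji) iq.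
have : ((A ^+ j *m Omega)^T <= (Q i)^T)%MS.
  rewrite eqK; pose B := fun j : 'I_i => A ^+ j *m Omega.
  have -> : A ^+ j *m Omega = submxrow (krylov_mx A Omega i) (Ordinal ji).
    by rewrite /krylov_mx mxrowK.
  by rewrite tr_submxrow /submxcol rowsub_sub.
case/submxP => M /(congr1 trmx); rewrite trmxK trmx_mul trmxK => ->.
by rewrite -mulmxA (mulmxA (Q i)^T) oQ mul1mx.
Qed.

Lemma lanczos_krylov_coef i : (0 < i)%N -> (i <= s + r)%N ->
  exists C : 'I_i -> 'M[R]_(l, ncols b i), Q i = \sum_(j < i) A ^+ j *m Omega *m C j.
Proof.
move=> i0 iq; have [oQ eqK] := lanczos i0 iq.
have /submxP[M] : ((Q i)^T <= (krylov_mx A Omega i)^T)%MS by rewrite eqK.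
move/(congr1 trmx); rewrite trmx_mul !trmxK => QE.
exists (submxcol M^T); rewrite {1}QE -{1}(submxcolK M^T) /krylov_mx mul_mxrow_mxcol.
by [].
Qed.

Lemma concat_blocks_widen p q (h : (ncols b p <= ncols b q)%N) : (p <= q)%N ->
  colsub (widen_ord h) (Q q) = Q p.
Proof.
elim: q h => [|q IH] h.
  rewrite leqn0 => /eqP p0; subst p; apply/matrixP => i j; rewrite mxE.
  by congr (_ _ _); exact: val_inj.
rewrite leq_eqVlt => /predU1P[pq|pq].
  subst p; apply/matrixP => i j; rewrite mxE.
  by congr (_ _ _); exact: val_inj.
have h' : (ncols b p <= ncols b q)%N.
  move: pq; rewrite ltnS => /subnKC <-; exact: leq_ncols.
rewrite -(IH h' pq); apply/matrixP => i j; rewrite [LHS]mxE [RHS]mxE.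
have -> : widen_ord h j = lshift (b q) (widen_ord h' j) by exact: val_inj.
by rewrite /= row_mxEl.
Qed.

(** Selects the first d_s columns: it turns the leading submatrix into the compression E^T M E, and
    Q_s into Q_(s+r) E. *)
Let E : 'M[R]_(ncols b (s + r), ncols b s) :=
  colsub (widen_ord (leq_ncols b s r)) 1%:M.

Let colsubE m (M : 'M[R]_(m, ncols b (s + r))) :
  colsub (widen_ord (leq_ncols b s r)) M = M *m E.
Proof.
rewrite -{1}[M]mulmx1; apply/matrixP => i j; rewrite !mxE.
by apply: eq_bigr => k _; rewrite !mxE.
Qed.

Lemma leading_submxE (M : 'M[R]_(ncols b (s + r))) :
  leading_submx (leq_ncols b s r) M = E^T *m M *m E.
Proof.
rewrite /leading_submx -colsubE.
rewrite (_ : E^T *m M = rowsub (widen_ord (leq_ncols b s r)) M); last first.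
  rewrite -{2}[M]mul1mx; apply/matrixP => i j; rewrite !mxE.
  by apply: eq_bigr => k _; rewrite !mxE eq_sym.
by apply/matrixP => i j; rewrite !mxE.
Qed.

Lemma lanczos_prefix : Q (s + r) *m E = Q s.
Proof. by rewrite -colsubE concat_blocks_widen. Qed.

Lemma prefix_orthonormal : orthonormal_cols E.
Proof.
apply/matrixP => i j; rewrite !mxE (bigD1 (widen_ord (leq_ncols b s r) i))//= big1.
  by rewrite !mxE eqxx mul1r addr0.
by move=> k ki; rewrite !mxE (negbTE ki) mul0r.
Qed.

Local Notation T := (lanczos_T A V (s + r)).

Lemma tr_lanczos_T : T^T = T.
Proof. by rewrite /lanczos_T !trmx_mul trmxK sA mulmxA. Qed.

(** The columns of A^j Q_s lie in the Krylov space of index s + j, inside the range of Q = Q_(s+r)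
    as long as j <= r. The projector Q Q^T can then be inserted after each multiplication by A,
    which turns A into T_q. *)
Lemma lanczos_expr_prefix j : (j <= r)%N -> A ^+ j *m Q s = Q (s + r) *m T ^+ j *m E.
Proof.
have q0 : (0 < s + r)%N by exact: leq_trans s0 s_sr.
have oQ := lanczos_orthonormal q0 (leqnn _).
elim: j => [|j IH] jr; first by rewrite !expr0 mul1mx mulmx1 lanczos_prefix.
have -> : A ^+ j.+1 *m Q s = Q (s + r) *m (Q (s + r))^T *m (A ^+ j.+1 *m Q s).
  have [C ->] := lanczos_krylov_coef s0 s_sr.
  rewrite !mulmx_sumr; apply: eq_bigr => i _.
  have -> : A ^+ j.+1 *m (A ^+ i *m Omega *m C i) = A ^+ (j.+1 + i) *m Omega *m C i.
    by rewrite exprD -mulmxE !mulmxA.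
  rewrite [RHS]mulmxA lanczos_proj_krylov//.
  by rewrite -addnS addnC leq_add.
rewrite exprS -mulmxE -(mulmxA A) IH; last exact: ltnW.
by rewrite exprS -mulmxE /lanczos_T !mulmxA.
Qed.

(** A power N = i + 1 + j with i, j <= r is split as A^i on the left, A^j on the right, and one
    factor A in the middle whose compression is T_q by definition; this middle factor carries the
    exactness from 2 r to 2 r + 1. *)
Lemma lanczos_expr_exact N : (N <= 2 * r + 1)%N ->
  (Q s)^T *m A ^+ N *m Q s = E^T *m T ^+ N *m E.
Proof.
have q0 : (0 < s + r)%N by exact: leq_trans s0 s_sr.
have oQ := lanczos_orthonormal q0 (leqnn _).
have trX m (M : 'M[R]_m) i : M^T = M -> (M ^+ i)^T = M ^+ i.
  move=> sM; elim: i => [|i IH]; first by rewrite expr0 trmx1.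
  by rewrite exprS -mulmxE trmx_mul IH sM mulmxE -exprSr exprS.
case: N => [|N] Nr.
  rewrite !expr0 !mulmx1 (lanczos_orthonormal s0 s_sr).
  by rewrite prefix_orthonormal.
have [i [j [ir jr ->]]] : exists i j, [/\ (i <= r)%N, (j <= r)%N & N = (i + j)%N].
  have [Nr'|rN] := leqP N r; first by exists N, 0; rewrite addn0.
  have Nrr : (N <= r + r)%N by move: Nr; rewrite addn1 ltnS mul2n -addnn.
  by exists r, (N - r)%N; split; [exact: leqnn|rewrite leq_subLR|rewrite subnKC// ltnW].
have -> : (Q s)^T *m A ^+ (i + j).+1 *m Q s = (A ^+ i *m Q s)^T *m A *m (A ^+ j *m Q s).
  by rewrite trmx_mul trX// -addnS exprD exprS -!mulmxE !mulmxA.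
rewrite !lanczos_expr_prefix// !trmx_mul (trX _ _ _ tr_lanczos_T).
rewrite -addnS exprD exprS -!mulmxE {2}/lanczos_T !mulmxA.
by [].
Qed.

Lemma lanczos_poly_exact (p : {poly R}) : (size p <= 2 * r + 2)%N ->
  (Q s)^T *m poly_mx p A *m Q s = E^T *m poly_mx p T *m E.
Proof.
move=> sp; rewrite /poly_mx !mulmx_sumr !mulmx_suml; apply: eq_bigr => i _.
rewrite -!scalemxAr -!scalemxAl lanczos_expr_exact//.
by rewrite -ltnS -addnS (leq_trans _ sp).
Qed.

(** A spectral bound becomes a Frobenius bound at the price of the dimension [p] of the compression;
    for Q_s this dimension is at most l s, the source of the factor sqrt(l s). *)
Lemma sqnorm_compress_le m p (U : 'M[R]_m) (d : 'rV[R]_m) (Z : 'M[R]_(m, p)) c :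
  orthonormal_cols U -> orthonormal_cols Z -> (forall i, `|d 0 i| <= c) ->
  sqnorm (Z^T *m (U *m diag_mx d *m U^T) *m Z) <= c ^+ 2 * p%:R.
Proof.
move=> oU oZ dc; rewrite -mulmxA (le_trans (sqnorm_orthonormal_tr_le _ oZ))//.
rewrite -!mulmxA sqnorm_orthonormal_l// (le_trans (sqnorm_mul_diag_le _ dc))//.
rewrite ler_wpM2l ?sqr_ge0// (le_trans (sqnorm_orthonormal_tr_le _ oU))//.
by rewrite sqnorm_orthonormal.
Qed.

(** The eigenvalues of T_q are convex combinations of those of A, with weights [Y j i ^+ 2]. An
    approximation of f on an interval containing the spectrum of A therefore serves for T_q as
    well. *)
Lemma lanczos_T_eigen_bounds (U : 'M[R]_n) (d : 'rV[R]_n) (W : 'M[R]_(ncols b (s + r))) t lo hi :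
  orthonormal_cols U -> A = U *m diag_mx d *m U^T ->
  orthonormal_cols W -> T = W *m diag_mx t *m W^T ->
  (forall i, lo <= d 0 i <= hi) -> forall i, lo <= t 0 i <= hi.
Proof.
move=> oU AE oW TE dlh i.
have q0 : (0 < s + r)%N by exact: leq_trans s0 s_sr.
have oQ := lanczos_orthonormal q0 (leqnn _).
pose Y := U^T *m (Q (s + r) *m W).
have oY : Y^T *m Y = 1%:M.
  rewrite /Y !trmx_mul trmxK -!mulmxA (mulmxA U) (orthonormal_square oU) mul1mx.
  by rewrite (mulmxA _ (Q (s + r))) oQ mul1mx.
have tE : diag_mx t = Y^T *m diag_mx d *m Y.
  transitivity (W^T *m T *m W).
    by rewrite TE !mulmxA oW mul1mx -mulmxA oW mulmx1.
  by rewrite /lanczos_T {1}AE /Y !trmx_mul trmxK !mulmxA.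
have {}tE : t 0 i = \sum_j d 0 j * Y j i ^+ 2.
  have /matrixP/(_ i i) := tE; rewrite [LHS]mxE eqxx mulr1n => ->.
  rewrite mul_mx_diag mxE; apply: eq_bigr => j _.
  by rewrite [X in X * _]mxE [X in X * _ * _]mxE expr2; ring.
have Y1 : \sum_j Y j i ^+ 2 = 1.
  have /matrixP/(_ i i) := oY; rewrite [RHS]mxE eqxx mulr1n => <-.
  by rewrite [RHS]mxE; apply: eq_bigr => j _; rewrite [X in _ = X * _]mxE expr2.
rewrite tE -[lo]mulr1 -[hi]mulr1 -Y1 !mulr_sumr; apply/andP; split; apply: ler_sum => j _.
  by rewrite ler_wpM2r ?sqr_ge0//; case/andP: (dlh j).
by rewrite ler_wpM2r ?sqr_ge0//; case/andP: (dlh j).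
Qed.

(** The polynomial parts of f(A) and f(T_q) cancel by exactness. What remains is f - p on A and on
    T_q, each at most [c] in spectral norm, whence the factor 2. *)
Lemma lanczos_matrix_fun_error (f : R -> R) (p : {poly R}) (U : 'M[R]_n) (d : 'rV[R]_n) lo hi c :
  orthonormal_cols U -> A = U *m diag_mx d *m U^T -> (forall i, lo <= d 0 i <= hi) ->
  (size p <= 2 * r + 2)%N -> 0 <= c -> (forall x, lo <= x <= hi -> `|f x - p.[x]| <= c) ->
  frobenius_norm ((Q s)^T *m matrix_fun f A *m Q s -
    leading_submx (leq_ncols b s r) (matrix_fun f T)) <= 2 * c * Num.sqrt (l%:R * s%:R).
Proof.
move=> oU AE dlh sp c0 fp; have [W [t [oW TE]]] := symmetric_diagonalizable tr_lanczos_T.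
have oQs := lanczos_orthonormal s0 s_sr.
have fpE m (X : 'M[R]_m) (x : 'rV[R]_m) : orthonormal_cols X ->
    matrix_fun f (X *m diag_mx x *m X^T) = poly_mx p (X *m diag_mx x *m X^T) +
      X *m diag_mx (map_mx (fun x => f x - p.[x]) x) *m X^T.
  move=> oX; rewrite matrix_funE// poly_mx_diagonalized// -mulmxDl -mulmxDr; congr (_ *m _ *m _).
  apply/matrixP => i j; rewrite !mxE; case: eqP => _; rewrite ?mulr0n ?addr0// !mulr1n.
  by rewrite addrC subrK.
have ncl : (ncols b s)%:R <= l%:R * s%:R :> R.
  rewrite (block_lanczos_ncols lanczos s0 s_sr) -natrM ler_nat.
  by rewrite (leq_trans (rank_leq_col _))// sum_nat_const card_ord mulnC.
have err m (X : 'M[R]_m) (x : 'rV[R]_m) (Z : 'M[R]_(m, ncols b s)) :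
    orthonormal_cols X -> orthonormal_cols Z -> (forall i, lo <= x 0 i <= hi) ->
    frobenius_norm (Z^T *m (X *m diag_mx (map_mx (fun x => f x - p.[x]) x) *m X^T) *m Z)
      <= c * Num.sqrt (l%:R * s%:R).
  move=> oX oZ xlh; rewrite frobenius_normE -[c]ger0_norm// -sqrtr_sqr -sqrtrM ?sqr_ge0//.
  rewrite ler_sqrt ?mulr_ge0 ?sqr_ge0// (le_trans (sqnorm_compress_le (c := c) oX oZ _))//.
    by move=> i; rewrite mxE; exact: fp.
  by rewrite ler_wpM2l ?sqr_ge0.
have tlh := lanczos_T_eigen_bounds oU AE oW TE dlh.
rewrite leading_submxE {1}AE {1}TE !fpE// -AE -TE !mulmxDr !mulmxDl lanczos_poly_exact//.
rewrite opprD addrACA subrr add0r (le_trans (frobenius_normD _ _))// frobenius_normN.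
rewrite mulrDl mul1r mulrDl lerD//; first exact: err.
by apply: err => //; exact: prefix_orthonormal.
Qed.

End LanczosExactness.

(** * The regularized inverse Wishart matrix *)

Section RegularFunctional.
Context {R : realType} {I : finType}.
Implicit Types (F G : (I -> R) -> R) (v : I -> R) (i : I).

(** Stein's identity differentiates along one coordinate at a time, so separate differentiability is
    the right notion. The class is closed under sums, products and inverses of nowhere vanishing
    functionals, hence contains the entries of an inverse matrix. *)
Definition regular F := measurable_functional F /\
  forall v i (x : R), derivable (fun y : R => F (update v i y)) x 1.

Definition partial i F v : R := 'D_1 (fun y : R => F (update v i y)) (v i).

Lemma regular_is_derive i F v : regular F ->
  is_derive (v i) 1 (fun y : R => F (update v i y)) (partial i F v).
Proof. by move=> [_ dF]; apply: DeriveDef. Qed.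

Lemma regular_continuous F v i : regular F ->
  continuous (fun y : R => F (update v i y)).
Proof.
move=> [_ dF] x; apply: differentiable_continuous.
exact/derivable1_diffP.
Qed.

Lemma regular_cst c : regular (fun=> c).
Proof. by split=> [d T Y mY|v i x]; [exact: measurable_cst|exact: derivable_cst]. Qed.

Lemma regular_coord j : regular (fun v => v j).
Proof.
split=> [d T Y mY|v i x]; first exact: mY.
rewrite /update; case: eqP => _; [exact: derivable_id|exact: derivable_cst].
Qed.

Lemma regularD F G : regular F -> regular G -> regular (fun v => F v + G v).
Proof.
move=> [mF dF] [mG dG]; split=> [d T Y mY|v i x].
  by apply: measurable_funD; [exact: mF|exact: mG].
exact: derivableD.
Qed.

Lemma regularM F G : regular F -> regular G -> regular (fun v => F v * G v).
Proof.
move=> [mF dF] [mG dG]; split=> [d T Y mY|v i x].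
  by apply: measurable_funM; [exact: mF|exact: mG].
exact: derivableM.
Qed.

Lemma regularV F : regular F -> (forall v, F v != 0) -> regular (fun v => (F v)^-1).
Proof.
move=> [mF dF] F0; split=> [d T Y mY|v i x]; last exact: derivableV.
have mFY : measurable_fun setT (fun t => F (fun j => Y j t)) by exact: mF.
apply: (@measurable_comp _ _ _ _ _ _ [set x : R | x != 0] (fun x : R => x^-1) setT
  (fun t => F (fun j => Y j t))) => //.
- by apply: open_measurable; exact: open_neq.
- by move=> _ [t _ <-] /=.
- apply: open_continuous_measurable_fun; first exact: open_neq.
  by move=> x; rewrite inE /= => x0; exact: inv_continuous.
Qed.

Lemma regular_sum (J : Type) (s : seq J) (F : J -> (I -> R) -> R) :
  (forall j, regular (F j)) -> regular (fun v => \sum_(j <- s) F j v).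
Proof.
move=> rF; elim: s => [|j s IH].
  by under eq_fun do rewrite big_nil; exact: regular_cst.
by under eq_fun do rewrite big_cons; exact: regularD.
Qed.

Lemma regular_prod (J : Type) (s : seq J) (F : J -> (I -> R) -> R) :
  (forall j, regular (F j)) -> regular (fun v => \prod_(j <- s) F j v).
Proof.
move=> rF; elim: s => [|j s IH].
  by under eq_fun do rewrite big_nil; exact: regular_cst.
by under eq_fun do rewrite big_cons; exact: regularM.
Qed.

Lemma partial_cst i c v : partial i (fun=> c) v = 0.
Proof. exact: derive_cst. Qed.

Lemma partial_coord i j v : partial i (fun v => v j) v = (j == i)%:R.
Proof.
rewrite /partial /update; case: eqP => _; first exact: derive_id.
exact: derive_cst.
Qed.

Lemma partialD i F G v : regular F -> regular G ->
  partial i (fun v => F v + G v) v = partial i F v + partial i G v.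
Proof. by move=> [_ dF] [_ dG]; exact: deriveD. Qed.

Lemma partialM i F G v : regular F -> regular G ->
  partial i (fun v => F v * G v) v = partial i F v * G v + F v * partial i G v.
Proof.
move=> [_ dF] [_ dG]; rewrite /partial deriveM// !update_id.
by rewrite /GRing.scale /= addrC mulrC.
Qed.

Lemma partial_sum i (J : Type) (s : seq J) (F : J -> (I -> R) -> R) v :
  (forall j, regular (F j)) ->
  partial i (fun v => \sum_(j <- s) F j v) v = \sum_(j <- s) partial i (F j) v.
Proof.
move=> rF; elim: s => [|j s IH].
  by under eq_fun do rewrite big_nil; rewrite big_nil partial_cst.
rewrite big_cons -IH -partialD//; last exact: regular_sum.
by under eq_fun do rewrite big_cons.
Qed.

Definition growth (m : nat) F := exists C, forall v,
  `|F v| <= C * (1 + \sum_j `|v j|) ^+ m.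

Let N v := 1 + \sum_j `|v j|.

Let N_ge1 v : 1 <= N v. Proof. by rewrite lerDl sumr_ge0. Qed.

Let N_gt0 v : 0 < N v. Proof. exact: lt_le_trans ltr01 (N_ge1 v). Qed.

Lemma growthW m p F : (m <= p)%N -> growth m F -> growth p F.
Proof.
move=> mp [C FC]; exists C => v; rewrite (le_trans (FC v))//.
have C0 : 0 <= C.
  have := le_trans (normr_ge0 _) (FC v).
  by rewrite pmulr_lge0//; apply: exprn_gt0; exact: N_gt0.
by rewrite ler_wpM2l//; apply: ler_weXn2l => //; exact: N_ge1.
Qed.

Lemma growth_cst m c : growth m (fun=> c).
Proof. by apply: (@growthW 0) => //; exists `|c| => v; rewrite expr0 mulr1. Qed.

Lemma growth_coord j : growth 1 (fun v => v j).
Proof.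
exists 1 => v; rewrite mul1r expr1 (bigD1 j)//= addrCA lerDl addr_ge0//.
by apply: sumr_ge0 => *; exact: normr_ge0.
Qed.

Lemma growthD m F G : growth m F -> growth m G -> growth m (fun v => F v + G v).
Proof.
move=> [C FC] [D GD]; exists (C + D) => v.
by rewrite (le_trans (ler_normD _ _))// mulrDl lerD.
Qed.

Lemma growthM m p F G : growth m F -> growth p G ->
  growth (m + p) (fun v => F v * G v).
Proof.
move=> [C FC] [D GD]; exists (C * D) => v.
by rewrite normrM exprD mulrACA ler_pM.
Qed.

Lemma growth_sum m (J : Type) (s : seq J) (F : J -> (I -> R) -> R) :
  (forall j, growth m (F j)) -> growth m (fun v => \sum_(j <- s) F j v).
Proof.
move=> rF; elim: s => [|j s IH].
  by under eq_fun do rewrite big_nil; exact: growth_cst.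
by under eq_fun do rewrite big_cons; exact: growthD.
Qed.

End RegularFunctional.

Section MatrixFunctional.
Context {R : realType} {I : finType}.
Implicit Types (v : I -> R) (i : I).

Definition regular_mx m n (M : (I -> R) -> 'M[R]_(m, n)) :=
  forall a b, regular (fun v => M v a b).

Definition partial_mx i m n (M : (I -> R) -> 'M[R]_(m, n)) v : 'M[R]_(m, n) :=
  \matrix_(a, b) partial i (fun v => M v a b) v.

Definition growth_mx p m n (M : (I -> R) -> 'M[R]_(m, n)) :=
  forall a b, growth p (fun v => M v a b).

Lemma eq_regular (F G : (I -> R) -> R) : F =1 G -> regular F -> regular G.
Proof. by move=> /funext ->. Qed.

Lemma regular_mx_cst m n (A : 'M[R]_(m, n)) : regular_mx (fun=> A).
Proof. by move=> a b; exact: regular_cst. Qed.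

Lemma regular_mxD m n (A B : (I -> R) -> 'M[R]_(m, n)) :
  regular_mx A -> regular_mx B -> regular_mx (fun v => A v + B v).
Proof.
move=> rA rB a b; apply: eq_regular (regularD (rA a b) (rB a b)) => v.
by rewrite mxE.
Qed.

Lemma regular_mxM m n p (A : (I -> R) -> 'M[R]_(m, n)) (B : (I -> R) -> 'M[R]_(n, p)) :
  regular_mx A -> regular_mx B -> regular_mx (fun v => A v *m B v).
Proof.
move=> rA rB a b.
apply: (@eq_regular (fun v => \sum_j A v a j * B v j b)) => [v|]; first by rewrite mxE.
by apply: regular_sum => j; exact: regularM.
Qed.

Lemma regular_tr m n (A : (I -> R) -> 'M[R]_(m, n)) :
  regular_mx A -> regular_mx (fun v => (A v)^T).
Proof. by move=> rA a b; apply: eq_regular (rA b a) => v; rewrite mxE. Qed.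

Lemma regular_det n (A : (I -> R) -> 'M[R]_n) :
  regular_mx A -> regular (fun v => \det (A v)).
Proof.
move=> rA; rewrite /determinant; apply: regular_sum => s.
apply: regularM; first exact: regular_cst.
by apply: regular_prod => j.
Qed.

(** Cramer's rule writes the entries as polynomials in those of [A v], divided by a determinant that
    never vanishes. *)
Lemma regular_invmx n (A : (I -> R) -> 'M[R]_n) :
  regular_mx A -> (forall v, A v \in unitmx) -> regular_mx (fun v => invmx (A v)).
Proof.
move=> rA uA a b.
apply: (@eq_regular (fun v => (\det (A v))^-1 * cofactor (A v) b a)) => [v|].
  by rewrite /invmx uA !mxE.
apply: regularM.
  apply: regularV; first exact: regular_det.
  by move=> v; have := uA v; rewrite unitmxE unitfE.
apply: regularM; first exact: regular_cst.
apply: regular_det => c d.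
by apply: eq_regular (rA (lift b c) (lift a d)) => v; rewrite !mxE.
Qed.

Lemma partial_mx_cst i m n (A : 'M[R]_(m, n)) v : partial_mx i (fun=> A) v = 0.
Proof. by apply/matrixP => a b; rewrite !mxE partial_cst. Qed.

Lemma partial_mxD i m n (A B : (I -> R) -> 'M[R]_(m, n)) v :
  regular_mx A -> regular_mx B ->
  partial_mx i (fun v => A v + B v) v = partial_mx i A v + partial_mx i B v.
Proof.
move=> rA rB; apply/matrixP => a b; rewrite !mxE -partialD//.
by congr (partial i _ v); apply/funext => w; rewrite mxE.
Qed.

Lemma partial_mxM i m n p (A : (I -> R) -> 'M[R]_(m, n))
    (B : (I -> R) -> 'M[R]_(n, p)) v : regular_mx A -> regular_mx B ->
  partial_mx i (fun v => A v *m B v) v =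
  partial_mx i A v *m B v + A v *m partial_mx i B v.
Proof.
move=> rA rB; apply/matrixP => a b; rewrite !mxE -big_split/=.
transitivity (partial i (fun v => \sum_j A v a j * B v j b) v).
  by congr (partial i _ v); apply/funext => w; rewrite mxE.
rewrite partial_sum => [|j]; last exact: regularM.
by apply: eq_bigr => j _; rewrite partialM// !mxE.
Qed.

Lemma partial_tr i m n (A : (I -> R) -> 'M[R]_(m, n)) v :
  partial_mx i (fun v => (A v)^T) v = (partial_mx i A v)^T.
Proof.
apply/matrixP => a b; rewrite !mxE; congr (partial i _ v).
by apply/funext => w; rewrite mxE.
Qed.

(** Differentiation of A A^-1 = 1. *)
Lemma partial_invmx i n (A : (I -> R) -> 'M[R]_n) v :
  regular_mx A -> (forall v, A v \in unitmx) ->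
  partial_mx i (fun v => invmx (A v)) v =
  - (invmx (A v) *m partial_mx i A v *m invmx (A v)).
Proof.
move=> rA uA; have rK := regular_invmx rA uA.
have := partial_mxM i v rA rK.
rewrite (_ : (fun v => A v *m invmx (A v)) = (fun=> 1%:M)); last first.
  by apply/funext => w; rewrite mulmxV.
rewrite partial_mx_cst => /esym/eqP; rewrite addrC addr_eq0 => /eqP E.
by rewrite -[LHS](mulKmx (uA v)) E mulmxN mulmxA.
Qed.

Lemma growth_mx_cst p m n (A : 'M[R]_(m, n)) : growth_mx p (fun=> A).
Proof. by move=> a b; exact: growth_cst. Qed.

Lemma eq_growth p (F G : (I -> R) -> R) : F =1 G -> growth p F -> growth p G.
Proof. by move=> /funext ->. Qed.

Lemma growth_mxM p q m n r (A : (I -> R) -> 'M[R]_(m, n)) (B : (I -> R) -> 'M[R]_(n, r)) :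
  growth_mx p A -> growth_mx q B -> growth_mx (p + q) (fun v => A v *m B v).
Proof.
move=> rA rB a b.
apply: (@eq_growth _ (fun v => \sum_j A v a j * B v j b)) => [v|]; first by rewrite mxE.
by apply: growth_sum => j; exact: growthM.
Qed.

End MatrixFunctional.

Section RegularizedWishart.
Context {R : realType} {n l k : nat}.
Variables (G : 'M[R]_(n, k)) (e : R).
Hypothesis G1 : G^T *m G = 1%:M.
Hypothesis e0 : 0 < e.
Local Notation I := ('I_n * 'I_l)%type.
Implicit Types (W : 'M[R]_(n, l)) (v : I -> R).

(* For e > 0 the matrix wishart W is invertible for every W, and as e -> 0 rinverse W tends to the
   pseudoinverse of G^T W: working with e > 0 avoids the null event on which G^T W is rank deficient. *)
Definition wishart W : 'M[R]_k := G^T *m W *m W^T *m G + e%:M.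
Definition iwishart W : 'M[R]_k := invmx (wishart W).
Definition rinverse W : 'M[R]_(l, k) := W^T *m G *m iwishart W.

Lemma wishart_quad W (x : 'cV[R]_k) :
  (x^T *m wishart W *m x) 0 0 = \sum_i (W^T *m G *m x) i 0 ^+ 2 + e * \sum_i x i 0 ^+ 2.
Proof.
rewrite /wishart mulmxDr mulmxDl mxE; congr (_ + _).
  rewrite (_ : _ *m x = (W^T *m G *m x)^T *m (W^T *m G *m x)).
    by rewrite mxE; apply: eq_bigr => i _; rewrite !mxE expr2.
  by rewrite !trmx_mul trmxK !mulmxA.
rewrite mul_mx_scalar -scalemxAl mxE; congr (_ * _).
by rewrite mxE; apply: eq_bigr => i _; rewrite !mxE expr2.
Qed.

Lemma wishart_unit W : wishart W \in unitmx.
Proof.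
rewrite -row_free_unit -kermx_eq0; apply/eqP/row_matrixP => i.
have : row i (kermx (wishart W)) *m wishart W = 0 by rewrite -row_mul mulmx_ker row0.
set y := row i _ => yS; have := wishart_quad W y^T.
rewrite trmxK yS mul0mx mxE => /esym/eqP.
rewrite paddr_eq0; last 2 first.
- by apply: sumr_ge0 => *; exact: sqr_ge0.
- by apply: mulr_ge0; [exact: ltW|apply: sumr_ge0 => *; exact: sqr_ge0].
move=> /andP[_]; rewrite mulf_eq0 gt_eqF//= psumr_eq0 => [|*]; last exact: sqr_ge0.
move=> /allP H; apply/rowP => j; have := H j; rewrite mem_index_enum => /(_ isT).
by rewrite sqrf_eq0 !mxE => /eqP.
Qed.

Lemma tr_wishart W : (wishart W)^T = wishart W.
Proof. by rewrite /wishart linearD /= tr_scalar_mx !trmx_mul !trmxK !mulmxA. Qed.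

Lemma tr_iwishart W : (iwishart W)^T = iwishart W.
Proof. by rewrite /iwishart trmx_inv tr_wishart. Qed.

Lemma mul_rinverse W : G^T *m W *m rinverse W = 1%:M - e *: iwishart W.
Proof.
rewrite /rinverse !mulmxA -(addrK e%:M (G^T *m W *m W^T *m G)) -/(wishart W).
by rewrite mulmxBl mulmxV ?wishart_unit// mul_scalar_mx.
Qed.

Lemma sqnorm_rinverse W :
  sqnorm (rinverse W) = \tr (iwishart W) - e * sqnorm (iwishart W).
Proof.
rewrite !sqnormE {1}/rinverse !trmx_mul trmxK tr_iwishart -!mulmxA.
rewrite [G^T *m _]mulmxA mul_rinverse mulmxBr mulmx1 -scalemxAr.
by rewrite linearB linearZ.
Qed.

End RegularizedWishart.

Lemma mul_delta_mxE {R : pzRingType} m n p q (A : 'M[R]_(m, n)) (B : 'M[R]_(p, q))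
    a b x y : (A *m delta_mx a b *m B) x y = A x a * B b y.
Proof.
rewrite -mulmxA mxE (bigD1 a)//= big1 ?addr0.
  rewrite mxE (bigD1 b)//= big1 ?addr0 ?mxE ?eqxx ?mul1r// => j jb.
  by rewrite mxE eqxx (negbTE jb) mul0r.
move=> j ja; rewrite mxE big1 ?mulr0// => j' _.
by rewrite mxE (negbTE ja) mul0r.
Qed.

Section RinverseRegular.
Context {R : realType} {n l k : nat}.
Variables (G : 'M[R]_(n, k)) (e : R).
Hypothesis G1 : G^T *m G = 1%:M.
Hypothesis e0 : 0 < e.
Local Notation I := ('I_n * 'I_l)%type.
Implicit Types (W : 'M[R]_(n, l)) (v : I -> R).
Local Notation K := (iwishart G e).
Local Notation H := (rinverse G e).

Lemma gram_rinverse W : (H W)^T *m H W = K W - e *: (K W *m K W).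
Proof.
rewrite {1}/rinverse !trmx_mul trmxK tr_iwishart -!mulmxA.
by rewrite [G^T *m _]mulmxA mul_rinverse// mulmxBr mulmx1 -scalemxAr.
Qed.

(** The diagonal of K = H^T H + e K^2, a sum of squares. The uniform bounds follow from it: e K_ii^2
    <= K_ii gives K_ii <= 1 / e, and each H_bi^2 and e K_ij^2 is at most K_ii. *)
Lemma iwishart_diagE W i :
  K W i i = \sum_b H W b i ^+ 2 + e * \sum_j K W i j ^+ 2.
Proof.
have gramE p q (A : 'M[R]_(p, q)) j : (A^T *m A) j j = \sum_b A b j ^+ 2.
  by rewrite mxE; apply: eq_bigr => b _; rewrite mxE expr2.
have subE (A B : 'M[R]_k) : (A - e *: B) i i = A i i - e * B i i by rewrite !mxE.
have := gramE _ _ (H W) i; rewrite gram_rinverse subE => <-.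
have <- : (K W *m K W) i i = \sum_j K W i j ^+ 2; last by rewrite subrK.
rewrite mxE; apply: eq_bigr => j _; rewrite expr2; congr (_ * _).
by rewrite -[in LHS]tr_iwishart mxE.
Qed.

Lemma iwishart_diag_ge0 W i : 0 <= K W i i.
Proof.
rewrite iwishart_diagE addr_ge0//; first by apply: sumr_ge0 => *; exact: sqr_ge0.
by apply: mulr_ge0; [exact: ltW|apply: sumr_ge0 => *; exact: sqr_ge0].
Qed.

Lemma le_iwishart_diag W i : e * K W i i <= 1.
Proof.
have H1 := iwishart_diagE W i; have := iwishart_diag_ge0 W i.
rewrite le_eqVlt => /predU1P[<-|K0]; first by rewrite mulr0.
rewrite -(ler_pM2r K0) mul1r -mulrA -expr2 {2}H1 -[leLHS]add0r lerD//.
  by apply: sumr_ge0 => *; exact: sqr_ge0.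
rewrite ler_pM2l// (bigD1 i)//= lerDl; apply: sumr_ge0 => *; exact: sqr_ge0.
Qed.

Lemma le_sqr_iwishart W i j : K W i j ^+ 2 <= e^-1 ^+ 2.
Proof.
have H1 := iwishart_diagE W i; have H2 := le_iwishart_diag W i.
have ee : e * e^-1 ^+ 2 = e^-1 by field; rewrite gt_eqF.
rewrite -(ler_pM2l e0) ee.
apply: (@le_trans _ _ (K W i i)); last by rewrite -(ler_pM2l e0) divff// gt_eqF.
rewrite H1 -[leLHS]add0r lerD//; first by apply: sumr_ge0 => *; exact: sqr_ge0.
rewrite ler_pM2l// (bigD1 j)//= lerDl; apply: sumr_ge0 => *; exact: sqr_ge0.
Qed.

Lemma le_sqr_rinverse W b i : H W b i ^+ 2 <= e^-1.
Proof.
have H1 := iwishart_diagE W i; have H2 := le_iwishart_diag W i.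
apply: (@le_trans _ _ (K W i i)); last by rewrite -(ler_pM2l e0) divff// gt_eqF.
rewrite H1 (bigD1 b)//= -addrA lerDl addr_ge0//.
  by apply: sumr_ge0 => *; exact: sqr_ge0.
by apply: mulr_ge0; [exact: ltW|apply: sumr_ge0 => *; exact: sqr_ge0].
Qed.

Definition mx_of v : 'M[R]_(n, l) := \matrix_(a, b) v (a, b).

Lemma regular_mx_of : regular_mx mx_of.
Proof. by move=> a b; apply: eq_regular (regular_coord (a, b)) => v; rewrite mxE. Qed.

Lemma growth_mx_of : growth_mx 1 mx_of.
Proof. by move=> a b; apply: eq_growth (growth_coord (a, b)) => v; rewrite mxE. Qed.

Lemma regular_wishart : regular_mx (fun v => wishart G e (mx_of v)).
Proof.
apply: regular_mxD; last exact: regular_mx_cst.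
apply: regular_mxM; last exact: regular_mx_cst.
apply: regular_mxM; last exact/regular_tr/regular_mx_of.
by apply: regular_mxM; [exact: regular_mx_cst|exact: regular_mx_of].
Qed.

Lemma regular_iwishart : regular_mx (fun v => K (mx_of v)).
Proof. by apply: regular_invmx; [exact: regular_wishart|move=> v; exact: wishart_unit]. Qed.

Lemma regular_rinverse : regular_mx (fun v => H (mx_of v)).
Proof.
apply: regular_mxM; last exact: regular_iwishart.
by apply: regular_mxM; [exact/regular_tr/regular_mx_of|exact: regular_mx_cst].
Qed.

Lemma growth_iwishart : growth_mx 0 (fun v => K (mx_of v)).
Proof.
move=> a b; exists e^-1 => v; rewrite expr0 mulr1 -ler_sqr ?nnegrE//; last first.
  by rewrite invr_ge0 ltW.
by rewrite real_normK ?num_real// le_sqr_iwishart.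
Qed.

Lemma growth_rinverse : growth_mx 0 (fun v => H (mx_of v)).
Proof.
move=> a b; exists (1 + e^-1) => v; rewrite expr0 mulr1.
have ei : 0 <= e^-1 by rewrite invr_ge0 ltW.
rewrite -ler_sqr ?nnegrE//; last by rewrite addr_ge0.
rewrite real_normK ?num_real// (le_trans (le_sqr_rinverse _ _ _))//.
nra.
Qed.

Lemma partial_mx_of a b v : partial_mx (a, b) mx_of v = delta_mx a b.
Proof.
apply/matrixP => c d; rewrite !mxE -(partial_coord (a, b) (c, d) v).
by congr (partial _ _ v); apply/funext => w; rewrite mxE.
Qed.

(** Product rule for H = W^T G K, with D = [delta_mx a b] as the increment of W. The first term
    differentiates W^T; the other two come from dK = - K dS K with dS = G^T D W^T G + G^T W D^T G,
    one for each summand. *)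
Lemma partial_rinverse a b v c i :
  partial (a, b) (fun v => H (mx_of v) c i) v =
  (c == b)%:R * (G *m K (mx_of v)) a i
  - (H (mx_of v) *m G^T) c a * H (mx_of v) b i
  - (H (mx_of v) *m G^T *m mx_of v) c b * (G *m K (mx_of v)) a i.
Proof.
pose D : 'M[R]_(n, l) := delta_mx a b; pose M := mx_of v.
have rM := regular_mx_of; have rK := regular_iwishart; have rS := regular_wishart.
have rMt := regular_tr rM.
have rG := @regular_mx_cst R I _ _ G; have rGt := @regular_mx_cst R I _ _ G^T.
have dS : partial_mx (a, b) (fun v => wishart G e (mx_of v)) v =
    G^T *m D *m M^T *m G + G^T *m M *m D^T *m G.
  rewrite partial_mxD//; last 2 first.
  - by do ! apply: regular_mxM => //.
  - exact: regular_mx_cst.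
  rewrite partial_mx_cst addr0 partial_mxM//; last first.
    by do ! apply: regular_mxM => //.
  rewrite partial_mx_cst mulmx0 addr0 partial_mxM//; last exact: regular_mxM.
  rewrite partial_mxM// partial_mx_cst mul0mx add0r partial_tr partial_mx_of.
  by rewrite mulmxDl.
have dH : partial_mx (a, b) (fun v => H (mx_of v)) v =
    D^T *m (G *m K M) - (H M *m G^T) *m D *m H M - (H M *m G^T *m M) *m D^T *m (G *m K M).
  rewrite partial_mxM//; last exact: regular_mxM.
  rewrite partial_mxM// partial_mx_cst mulmx0 addr0 partial_tr partial_mx_of.
  rewrite partial_invmx//; last by move=> w; exact: wishart_unit.
  rewrite dS -/(iwishart G e M) mulmxDr mulmxDl mulmxN mulmxDr opprD addrA.
  by rewrite /rinverse !mulmxA.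
have /matrixP/(_ c i) := dH; rewrite mxE => ->.
have subE (A B C : 'M[R]_(l, k)) : (A - B - C) c i = A c i - B c i - C c i.
  by rewrite !mxE.
rewrite subE trmx_delta.
have -> : delta_mx b a *m (G *m K M) = 1%:M *m delta_mx b a *m (G *m K M) by rewrite mul1mx.
rewrite !mul_delta_mxE.
by congr (_ * _ - _ - _); rewrite mxE.
Qed.

End RinverseRegular.

(** * Expectations of functionals of a Gaussian family *)

Section GaussianExpectation.
Context {R : realType} {d : measure_display} {T : measurableType d}.
Variables (P : probability T R) (I : finType) (X : I -> {RV P >-> R}).
Hypothesis gaussX : forall i (B : set R), measurable B ->
  distribution P (X i) B = normal_prob 0 1 B.
Hypothesis indepX : mutually_independent X.
Implicit Types F G : (I -> R) -> R.

Definition expect F : R := (\int[P]_w F (X ^~ w))%R.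

(** Quadratic growth is what second moments integrate; it covers v_i F for F of linear growth, and
    squared norms of matrices with entries of linear growth. *)
Definition moderate F := regular F /\ growth 2 F.

Lemma moderate_integrable F : moderate F ->
  P.-integrable setT (EFin \o (fun w => F (X ^~ w))).
Proof. by move=> [[mF _] [C FC]]; exact: integrable_gaussian_growth FC. Qed.

Lemma expect_cst c : expect (fun=> c) = c.
Proof. by rewrite /expect Rintegral_cst//= probability_setT mulr1. Qed.

Lemma expectD F G : moderate F -> moderate G ->
  expect (fun v => F v + G v) = expect F + expect G.
Proof. by move=> mF mG; rewrite /expect RintegralD//; exact: moderate_integrable. Qed.

Lemma expectZ c F : moderate F -> expect (fun v => c * F v) = c * expect F.
Proof. by move=> mF; rewrite /expect RintegralZl//; exact: moderate_integrable. Qed.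

Lemma moderate_cst c : moderate (fun=> c).
Proof. by split; [exact: regular_cst|exact: growth_cst]. Qed.

Lemma moderateD F G : moderate F -> moderate G -> moderate (fun v => F v + G v).
Proof. by move=> [? ?] [? ?]; split; [exact: regularD|exact: growthD]. Qed.

Lemma moderateZ c F : moderate F -> moderate (fun v => c * F v).
Proof.
move=> [? ?]; split; first by apply: regularM => //; exact: regular_cst.
exact: (growthM (growth_cst 0 c)).
Qed.

Lemma moderate_sum (J : Type) (s : seq J) (F : J -> (I -> R) -> R) :
  (forall j, moderate (F j)) -> moderate (fun v => \sum_(j <- s) F j v).
Proof.
by move=> mF; split; [apply: regular_sum|apply: growth_sum] => j; case: (mF j).
Qed.

Lemma expect_sum (J : Type) (s : seq J) (F : J -> (I -> R) -> R) :
  (forall j, moderate (F j)) ->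
  expect (fun v => \sum_(j <- s) F j v) = \sum_(j <- s) expect (F j).
Proof.
move=> mF; elim: s => [|j s IH].
  by under eq_fun do rewrite big_nil; rewrite big_nil expect_cst.
rewrite big_cons -IH -expectD//; last exact: moderate_sum.
by under eq_fun do rewrite big_cons.
Qed.

Lemma le_expect F G : moderate F -> moderate G -> (forall v, F v <= G v) ->
  expect F <= expect G.
Proof.
move=> mF mG FG; apply: le_Rintegral => //; by [exact: moderate_integrable|move=> w _; exact: FG].
Qed.

Lemma stein_expect i F : regular F -> growth 1 F -> moderate (partial i F) ->
  expect (fun v => v i * F v) = expect (partial i F).
Proof.
move=> rF [C FC] [rdF [D dFD]]; have [mF _] := rF; have [mdF _] := rdF.
apply: (@stein_gaussian _ _ _ _ _ _ gaussX indepX _ _ _ (`|C| + `|D|)) => //.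
- by move=> v; exact: regular_is_derive.
- by move=> v; exact: regular_continuous.
- move=> v; rewrite (le_trans (FC v))// expr1 ler_wpM2r//.
    by rewrite addr_ge0// sumr_ge0.
  by rewrite (le_trans (ler_norm _))// lerDl.
- move=> v; rewrite (le_trans (dFD v))// ler_wpM2r// ?sqr_ge0//.
  by rewrite (le_trans (ler_norm _))// lerDr.
Qed.

End GaussianExpectation.

Section WishartExpectation.
Context {R : realType} {d : measure_display} {T : measurableType d}.
Context {n l k : nat}.
Local Notation I := ('I_n * 'I_l)%type.
Variables (P : probability T R) (X : I -> {RV P >-> R}).
Hypothesis gaussX : forall i (B : set R), measurable B ->
  distribution P (X i) B = normal_prob 0 1 B.
Hypothesis indepX : mutually_independent X.
Variables (G : 'M[R]_(n, k)) (e : R).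
Hypothesis G1 : G^T *m G = 1%:M.
Hypothesis e0 : 0 < e.
Local Notation K v := (iwishart G e (mx_of v)).
Local Notation H v := (rinverse G e (mx_of v)).
Local Notation E := (expect X).

Let rM := @regular_mx_of R n l.
Let gM := @growth_mx_of R n l.
Let rK : regular_mx (fun v : I -> R => K v) := regular_iwishart G e0.
Let rH : regular_mx (fun v : I -> R => H v) := regular_rinverse G e0.
Let gK : growth_mx 0 (fun v : I -> R => K v) := growth_iwishart G e0.
Let gH : growth_mx 0 (fun v : I -> R => H v) := growth_rinverse G e0.
Let rG p q (A : 'M[R]_(p, q)) := @regular_mx_cst R I _ _ A.
Let gG p q (A : 'M[R]_(p, q)) := @growth_mx_cst R I 0 _ _ A.

Let regularN (F : (I -> R) -> R) : regular F -> regular (fun v => - F v).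
Proof.
move=> rF; apply: (eq_regular _ (regularM (@regular_cst R I (-1)) rF)) => v.
by rewrite mulN1r.
Qed.

Let growthN m (F : (I -> R) -> R) : growth m F -> growth m (fun v => - F v).
Proof. by move=> [C FC]; exists C => v; rewrite normrN. Qed.

Let partialHE (a : 'I_n) (b : 'I_l) c i : partial (a, b) (fun v : I -> R => H v c i) =
  (fun v => (c == b)%:R * (G *m K v) a i - (H v *m G^T) c a * H v b i -
     (H v *m G^T *m mx_of v) c b * (G *m K v) a i).
Proof. by apply/funext => v; rewrite partial_rinverse. Qed.

Let regular_partialH (a : 'I_n) (b : 'I_l) c i : regular (partial (a, b) (fun v : I -> R => H v c i)).
Proof.
rewrite partialHE.
apply: regularD; first apply: regularD.
- by apply: regularM; [exact: regular_cst|exact: (regular_mxM (rG G) rK)].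
- apply: regularN; apply: regularM; last exact: rH.
  exact: (regular_mxM rH (rG _)).
- apply: regularN; apply: regularM; last exact: (regular_mxM (rG G) rK).
  exact: (regular_mxM (regular_mxM rH (rG _)) rM).
Qed.

Let growth_partialH (a : 'I_n) (b : 'I_l) c i : growth 1 (partial (a, b) (fun v : I -> R => H v c i)).
Proof.
rewrite partialHE.
have gGK := growth_mxM (gG G) gK.
apply: growthD; first apply: growthD.
- by apply: (@growthW _ _ (0 + 0)) => //; apply: growthM; [exact: growth_cst|exact: gGK].
- apply: growthN; apply: (@growthW _ _ (0 + 0 + 0)) => //.
  by apply: growthM; [exact: (growth_mxM gH (gG _))|exact: gH].
- apply: growthN; apply: (@growthW _ _ (0 + 0 + 1 + (0 + 0))) => //.
  by apply: growthM; [exact: (growth_mxM (growth_mxM gH (gG _)) gM)|exact: gGK].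
Qed.

Let sumGK (v : I -> R) i : \sum_a G a i * (G *m K v) a i = K v i i.
Proof.
transitivity ((G^T *m (G *m K v)) i i); last by rewrite mulmxA G1 mul1mx.
by rewrite mxE; apply: eq_bigr => a _; rewrite [X in _ = X * _]mxE.
Qed.

Let sumHG (v : I -> R) b i : \sum_a G a i * (H v *m G^T) b a = H v b i.
Proof.
transitivity ((H v *m G^T *m G) b i); last by rewrite -mulmxA G1 mulmx1.
by rewrite mxE; apply: eq_bigr => a _; rewrite mulrC.
Qed.

Let trHGM (v : I -> R) : \tr (H v *m G^T *m mx_of v) = k%:R - e * \tr (K v).
Proof.
by rewrite -mulmxA mxtrace_mulC mul_rinverse// linearB linearZ /= mxtrace1.
Qed.

Lemma moderate_tr_iwishart : moderate (fun v : I -> R => \tr (K v)).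
Proof.
split; first by apply: regular_sum => i; exact: rK.
by apply: growth_sum => i; apply: (@growthW _ _ 0) => //; exact: gK.
Qed.

(* Stein's identity for the products W_ab H_bi, summed with the weights G_ai *)
Lemma expect_tr_iwishart :
  (l%:R - k%:R - 1) * E (fun v : I -> R => \tr (K v)) <= k%:R.
Proof.
have mK := moderate_tr_iwishart.
pose A (v : I -> R) := \sum_i \sum_b \sum_a G a i * (v (a, b) * H v b i).
pose B (v : I -> R) := \sum_i \sum_b \sum_a G a i * partial (a, b) (fun v : I -> R => H v b i) v.
have m1 a b i : moderate (fun v : I -> R => v (a, b) * H v b i).
  split; first by apply: regularM; [exact: regular_coord|exact: rH].
  apply: (@growthW _ _ (1 + 0)) => //.
  by apply: growthM; [exact: growth_coord|exact: gH].
have m2 a b i : moderate (partial (a, b) (fun v : I -> R => H v b i)).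
  by split; [exact: regular_partialH|apply: (@growthW _ _ 1)].
have mB : moderate B.
  by do ! apply: moderate_sum => ?; exact: moderateZ.
have EAB : E A = E B.
  rewrite /A /B (expect_sum gaussX) => [|i]; last by do 2 apply: moderate_sum => ?; exact: moderateZ.
  rewrite (expect_sum gaussX) => [|i]; last by do 2 apply: moderate_sum => ?; exact: moderateZ.
  apply: eq_bigr => i _.
  rewrite (expect_sum gaussX) => [|b]; last by apply: moderate_sum => ?; exact: moderateZ.
  rewrite (expect_sum gaussX) => [|b]; last by apply: moderate_sum => ?; exact: moderateZ.
  apply: eq_bigr => b _.
  rewrite (expect_sum gaussX) => [|a]; last exact: moderateZ.
  rewrite (expect_sum gaussX) => [|a]; last exact: moderateZ.
  apply: eq_bigr => a _; rewrite !(expectZ gaussX)//; congr (_ * _).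
  apply: (stein_expect gaussX indepX (i := (a, b)) (F := fun v => H v b i)).
  - exact: rH.
  - by apply: (@growthW _ _ 0) => //; exact: gH.
  - exact: m2.
(* [A] is the trace of G^T W H = 1 - e K. *)
have AE v : A v = k%:R - e * \tr (K v).
  rewrite -trHGM -mulmxA mxtrace_mulC /mxtrace; apply: eq_bigr => i _.
  rewrite mxE; apply: eq_bigr => b _; rewrite [X in _ = X * _]mxE mulr_suml.
  apply: eq_bigr => a _; rewrite mulrA; congr (_ * _ * _); by rewrite mxE.
have BE v : B v = l%:R * \tr (K v) - sqnorm (H v) - (k%:R - e * \tr (K v)) * \tr (K v).
  transitivity (\sum_i \sum_b (K v i i - H v b i ^+ 2 - (H v *m G^T *m mx_of v) b b * K v i i)).
    apply: eq_bigr => i _; apply: eq_bigr => b _.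
    rewrite -{1 2}(sumGK v i) {1}expr2 -{1}(sumHG v b i) mulr_sumr mulr_suml -!sumrB.
    apply: eq_bigr => a _; rewrite partial_rinverse// eqxx mul1r.
    by ring.
  rewrite exchange_big /=; under eq_bigr do rewrite !sumrB -mulr_sumr -/(\tr (K v)).
  rewrite !sumrB sumr_const card_ord -mulr_suml -/(\tr (H v *m G^T *m mx_of v)).
  by rewrite trHGM mulr_natl.
have mA : moderate A by do ! apply: moderate_sum => ?; exact: moderateZ.
(* Since |H|^2 = t - e q, [B] equals (l - k - 1) t + e q + e t^2. The terms with e are nonnegative
   and are dropped on this side; on the other side A = k - e t is at most k. *)
apply: (@le_trans _ _ (E B)).
  rewrite -(expectZ gaussX)//; apply: (le_expect gaussX) => [||v]; [exact: moderateZ|exact: mB|].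
  rewrite BE sqnorm_rinverse//; set t := \tr _; set q := sqnorm _.
  have q0 : 0 <= e * q.
    apply: mulr_ge0; first exact: ltW.
    by apply: sumr_ge0 => i _; apply: sumr_ge0 => j _; exact: sqr_ge0.
  have t0 : 0 <= e * t * t by rewrite -mulrA -expr2 mulr_ge0 ?sqr_ge0// ltW.
  by lra.
rewrite -EAB -[leRHS](expect_cst X); apply: (le_expect gaussX) => // [|v].
  exact: moderate_cst.
rewrite AE gerBl; apply: mulr_ge0; first exact: ltW.
by apply: sumr_ge0 => i _; exact: iwishart_diag_ge0.
Qed.

Let moderate_sqnorm p q (M : (I -> R) -> 'M[R]_(p, q)) : regular_mx M -> growth_mx 1 M ->
  moderate (fun v => sqnorm (M v)).
Proof.
move=> rM' gM'; split; first by do 2 apply: regular_sum => ?; apply: regularM; exact: rM'.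
by do 2 apply: growth_sum => ?; apply: (growthM (gM' _ _) (gM' _ _)).
Qed.

Lemma moderate_sqnorm_rinverse : moderate (fun v : I -> R => sqnorm (H v)).
Proof. by apply: moderate_sqnorm => // ? ?; exact: (@growthW _ _ 0). Qed.

Lemma moderate_sqnorm_mul_rinverse p (B : 'M[R]_(p, n)) :
  moderate (fun v : I -> R => sqnorm (B *m mx_of v *m H v)).
Proof.
apply: moderate_sqnorm; first exact: (regular_mxM (regular_mxM (rG _) rM) rH).
exact: (growth_mxM (growth_mxM (gG _) gM) gH).
Qed.

(** [H] depends on W only through G^T W, so it does not change when W moves along u e_b^T with G^T u
    = 0; this plays the part of the independence of u^T W and G^T W. In Stein's identity for [F]
    only the derivative of the explicit factor u^T W survives, and it sums to |u|^2 |H|^2. *)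
Lemma expect_orthogonal_rinverse (u : 'cV[R]_n) : u^T *m G = 0 ->
  E (fun v : I -> R => sqnorm (u^T *m mx_of v *m H v)) =
  sqnorm u * E (fun v : I -> R => sqnorm (H v)).
Proof.
move=> uG; pose q (v : I -> R) := u^T *m mx_of v *m H v.
have rq : regular_mx q by exact: (regular_mxM (regular_mxM (rG _) rM) rH).
have gq : growth_mx 1 q by exact: (growth_mxM (growth_mxM (gG _) gM) gH).
pose F b i (v : I -> R) := H v b i * q v 0 i.
have rF b i : regular (F b i) by apply: regularM; [exact: rH|exact: rq].
have gF b i : growth 1 (F b i).
  by apply: (@growthW _ _ (0 + 1)) => //; apply: growthM; [exact: gH|exact: gq].
have uGK v i : \sum_a u a 0 * (G *m K v) a i = 0.
  transitivity ((u^T *m (G *m K v)) 0 i); last by rewrite mulmxA uG mul0mx mxE.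
  by rewrite mxE; apply: eq_bigr => a _; rewrite [X in _ = X * _]mxE.
have uHG v c : \sum_a u a 0 * (H v *m G^T) c a = 0.
  transitivity ((H v *m (G^T *m u)) c 0).
    by rewrite mulmxA mxE; apply: eq_bigr => a _; rewrite mulrC.
  by rewrite -[G^T *m u]trmxK trmx_mul trmxK uG trmx0 mulmx0 mxE.
(* The derivative of [H] along u e_b^T. *)
have udH (v : I -> R) b c i :
    \sum_a u a 0 * partial (a, b) (fun v : I -> R => H v c i) v = 0.
  transitivity ((c == b)%:R * (\sum_a u a 0 * (G *m K v) a i)
     - (\sum_a u a 0 * (H v *m G^T) c a) * H v b i
     - (H v *m G^T *m mx_of v) c b * (\sum_a u a 0 * (G *m K v) a i)).
    rewrite !mulr_sumr mulr_suml -!sumrB; apply: eq_bigr => a _.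
    by rewrite partial_rinverse//; ring.
  by rewrite uGK uHG !mulr0 mul0r !subr0.
have dq a b i v : partial (a, b) (fun v => q v 0 i) v =
    u a 0 * H v b i + \sum_c (u^T *m mx_of v) 0 c * partial (a, b) (fun v : I -> R => H v c i) v.
  have /matrixP/(_ 0 i) : partial_mx (a, b) q v = u^T *m delta_mx a b *m H v +
      u^T *m mx_of v *m partial_mx (a, b) (fun v : I -> R => H v) v.
    rewrite partial_mxM//; last exact: regular_mxM.
    by rewrite partial_mxM// partial_mx_cst mul0mx add0r partial_mx_of.
  rewrite mxE => ->; rewrite mxE mul_delta_mxE [u^T 0 a]mxE; congr (_ + _).
  by rewrite mxE; apply: eq_bigr => c _; rewrite [X in _ * X = _]mxE.
have dF a b i v : partial (a, b) (F b i) v =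
    partial (a, b) (fun v : I -> R => H v b i) v * q v 0 i +
    H v b i * partial (a, b) (fun v => q v 0 i) v.
  by rewrite partialM.
have regdq a b i : regular (partial (a, b) (fun v => q v 0 i)).
  apply: (eq_regular (fun v => esym (dq a b i v))).
  apply: regularD; first by apply: regularM; [exact: regular_cst|exact: rH].
  apply: regular_sum => c; apply: regularM; last exact: regular_partialH.
  exact: (regular_mxM (rG _) rM).
have gdq a b i : growth 2 (partial (a, b) (fun v => q v 0 i)).
  apply: (eq_growth (fun v => esym (dq a b i v))).
  apply: growthD.
    by apply: (@growthW _ _ (0 + 0)) => //; apply: growthM; [exact: growth_cst|exact: gH].
  apply: growth_sum => c; apply: (@growthW _ _ (0 + 1 + 1)) => //.
  apply: growthM; last exact: growth_partialH.
  exact: (growth_mxM (gG _) gM).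
have mdF a b i : moderate (partial (a, b) (F b i)).
  split; first apply: (eq_regular (fun v => esym (dF a b i v))).
    apply: regularD; apply: regularM; [exact: regular_partialH|exact: rq|exact: rH|exact: regdq].
  apply: (eq_growth (fun v => esym (dF a b i v))); apply: growthD.
    by apply: (@growthW _ _ (1 + 1)) => //; apply: growthM; [exact: growth_partialH|exact: gq].
  by apply: (@growthW _ _ (0 + 2)) => //; apply: growthM; [exact: gH|exact: gdq].
have mvF a b i : moderate (fun v : I -> R => v (a, b) * F b i v).
  split; first by apply: regularM; [exact: regular_coord|exact: rF].
  by apply: (growthM (growth_coord _) (gF b i)).
pose A (v : I -> R) := \sum_i \sum_b \sum_a u a 0 * (v (a, b) * F b i v).
pose B (v : I -> R) := \sum_i \sum_b \sum_a u a 0 * partial (a, b) (F b i) v.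
have EAB : E A = E B.
  rewrite /A /B (expect_sum gaussX) => [|i]; last by do 2 apply: moderate_sum => ?; exact: moderateZ.
  rewrite (expect_sum gaussX) => [|i]; last by do 2 apply: moderate_sum => ?; exact: moderateZ.
  apply: eq_bigr => i _.
  rewrite (expect_sum gaussX) => [|b]; last by apply: moderate_sum => ?; exact: moderateZ.
  rewrite (expect_sum gaussX) => [|b]; last by apply: moderate_sum => ?; exact: moderateZ.
  apply: eq_bigr => b _.
  rewrite (expect_sum gaussX) => [|a]; last exact: moderateZ.
  rewrite (expect_sum gaussX) => [|a]; last exact: moderateZ.
  apply: eq_bigr => a _; rewrite !(expectZ gaussX)//; congr (_ * _).
  exact: (stein_expect gaussX indepX (i := (a, b))).
have AE : A = (fun v => sqnorm (q v)).
  apply/funext => v; rewrite /sqnorm big_ord1; apply: eq_bigr => i _.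
  rewrite expr2 [X in _ = X * _]mxE mulr_suml; apply: eq_bigr => b _.
  rewrite [X in _ = X * _ * _]mxE !mulr_suml; apply: eq_bigr => a _.
  by rewrite /F [X in _ = X * _ * _ * _]mxE [X in _ = _ * X * _ * _]mxE; ring.
have BE : B = (fun v => sqnorm u * sqnorm (H v)).
  apply/funext => v; rewrite {2}/sqnorm exchange_big mulr_sumr; apply: eq_bigr => i _.
  rewrite mulr_sumr; apply: eq_bigr => b _.
  transitivity ((\sum_a u a 0 * partial (a, b) (fun v : I -> R => H v b i) v) * q v 0 i +
    H v b i * (\sum_a u a 0 ^+ 2) * H v b i +
    H v b i * \sum_c (u^T *m mx_of v) 0 c * (\sum_a u a 0 * partial (a, b) (fun v : I -> R => H v c i) v)).
    under [X in _ = _ + _ * X]eq_bigr do rewrite mulr_sumr.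
    rewrite [X in _ = _ + _ * X]exchange_big /= !mulr_sumr !mulr_suml -!big_split /=.
    apply: eq_bigr => a _; rewrite dF dq !mulrDr !addrA; congr (_ + _ + _).
    - by ring.
    - by ring.
    - rewrite !mulr_sumr; apply: eq_bigr => c _; by ring.
  rewrite udH mul0r add0r [X in _ + _ * X]big1 ?mulr0 ?addr0 => [|c _]; last by rewrite udH mulr0.
  rewrite /sqnorm; under [X in _ = X * _]eq_bigr do rewrite big_ord1.
  by ring.
have sqH := moderate_sqnorm_rinverse.
by rewrite -(expectZ gaussX)// -BE -EAB AE.
Qed.

Lemma expect_orthogonal_rinverse_le (u : 'cV[R]_n) : u^T *m G = 0 ->
  E (fun v : I -> R => sqnorm (u^T *m mx_of v *m H v)) <=
  sqnorm u * E (fun v : I -> R => \tr (K v)).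
Proof.
move=> uG; rewrite expect_orthogonal_rinverse// ler_wpM2l ?sqnorm_ge0//.
apply: (le_expect gaussX) => [||v].
- exact: moderate_sqnorm_rinverse.
- exact: moderate_tr_iwishart.
- by rewrite sqnorm_rinverse// gerBl mulr_ge0 ?sqnorm_ge0// ltW.
Qed.

End WishartExpectation.

(** * Deterministic error bounds *)

Section TruncationError.
Context {R : realType}.

(** Pythagoras: Q Q^T B Q Q^T is the orthogonal projection of B onto the matrices of the form Q Y
    Q^T. *)
Lemma sqnorm_compress n m (B : 'M[R]_n) (Q : 'M[R]_(n, m)) (Y : 'M[R]_m) :
  orthonormal_cols Q ->
  sqnorm (B - Q *m Y *m Q^T) =
  sqnorm (B - Q *m (Q^T *m B *m Q) *m Q^T) + sqnorm (Q^T *m B *m Q - Y).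
Proof.
move=> oQ; pose M := Q^T *m B *m Q; have ME : Q^T *m B *m Q = M by [].
rewrite ME; clearbody M.
have -> : B - Q *m Y *m Q^T = (B - Q *m M *m Q^T) + Q *m (M - Y) *m Q^T.
  by rewrite mulmxBr mulmxBl addrA subrK.
rewrite [LHS]sqnormD sqnorm_orthonormal_r// sqnorm_orthonormal_l//.
suff -> : frobdot (B - Q *m M *m Q^T) (Q *m (M - Y) *m Q^T) = 0 by rewrite mulr0 addr0.
have Z : Q^T *m (B - Q *m M *m Q^T)^T *m Q = 0.
  apply: trmx_inj; rewrite trmx0 2!trmx_mul !trmxK mulmxBl mulmxBr !mulmxA oQ mul1mx.
  by rewrite -(mulmxA M) oQ mulmx1 ME subrr.
by rewrite frobdotE mulmxA mxtrace_mulC !mulmxA Z mul0mx linear0.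
Qed.

(* The rank-k candidate C is compared with the truncation Y inside the range of Q, where Eckart-Young
   applies to X; the part of B outside the range of Q is common to both. *)
Lemma truncation_error n m k (B C S : 'M[R]_n) (Q : 'M[R]_(n, m)) (X Y : 'M[R]_m) :
  orthonormal_cols Q -> truncated_svd k X Y ->
  projection S -> \tr S <= k%:R -> Q *m Q^T *m S = S ->
  S *m C = C -> C *m S = C ->
  frobenius_norm (B - Q *m Y *m Q^T) <=
  2 * frobenius_norm (Q^T *m B *m Q - X) + frobenius_norm (B - C).
Proof.
move=> oQ XY [sS SS] trS QS SC CS; set M := Q^T *m B *m Q.
have SQ : S *m (Q *m Q^T) = S by apply: trmx_inj; rewrite !trmx_mul trmxK sS QS.
pose D := Q^T *m C *m Q; pose S' := Q^T *m S *m Q.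
have pS' : projection S'.
  split; first by rewrite /S' !trmx_mul trmxK sS mulmxA.
  by rewrite /S' !mulmxA -(mulmxA _ Q Q^T) -(mulmxA _ S (Q *m Q^T)) SQ -(mulmxA _ S S) SS.
have SD : S' *m D = D.
  by rewrite /S' /D !mulmxA -(mulmxA _ Q Q^T) -(mulmxA _ S (Q *m Q^T)) SQ -(mulmxA _ S C) SC.
have trS' : \tr S' <= k%:R by rewrite /S' -mulmxA mxtrace_mulC -mulmxA SQ.
have CE : Q *m D *m Q^T = C.
  rewrite /D !mulmxA -SC !mulmxA QS SC -CS -!mulmxA SQ.
  by [].
have XYD := frobenius_truncated_svd_le XY pS' SD trS'.
have MY : frobenius_norm (M - Y) <= 2 * frobenius_norm (M - X) + frobenius_norm (M - D).
  have -> : M - Y = (M - X) + (X - Y) by rewrite addrA subrK.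
  rewrite (le_trans (frobenius_normD _ _))//.
  have : frobenius_norm (X - D) <= frobenius_norm (M - X) + frobenius_norm (M - D).
    rewrite -(frobenius_normN (M - X)) (le_trans _ (frobenius_normD _ _))//.
    by rewrite opprB addrA subrK.
  by lra.
have := sqnorm_compress B Y oQ; have := sqnorm_compress B D oQ.
rewrite CE -/M -!sqr_frobenius_norm.
set a := frobenius_norm (B - _ *m M *m _).
have := frobenius_norm_ge0 (B - C); have := frobenius_norm_ge0 (M - X).
have := frobenius_norm_ge0 (M - Y); have := frobenius_norm_ge0 (M - D).
have := frobenius_norm_ge0 (B - Q *m Y *m Q^T); move: MY.
set e := frobenius_norm (M - X); set y := frobenius_norm (M - Y).
set z := frobenius_norm (M - D); set u := frobenius_norm (B - C).
set v := frobenius_norm _ => yez v0 z0 y0 e0 u0 uE vE.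
have zu : z <= u by rewrite -ler_sqr ?nnegrE// uE lerDr sqr_ge0.
(* Here u^2 = a^2 + z^2 and v^2 = a^2 + y^2 with the same a. As y <= 2 e + z and z <= u, one gets
   v^2 <= u^2 + 4 e z + 4 e^2 <= (2 e + u)^2. *)
rewrite -ler_sqr ?nnegrE ?addr_ge0 ?mulr_ge0// vE.
have : y ^+ 2 <= (2 * e + z) ^+ 2 by rewrite ler_sqr ?nnegrE ?addr_ge0 ?mulr_ge0.
by nra.
Qed.

(* As B1 and B2 are positive semidefinite with orthogonal ranges, the cross term
   <B2, B1 - S B1 S> = - |R1^T S R2|^2 is nonpositive. *)
Lemma psd_split_error n m p (R1 : 'M[R]_(n, m)) (R2 : 'M[R]_(n, p)) (S B1 B2 : 'M[R]_n) :
  projection S -> R1^T *m R2 = 0 -> B1 = R1 *m R1^T -> B2 = R2 *m R2^T ->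
  sqnorm (B1 + B2 - S *m B1 *m S) <= sqnorm B2 + 2 * sqnorm (B1 - S *m B1).
Proof.
move=> pS R12 B1E B2E; have [sS SS] := pS.
have sB1 : B1^T = B1 by rewrite B1E trmx_mul trmxK.
have -> : B1 + B2 - S *m B1 *m S = B2 + (B1 - S *m B1 *m S) by rewrite addrCA addrA.
rewrite sqnormD -addrA lerD2l.
have -> : frobdot B2 (B1 - S *m B1 *m S) = - sqnorm (R1^T *m S *m R2).
  rewrite frobdotE mulmxBr linearB /=.
  rewrite (_ : B2^T *m B1 = 0); last first.
    rewrite B2E B1E trmx_mul trmxK -mulmxA (mulmxA R2^T) -[R2^T *m R1]trmxK trmx_mul trmxK.
    by rewrite R12 trmx0 mul0mx mulmx0.
  rewrite linear0 sub0r; congr (- _); rewrite sqnormE !trmx_mul trmxK sS.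
  rewrite B2E trmx_mul trmxK -mulmxA mxtrace_mulC B1E !mulmxA.
  by rewrite [LHS]mxtrace_mulC !mulmxA.
(* Source of the factor 2: the components inside and outside the range of S are each at most |B1 - S
   B1|^2, the former because B1 - B1 S is the transpose of B1 - S B1. *)
have -> : sqnorm (B1 - S *m B1 *m S) = sqnorm (S *m (B1 - B1 *m S)) + sqnorm (B1 - S *m B1).
  rewrite [LHS](sqnorm_projection _ pS); congr (_ + _); congr sqnorm.
    by rewrite !mulmxBr !mulmxA SS.
  rewrite mulmxBr !mulmxA SS opprB addrA subrK.
  by [].
have : sqnorm (S *m (B1 - B1 *m S)) <= sqnorm (B1 - S *m B1).
  rewrite (le_trans (sqnorm_projection_le _ pS))//.
  by rewrite -sqnorm_tr linearB /= trmx_mul sS sB1.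
have := sqnorm_ge0 (R1^T *m S *m R2); lra.
Qed.

End TruncationError.

Lemma mul_diag_trE {R : pzRingType} m n p (M : 'M[R]_(m, n)) (N : 'M[R]_(p, n)) (v : 'rV[R]_n) a b :
  (M *m diag_mx v *m N^T) a b = \sum_j M a j * v 0 j * N b j.
Proof. by rewrite mul_mx_diag mxE; apply: eq_bigr => j _; rewrite !mxE. Qed.

(** * Splitting off the dominant eigenvectors *)

Section TailSplit.
Context {R : realType} {n k : nat}.
Variables (le_kn : (k <= n)%N) (U : 'M[R]_n).
Hypothesis oU : orthonormal_cols U.
Implicit Types v : 'rV[R]_n.

Definition head_cols : 'M[R]_(n, k) := colsub (widen_ord le_kn) U.

Definition head_row v : 'rV[R]_k := \row_i v 0 (widen_ord le_kn i).

(** Padded with zeros to full length, so that the tail stays diagonal in the whole basis [U]. *)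
Definition tail_row v : 'rV[R]_n := \row_j if (k <= j)%N then v 0 j else 0.

Lemma diag_split v : U *m diag_mx v *m U^T =
  head_cols *m diag_mx (head_row v) *m head_cols^T + U *m diag_mx (tail_row v) *m U^T.
Proof.
apply/matrixP => a b; rewrite [RHS]mxE !mul_diag_trE.
have -> : \sum_j head_cols a j * head_row v 0 j * head_cols b j =
    \sum_(j < n | (j < k)%N) U a j * v 0 j * U b j.
  by rewrite (big_ord_narrow le_kn); apply: eq_bigr => j _; rewrite !mxE.
rewrite (bigID (fun j : 'I_n => (j < k)%N)) /=; congr (_ + _).
rewrite [LHS]big_mkcond /=; apply: eq_bigr => j _; rewrite !mxE -leqNgt.
by case: ifP; rewrite ?mulr0 ?mul0r.
Qed.

Lemma head_cols_orthonormal : head_cols^T *m head_cols = 1%:M.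
Proof.
apply/matrixP => i j; have /matrixP/(_ (widen_ord le_kn i) (widen_ord le_kn j)) := oU.
rewrite !mxE => E; rewrite -[RHS]E.
by apply: eq_bigr => a _; rewrite !mxE.
Qed.

Lemma tail_col_orthogonal (j : 'I_n) : (k <= j)%N -> (col j U)^T *m head_cols = 0.
Proof.
move=> kj; apply/matrixP => a i; have /matrixP/(_ j (widen_ord le_kn i)) E := oU.
rewrite [RHS]mxE; transitivity ((U^T *m U) j (widen_ord le_kn i)).
  by rewrite [LHS]mxE [RHS]mxE; apply: eq_bigr => b _; rewrite !mxE.
rewrite E mxE (_ : (_ == _) = false) //; apply/negbTE/eqP => /(congr1 val) /= ji.
by move: kj; rewrite ji leqNgt ltn_ord.
Qed.

Lemma head_tail_orthogonal v : head_cols^T *m (U *m diag_mx (tail_row v)) = 0.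
Proof.
apply/matrixP => i j; rewrite mulmxA mul_mx_diag mxE [tail_row v 0 j]mxE [RHS]mxE.
case: ifP => kj; last by rewrite mulr0.
have /matrixP/(_ 0 i) := tail_col_orthogonal kj; rewrite [RHS]mxE => E.
suff -> : (head_cols^T *m U) i j = 0 by rewrite mul0r.
rewrite -[RHS]E [LHS]mxE [RHS]mxE; apply: eq_bigr => a _; rewrite !mxE; exact: mulrC.
Qed.

Lemma sqnorm_tail v : sqnorm (U *m diag_mx (tail_row v) *m U^T) =
  \sum_(j < n | (k <= j)%N) v 0 j ^+ 2.
Proof.
rewrite sqnorm_orthonormal_r// sqnorm_orthonormal_l// sqnorm_diag [RHS]big_mkcond /=.
by apply: eq_bigr => j _; rewrite mxE; case: ifP; rewrite ?expr0n.
Qed.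

Lemma sqnorm_tail_mul_le p v v' (Y : 'M[R]_(n, p)) : (forall j, `|v 0 j| <= v' 0 j) ->
  sqnorm (U *m diag_mx (tail_row v) *m U^T *m Y) <=
  \sum_(j < n | (k <= j)%N) v' 0 j ^+ 2 * sqnorm ((col j U)^T *m Y).
Proof.
move=> vv'; rewrite -!mulmxA sqnorm_orthonormal_l// [leRHS]big_mkcond /=.
apply: ler_sum => j _; rewrite mul_diag_mx.
have -> : \sum_i (\matrix_(i0, j0) (tail_row v 0 i0 * (U^T *m Y) i0 j0)) j i ^+ 2 =
    tail_row v 0 j ^+ 2 * sqnorm ((col j U)^T *m Y).
  rewrite /sqnorm big_ord1 mulr_sumr; apply: eq_bigr => i _; rewrite mxE exprMn.
  congr (_ * _ ^+ 2); rewrite [LHS]mxE [RHS]mxE; apply: eq_bigr => a _; by rewrite !mxE.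
rewrite mxE; case: ifP => _; last by rewrite expr0n mul0r.
rewrite ler_wpM2r ?sqnorm_ge0// -(real_normK (num_real (v 0 j))).
by rewrite ler_sqr ?nnegrE// (le_trans _ (vv' j)).
Qed.

End TailSplit.
Arguments tail_row {R n} k v.

Section RegularizedError.
Context {R : realType} {n l k : nat}.
Variables (le_kn : (k <= n)%N) (U : 'M[R]_n) (d g : 'rV[R]_n) (p : {poly R}) (e c c' : R).
Hypothesis oU : orthonormal_cols U.
Hypothesis e0 : 0 < e.
Hypothesis g0 : forall j, 0 <= g 0 j.
Hypothesis p0 : forall j, 0 < p.[d 0 j].
Hypothesis pg : forall j, p.[d 0 j] <= g 0 j.
Hypothesis gc : forall j, g 0 j <= c * p.[d 0 j].
Hypothesis pc : forall j, p.[d 0 j] <= c'.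
Variable W : 'M[R]_(n, l).
Local Notation A := (U *m diag_mx d *m U^T).
Local Notation G := (head_cols le_kn U).
Local Notation K := (iwishart G e W).
Local Notation H := (rinverse G e W).

(** Undoes p(A) on the dominant eigenvectors and puts g in its place. Its entries are at most [c],
    which becomes 1 / (1 - gamma^s / s!). *)
Let q : 'rV[R]_k := \row_i (g 0 (widen_ord le_kn i) / p.[d 0 (widen_ord le_kn i)]).

Let sandwich_le m (X : 'M[R]_(m, k)) :
  sqnorm (X *m diag_mx q) <= c ^+ 2 * sqnorm X.
Proof.
rewrite -sqnorm_tr trmx_mul tr_diag_mx -(sqnorm_tr X).
apply: sqnorm_mul_diag_le => i; rewrite mxE ger0_norm; first by rewrite ler_pdivrMr.
by rewrite divr_ge0// ltW.
Qed.

(* S B1 is the best approximation of B1 with columns in the range of Z = p(A) W H; it is compared with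
   Z diag(q) G^T, which would equal B1 if the tail of p(A) and e both vanished. *)
Lemma regularized_projection_error (S B1 : 'M[R]_n) : projection S ->
  S *m (poly_mx p A *m W *m H) = poly_mx p A *m W *m H ->
  B1 = G *m diag_mx (head_row le_kn g) *m G^T ->
  sqnorm (B1 - S *m B1) <= e ^+ 2 * (c * c') ^+ 2 * sqnorm K +
    c ^+ 2 * \sum_(j < n | (k <= j)%N) g 0 j ^+ 2 * sqnorm ((col j U)^T *m W *m H).
Proof.
move=> pS SZ B1E; set Z := poly_mx p A *m W *m H in SZ.
have oG : orthonormal_cols G := head_cols_orthonormal le_kn oU.
pose ph := head_row le_kn (map_mx (horner p) d).
pose P2 := U *m diag_mx (tail_row k (map_mx (horner p) d)) *m U^T.
have ZE : Z = G *m diag_mx ph *m (1%:M - e *: K) + P2 *m (W *m H).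
  rewrite /Z poly_mx_diagonalized// (diag_split le_kn) -/ph -/P2 -!mulmxA mulmxDl.
  by rewrite -!mulmxA [in LHS](mulmxA G^T) mul_rinverse.
have phq : diag_mx ph *m diag_mx q = diag_mx (head_row le_kn g).
  apply/matrixP => i j; rewrite mul_mx_diag !mxE; case: eqP => [->|_].
    by rewrite !mulr1n mulrC divfK// gt_eqF.
  by rewrite !mulr0n mul0r.
have BZ : B1 - Z *m (diag_mx q *m G^T) =
    (G *m (e *: (diag_mx ph *m K *m diag_mx q)) - P2 *m (W *m H *m diag_mx q)) *m G^T.
  rewrite ZE B1E -phq; set X := P2 *m _; set D := diag_mx ph; set D' := diag_mx q.
  have -> : G *m (D *m D') *m G^T = G *m D *m (D' *m G^T) by rewrite !mulmxA.
  rewrite -mulmxBl -{1}[G *m D]mulmx1 opprD addrA -mulmxBr opprB addrCA subrr addr0.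
  rewrite [LHS]mulmxA; congr (_ *m _); rewrite [LHS]mulmxBl; congr (_ - _); last by rewrite /X -!mulmxA.
  by rewrite -!scalemxAr -scalemxAl !mulmxA.
apply: (@le_trans _ _ (sqnorm (B1 - Z *m (diag_mx q *m G^T)))).
  have -> : B1 - S *m B1 = (1%:M - S) *m (B1 - Z *m (diag_mx q *m G^T)).
    rewrite mulmxBl mul1mx mulmxBr (mulmxA S Z) SZ.
    by rewrite opprB addrA subrK.
  exact: sqnorm_projection_le (projection_compl pS).
(* The regularization error has its columns in the range of G and the tail error in the orthogonal
   complement, so their squares add up without a cross term. *)
rewrite BZ sqnorm_orthonormal_r// sqnormD sqnormN frobdotNr.
have -> : frobdot (G *m (e *: (diag_mx ph *m K *m diag_mx q))) (P2 *m (W *m H *m diag_mx q)) = 0.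
  rewrite frobdotE trmx_mul /P2 !mulmxA -(mulmxA _ G^T U) -(mulmxA _ (G^T *m U)).
  by rewrite -(mulmxA G^T) head_tail_orthogonal// mulmx0 !mul0mx linear0.
rewrite oppr0 mulr0 addr0 sqnorm_orthonormal_l// sqnormZ lerD//.
  rewrite -mulrA ler_wpM2l ?sqr_ge0// (le_trans (sandwich_le _))//.
  rewrite exprMn -[leRHS]mulrA ler_wpM2l ?sqr_ge0// sqnorm_mul_diag_le// => i.
  by rewrite !mxE ger0_norm ?pc// ltW.
rewrite (mulmxA P2) (le_trans (sandwich_le _))// ler_wpM2l ?sqr_ge0//.
under [leRHS]eq_bigr do rewrite -(mulmxA _ W).
apply: sqnorm_tail_mul_le => // j.
by rewrite mxE ger0_norm ?pg// ltW.
Qed.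

End RegularizedError.

(** * Relative accuracy of the Taylor polynomials of the exponential *)

Section ExpTaylor.
Context {R : realType}.

Lemma derive_ge0_from0 (f df : R -> R) : (forall y : R, is_derive y 1 f (df y)) ->
  f 0 = 0 -> (forall y, 0 <= y -> 0 <= df y) -> forall y, 0 <= y -> 0 <= f y.
Proof.
move=> fdf f0 df0 y; rewrite le_eqVlt => /predU1P[<-|y0]; first by rewrite f0.
have cf : {within `[0, y], continuous f}.
  apply: continuous_subspaceT => z; apply: differentiable_continuous.
  by apply/derivable1_diffP; case: (fdf z).
have [z] := MVT y0 (fun z _ => fdf z) cf.
rewrite in_itv /= f0 !subr0 => /andP[z0 _] ->.
by rewrite mulr_ge0 ?df0 ?ltW.
Qed.

Definition exp_taylor (s : nat) : {poly R} := \poly_(i < s) (i`!%:R)^-1.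

Lemma deriv_exp_taylor s : (exp_taylor s.+1)^`() = exp_taylor s.
Proof.
apply/polyP => i; rewrite coef_deriv !coef_poly ltnS; case: ifP => _; last by rewrite mul0rn.
rewrite -mulr_natr factS natrM; field.
by rewrite !pnatr_eq0 -lt0n fact_gt0 nat1r pnatr_eq0.
Qed.

Lemma exp_taylor0 s : (exp_taylor s.+1).[0] = 1.
Proof. by rewrite horner_coef0 coef_poly /= fact0 invr1. Qed.

(** Differentiation lowers s by one, and for s > 0 the difference vanishes at 0, so its sign is
    inherited. *)
Lemma exp_taylor_le s (y : R) : 0 <= y -> 0 <= expR y - (exp_taylor s).[y].
Proof.
elim: s y => [|s IH]; first by move=> y _; rewrite /exp_taylor poly_def big_ord0 horner0 subr0 expR_ge0.
apply: (derive_ge0_from0 (f := fun y => expR y - (exp_taylor s.+1).[y])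
  (df := fun y => expR y - (exp_taylor s).[y])) => //.
  by move=> y; rewrite -(deriv_exp_taylor s); exact: is_derive_exp_sub_poly.
by rewrite exp_taylor0 expR0 subrr.
Qed.

(** The Taylor remainder is at most e^y y^s / s!. The derivative of the slack at s + 1 is the slack
    at s plus e^y y^(s+1) / (s+1)!, and the slack at s + 1 vanishes at y = 0. *)
Lemma exp_taylor_ge s (y : R) : 0 <= y ->
  0 <= expR y * (y ^+ s / s`!%:R) - (expR y - (exp_taylor s).[y]).
Proof.
elim: s y => [|s IH].
  by move=> y _; rewrite /exp_taylor poly_def big_ord0 horner0 subr0 expr0 fact0 divr1 mulr1 subrr.
pose q : {poly R} := (s.+1`!%:R)^-1 *: 'X^(s.+1).
have dq : q^`() = (s`!%:R)^-1 *: 'X^s.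
  rewrite derivZ derivXn -scalerMnr scalerMnl /=; congr (_ *: _).
  rewrite -mulr_natr factS natrM; field.
  by rewrite !pnatr_eq0 -lt0n fact_gt0 nat1r pnatr_eq0.
apply: (derive_ge0_from0 (f := fun y => expR y * (y ^+ s.+1 / s.+1`!%:R) - (expR y - (exp_taylor s.+1).[y]))
  (df := fun y => expR y * (y ^+ s.+1 / s.+1`!%:R) +
    (expR y * (y ^+ s / s`!%:R) - (expR y - (exp_taylor s).[y])))).
- move=> y; have d1 := is_derive_exp_sub_poly (exp_taylor s.+1) y.
  have d2 : is_derive y 1 (fun y : R => q.[y]) q^`().[y] by exact: is_derive_poly.
  have d3 : is_derive y 1 (expR : R -> R) (expR y) by exact: is_derive_expR.
  have := is_deriveB (is_deriveM d3 d2) d1.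
  rewrite deriv_exp_taylor dq /q => /is_derive_eq dd.
  rewrite (_ : (fun z => _) = expR * (fun z : R => q.[z]) -
      (fun z : R => expR z - (exp_taylor s.+1).[z])); last first.
    apply/funext => z; rewrite /q; congr (_ * _ - _).
    by rewrite hornerZ hornerXn mulrC.
  apply: dd; rewrite !hornerZ !hornerXn /GRing.scale /=; ring.
- by rewrite exp_taylor0 expR0 expr0n mul0r mulr0 !subrr.
- move=> y y0; rewrite addr_ge0 ?IH// mulr_ge0 ?expR_ge0// divr_ge0 ?exprn_ge0//.
Qed.

(** The expansion is made at the left endpoint, so that x - a >= 0 and both one-sided estimates
    apply. The remainder bound is a multiple of exp (x - a), hence the error is relative. *)
Lemma exp_taylor_sandwich (a b : R) s : exists2 p : {poly R}, (size p <= s)%N &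
  forall x, a <= x <= b ->
    (1 - (b - a) ^+ s / s`!%:R) * expR x <= p.[x] /\ p.[x] <= expR x.
Proof.
exists (expR a *: (exp_taylor s \Po ('X - a%:P))) => [|x /andP[ax xb]].
  rewrite (leq_trans (size_scale_leq _ _))// size_comp_poly2 ?size_XsubC//.
  exact: size_poly.
rewrite hornerZ horner_comp !hornerE.
have xa : 0 <= x - a by rewrite subr_ge0.
have -> : expR x = expR a * expR (x - a) by rewrite -expRD addrC subrK.
split; last by rewrite ler_wpM2l ?expR_ge0// -subr_ge0 exp_taylor_le.
rewrite mulrCA ler_wpM2l ?expR_ge0//.
apply: (@le_trans _ _ (expR (x - a) - expR (x - a) * ((x - a) ^+ s / s`!%:R))).
  rewrite mulrBl mul1r lerD2l lerN2 mulrC ler_wpM2r ?expR_ge0// ler_wpM2r//.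
  by rewrite lerXn2r ?nnegrE ?lerD2r// (le_trans xa)// lerD2r.
by have := exp_taylor_ge s xa; lra.
Qed.

(** The term s^s / s! of the exponential series at s is below e^s, and (e g)^s <= s^s. This keeps 1
    - gamma^s / s! positive. *)
Lemma pow_fact_lt1 (g : R) s : (0 < s)%N -> 0 <= g -> expR 1 * g <= s%:R ->
  g ^+ s / s`!%:R < 1.
Proof.
case: s => // s _ g0 egs.
have e0 : 0 < expR 1 ^+ s.+1 :> R by rewrite exprn_gt0 ?expR_gt0.
rewrite -(ltr_pM2l e0) mulr1 mulrA -exprMn.
apply: (@le_lt_trans _ _ (s.+1%:R ^+ s.+1 / s.+1`!%:R)).
  by rewrite ler_wpM2r// lerXn2r ?nnegrE ?mulr_ge0 ?expR_ge0.
rewrite -expRM_natl mulr1; apply: lt_le_trans (expR_ge1Dxn s _) => //.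
by rewrite ltrDr.
Qed.

End ExpTaylor.

Section SpectralNorm.
Context {R : realType}.

(** The supremum is taken over a set bounded by the Frobenius norm of [M]. *)
Lemma le_spectral_norm m n (M : 'M[R]_(m, n)) (x : 'cV[R]_n) :
  frobenius_norm x <= 1 -> frobenius_norm (M *m x) <= spectral_norm M.
Proof.
move=> x1; apply: ub_le_sup; last by exists x.
exists (frobenius_norm M) => _ [y /= y1 <-].
rewrite -ler_sqr ?nnegrE ?frobenius_norm_ge0// !sqr_frobenius_norm.
rewrite (le_trans (sqnormM_le _ _))// ler_piMr ?sqnorm_ge0//.
by rewrite -sqr_frobenius_norm exprn_ile1 ?frobenius_norm_ge0.
Qed.

(** The unit eigenvector is tested in the supremum. For exp(A) this puts the spectral norm in place
    of exp (lambda_1). *)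
Lemma eigenvalue_le_spectral_norm n (U : 'M[R]_n) (g : 'rV[R]_n) j : orthonormal_cols U ->
  g 0 j <= spectral_norm (U *m diag_mx g *m U^T).
Proof.
move=> oU; pose u := col j U.
have u1 : sqnorm u = 1 by exact: sqnorm_col_orthonormal.
have Mu : U *m diag_mx g *m U^T *m u = g 0 j *: u.
  rewrite /u colE -!mulmxA (mulmxA U^T) oU mul1mx scalemxAr; congr (_ *m _).
  apply/matrixP => a b; rewrite mul_diag_mx !mxE.
  by case: eqP => [->//|_]; rewrite !mulr0.
apply: le_trans (le_spectral_norm (x := u) _ _); last first.
  by rewrite frobenius_normE u1 sqrtr1.
rewrite Mu frobenius_normE sqnormZ u1 mulr1 sqrtr_sqr.
exact: ler_norm.
Qed.

End SpectralNorm.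

(** * Error bound for a fixed starting block *)

Section PathwiseBound.
Context {R : realType} {n l k k' s r : nat}.
Variables (le_kn : (k' <= n)%N) (U : 'M[R]_n) (d : 'rV[R]_n) (lo hi e : R).
Hypothesis oU : orthonormal_cols U.
Hypothesis le_kk : (k' <= k)%N.
Hypothesis s0 : (0 < s)%N.
Hypothesis lohi : lo <= hi.
Hypothesis dlh : forall j, lo <= d 0 j <= hi.
Hypothesis gs : expR 1 * (hi - lo) <= s%:R.
Hypothesis e0 : 0 < e.
Variables (W : 'M[R]_(n, l)) (ALG : 'M[R]_n).
Local Notation A := (U *m diag_mx d *m U^T).
Local Notation G := (head_cols le_kn U).
Local Notation K := (iwishart G e W).
Local Notation H := (rinverse G e W).
Local Notation c := (1 - (hi - lo) ^+ s / s`!%:R).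

(** The number k' of eigenvectors split off may be smaller than the truncation rank k: the projector
    onto the range of [Z] has trace at most k', hence at most k, which is all that optimality of the
    truncation asks of it. *)
Lemma krylov_aware_error :
  krylov_aware_output A W k s r expR ALG ->
  frobenius_norm (matrix_fun expR A - ALG) <=
  Num.sqrt (l%:R * s%:R) * (hi - lo) ^+ (2 * r + 2) / (2 ^+ (4 * r + 1) * (2 * r + 2)`!%:R) *
    expR hi +
  Num.sqrt (\sum_(j < n | (k' <= j)%N) expR (d 0 j) ^+ 2 +
    2 * (e ^+ 2 * (c^-1 * expR hi) ^+ 2 * sqnorm K +
      c^-1 ^+ 2 * \sum_(j < n | (k' <= j)%N) expR (d 0 j) ^+ 2 * sqnorm ((col j U)^T *m W *m H))).
Proof.
move=> [b [V [Y [lan svd ->]]]].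
have s_sr : (s <= s + r)%N by exact: leq_addr.
have sA : A^T = A by rewrite !trmx_mul tr_diag_mx trmxK mulmxA.
have oQ := lanczos_orthonormal lan s0 s_sr.
have [p sp pe] := exp_taylor_sandwich lo hi s.
have c0 : 0 < c by rewrite subr_gt0 pow_fact_lt1// subr_ge0.
pose Z := poly_mx p A *m W *m H; pose g := map_mx expR d.
have [S [pS SZ trS [Y' SY]]] := range_projection Z.
pose Q := concat_blocks V s.
(* [Z] is p(A) W H with p of degree below s, so its columns, and with them the range of S, lie in
   the Krylov space spanned by Q_s. *)
have QS : Q *m Q^T *m S = S.
  rewrite SY mulmxA; congr (_ *m _); rewrite /Z mulmxA; congr (_ *m _).
  rewrite /poly_mx mulmx_suml mulmx_sumr; apply: eq_bigr => i _.
  rewrite -scalemxAl -scalemxAr (lanczos_proj_krylov lan)//.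
  exact: leq_trans sp.
pose B1 := G *m diag_mx (head_row le_kn g) *m G^T.
pose B2 := U *m diag_mx (tail_row k' g) *m U^T.
have BE : matrix_fun expR A = B1 + B2 by rewrite matrix_funE// (diag_split le_kn).
pose C := S *m B1 *m S; have [sS SS] := pS.
have trSk : \tr S <= k%:R by rewrite (le_trans trS)// ler_nat.
have SC : S *m C = C by rewrite /C !mulmxA SS.
have CS : C *m S = C by rewrite /C -!mulmxA SS.
apply: le_trans (truncation_error (matrix_fun expR A) oQ svd pS trSk QS SC CS) _.
apply: lerD.
  have m0 : (0 < 2 * r + 2)%N by rewrite addn2.
  have [t st te] := exp_poly_approx lohi m0.
  set D := expR hi * _ / _ in te.
  have D0 : 0 <= D by rewrite divr_ge0 ?mulr_ge0 ?expR_ge0 ?exprn_ge0 ?subr_ge0.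
  apply: le_trans (ler_wpM2l _ (lanczos_matrix_fun_error s0 sA lan oU erefl dlh st D0 te)) _ => //.
  (* The factors 2 of the truncation and of the Lanczos error cancel 2^2 out of 2^(4r+3). *)
  rewrite /D (_ : (2 * (2 * r + 2) - 1 = 4 * r + 1 + 2)%N); last first.
    by rewrite mulnDr mulnA -addnBA// -addnA.
  rewrite (exprD 2 (4 * r + 1) 2) le_eqVlt; apply/orP; left; apply/eqP; field.
  by rewrite expf_neq0// pnatr_eq0 -lt0n fact_gt0.
rewrite frobenius_normE ler_sqrt; last first.
  have tail0 (q : 'I_n -> R) : (forall j, 0 <= q j) ->
      0 <= \sum_(j < n | (k' <= j)%N) expR (d 0 j) ^+ 2 * q j.
    by move=> q0; apply: sumr_ge0 => j _; rewrite mulr_ge0 ?sqr_ge0.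
  have t0 : 0 <= \sum_(j < n | (k' <= j)%N) expR (d 0 j) ^+ 2.
    by apply: sumr_ge0 => j _; exact: sqr_ge0.
  rewrite addr_ge0// mulr_ge0// addr_ge0// mulr_ge0 ?sqnorm_ge0//.
  - by rewrite mulr_ge0 ?sqr_ge0.
  - exact: sqr_ge0.
  - by apply: tail0 => j; exact: sqnorm_ge0.
have -> : matrix_fun expR A - C = B1 + B2 - S *m B1 *m S by rewrite BE.
(* Square roots of the eigenvalues write B1 and B2 as R R^T, the form in which positive
   semidefiniteness enters the splitting. *)
pose h := map_mx (fun x => Num.sqrt (expR x)) d.
have hg (v : R) : Num.sqrt (expR v) * Num.sqrt (expR v) = expR v.
  by rewrite -expr2 sqr_sqrtr// expR_ge0.
apply: le_trans (@psd_split_error _ _ _ _ (G *m diag_mx (head_row le_kn h))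
  (U *m diag_mx (tail_row k' h)) _ _ _ pS _ _ _) _.
- by rewrite trmx_mul -mulmxA head_tail_orthogonal// mulmx0.
- rewrite trmx_mul tr_diag_mx /B1 !mulmxA; congr (_ *m _); rewrite -!mulmxA; congr (_ *m _).
  apply/matrixP => i j; rewrite mul_mx_diag !mxE; case: eqP => [->|_]; last by rewrite !mulr0n mul0r.
  by rewrite !mulr1n hg.
- rewrite trmx_mul tr_diag_mx /B2 !mulmxA; congr (_ *m _); rewrite -!mulmxA; congr (_ *m _).
  apply/matrixP => i j; rewrite mul_mx_diag !mxE; case: eqP => [->|_]; last by rewrite !mulr0n mul0r.
  by rewrite !mulr1n; case: ifP => _; rewrite ?mulr0// hg.
rewrite lerD//.
  rewrite sqnorm_tail//; apply: ler_sum => j _; by rewrite mxE.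
rewrite ler_wpM2l//.
have gE j : g 0 j = expR (d 0 j) by rewrite mxE.
have := @regularized_projection_error _ _ l _ le_kn U d g p e c^-1 (expR hi) oU e0 _ _ _ _ _ W
  S B1 pS SZ erefl.
under eq_bigr do rewrite gE.
apply.
- by move=> j; rewrite gE expR_ge0.
- move=> j; have [pl _] := pe _ (dlh j); rewrite (lt_le_trans _ pl)// mulr_gt0 ?expR_gt0//.
- by move=> j; rewrite gE; case: (pe _ (dlh j)).
- by move=> j; rewrite gE mulrC ler_pdivlMr// mulrC; case: (pe _ (dlh j)).
- move=> j; case: (pe _ (dlh j)) => _ /le_trans; apply; rewrite ler_expR.
  by case/andP: (dlh j).
Qed.

End PathwiseBound.

(** * Expected error *)

(* f need not be measurable: the integral of a nonnegative function is a supremum over the simple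
   functions below it *)
Lemma le_expectation_dominated {R : realType} {d : measure_display} {T : measurableType d}
    (P : probability T R) (f g : T -> R) :
  (forall w, 0 <= f w) -> (forall w, f w <= g w) -> P.-integrable setT (EFin \o g) ->
  ('E_P[f] <= (\int[P]_w g w)%R%:E)%E.
Proof.
move=> f0 fg ig; rewrite unlock fineK; last exact: integrable_fin_num.
have g0 w : 0 <= g w by exact: le_trans (fg w).
rewrite !ge0_integralTE => [|w|w]; rewrite ?lee_fin//.
apply: le_ereal_sup => _ [h /= hf <-]; exists h => //= w.
by rewrite (le_trans (hf w))// lee_fin.
Qed.

Section ExpectationOfSquareRoot.
Context {R : realType} {d : measure_display} {T : measurableType d}.
Variables (P : probability T R) (I : finType) (X : I -> {RV P >-> R}).
Hypothesis gaussX : forall i (B : set R), measurable B ->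
  distribution P (X i) B = normal_prob 0 1 B.

(* Jensen's inequality for the square root, through AM-GM with weight c *)
Lemma expectation_sqrt_le (f : T -> R) (F : (I -> R) -> R) a b c : 0 < c ->
  (forall w, 0 <= f w) -> (forall w, f w <= a + Num.sqrt (F (X ^~ w))) ->
  (forall v, 0 <= F v) -> moderate F -> expect X F <= b ->
  ('E_P[f] <= (a + (b / c + c) / 2)%:E)%E.
Proof.
move=> c0 f0 fF F0 mF Fb; pose g (v : I -> R) := a + c / 2 + (2 * c)^-1 * F v.
have mg : moderate g by apply: moderateD; [exact: moderate_cst|exact: moderateZ].
apply: le_trans (le_expectation_dominated f0 (g := fun w => g (X ^~ w)) _ _) _.
- move=> w; rewrite (le_trans (fF w))// /g -addrA lerD2l.
  set x := Num.sqrt _; have -> : F (X ^~ w) = x ^+ 2 by rewrite sqr_sqrtr.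
  rewrite -subr_ge0 (_ : _ - x = (2 * c)^-1 * (c - x) ^+ 2); last by field; rewrite gt_eqF.
  by rewrite mulr_ge0 ?sqr_ge0// invr_ge0 mulr_ge0// ltW.
- exact: (moderate_integrable gaussX mg).
rewrite lee_fin -/(expect X g) (expectD gaussX); [|exact: moderate_cst|exact: moderateZ].
rewrite expect_cst (expectZ gaussX)//.
have -> : a + (b / c + c) / 2 = a + c / 2 + (2 * c)^-1 * b by field; rewrite gt_eqF.
by rewrite lerD2l ler_wpM2l// invr_ge0 mulr_ge0// ltW.
Qed.

End ExpectationOfSquareRoot.

Section ExpectedPathwiseBound.
Context {R : realType} {d : measure_display} {T : measurableType d}.
Context {n l k : nat}.
Local Notation I := ('I_n * 'I_l)%type.
Variables (P : probability T R) (X : I -> {RV P >-> R}).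
Hypothesis gaussX : forall i (B : set R), measurable B ->
  distribution P (X i) B = normal_prob 0 1 B.
Hypothesis indepX : mutually_independent X.
Variables (le_kn : (k <= n)%N) (U : 'M[R]_n) (e : R).
Hypothesis oU : orthonormal_cols U.
Hypothesis e0 : 0 < e.
Local Notation G := (head_cols le_kn U).
Local Notation K v := (iwishart G e (mx_of v)).
Local Notation H v := (rinverse G e (mx_of v)).

Let oG : G^T *m G = 1%:M. Proof. exact: head_cols_orthonormal. Qed.

Lemma expect_tr_iwishart_ge0 : 0 <= expect X (fun v => \tr (K v)).
Proof.
rewrite -(expect_cst X 0); apply: (le_expect gaussX) => [||v]; first exact: moderate_cst.
  exact: moderate_tr_iwishart.
by apply: sumr_ge0 => i _; exact: iwishart_diag_ge0.
Qed.

Variables (q : 'I_n -> R) (c1 c2 : R).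
Hypothesis q0 : forall j, 0 <= q j.
Hypothesis c2_ge0 : 0 <= c2.

Let tau := \sum_(j < n | (k <= j)%N) q j.

(** The radicand of the bound for a fixed block, after e |K|^2 <= tr K. One factor e remains in
    front of [c1], so this term disappears in the limit. *)
Definition tail_bound (v : I -> R) : R :=
  tau + 2 * (e * c1 * \tr (K v) +
    c2 * \sum_(j < n | (k <= j)%N) q j * sqnorm ((col j U)^T *m mx_of v *m H v)).

Let tailE v : tail_bound v = tau + (2 * (e * c1) * \tr (K v) +
  2 * c2 * \sum_(j < n) (if (k <= j)%N then q j else 0) * sqnorm ((col j U)^T *m mx_of v *m H v)).
Proof.
rewrite /tail_bound mulrDr !mulrA; congr (_ + (_ + _ * _)).
by rewrite big_mkcond; apply: eq_bigr => j _; case: ifP; rewrite ?mul0r.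
Qed.

Let moderate_tail_sum : moderate (fun v : I -> R =>
  \sum_(j < n) (if (k <= j)%N then q j else 0) * sqnorm ((col j U)^T *m mx_of v *m H v)).
Proof. by apply: moderate_sum => j; apply: moderateZ; exact: moderate_sqnorm_mul_rinverse. Qed.

Lemma moderate_tail_bound : moderate tail_bound.
Proof.
rewrite (funext tailE); apply: moderateD; first exact: moderate_cst.
apply: moderateD; apply: moderateZ => //; exact: moderate_tr_iwishart.
Qed.

Lemma expect_tail_bound :
  expect X tail_bound <= tau + 2 * (e * c1 + c2 * tau) * expect X (fun v => \tr (K v)).
Proof.
have mK := @moderate_tr_iwishart _ _ l _ G _ e0; have mS := moderate_tail_sum.
rewrite (funext tailE) (expectD gaussX); last first.
- by apply: moderateD; exact: moderateZ.
- exact: moderate_cst.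
rewrite expect_cst lerD2l (expectD gaussX); try exact: moderateZ.
rewrite !(expectZ gaussX)// mulrDr mulrDl lerD2l.
rewrite [2 * (c2 * tau)]mulrA -[leRHS]mulrA ler_wpM2l ?mulr_ge0//.
rewrite (expect_sum gaussX) => [|j]; last first.
  by apply: moderateZ; exact: moderate_sqnorm_mul_rinverse.
rewrite /tau mulr_suml [leRHS]big_mkcond /=; apply: ler_sum => j _.
rewrite (expectZ gaussX); last exact: moderate_sqnorm_mul_rinverse.
case: ifP => kj; last by rewrite mul0r.
rewrite ler_wpM2l// (le_trans (expect_orthogonal_rinverse_le gaussX indepX e0 _))//.
  exact: tail_col_orthogonal.
by rewrite sqnorm_col_orthonormal// mul1r.
Qed.

End ExpectedPathwiseBound.

(** [lambda] is indexed from 1 and ordinals from 0, hence the successor. For k >= n both the matrix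
    and the sum are empty. *)
Lemma sqr_frobenius_tail_eigenvalues {R : realType} n k (lambda : nat -> R) :
  frobenius_norm (matrix_fun expR (tail_eigenvalues n k lambda)) ^+ 2 =
  \sum_(j < n | (minn k n <= j)%N) expR (lambda j.+1) ^+ 2.
Proof.
rewrite sqr_frobenius_norm matrix_fun_diag sqnorm_diag.
under [RHS]eq_bigl => j do rewrite geq_min [(n <= j)%N]leqNgt ltn_ord orbF.
rewrite -(big_geq_mkord _ _ predT (fun j => expR (lambda j.+1) ^+ 2)).
rewrite -[in RHS](add0n k) big_addn big_mkord; apply: eq_bigr => i _.
by rewrite !mxE addSn addnC.
Qed.

Lemma sorted_eigenvalues_diagonalization {R : realType} n (A : 'M[R]_n) (lambda : nat -> R) :
  A^T = A -> sorted_eigenvalues A lambda ->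
  exists2 U : 'M[R]_n, orthonormal_cols U &
    A = U *m diag_mx (\row_(i < n) lambda i.+1) *m U^T.
Proof.
move=> sA [cA _]; apply: symmetric_diagonalization => //.
by rewrite cA big_add1 big_mkord.
Qed.

(** The outcome of AM-GM with t^2 + h^2 as bound for the expected radicand and t + h as weight. The
    natural weight t could vanish; adding h keeps it positive. *)
Lemma sqr_sum_div_le {R : realType} (t h : R) : 0 <= t -> 0 < h ->
  ((t ^+ 2 + h ^+ 2) / (t + h) + (t + h)) / 2 <= t + h.
Proof.
move=> t0 h0; have th : 0 < t + h by exact: ltr_wpDl.
rewrite ler_pdivrMr// mulrDr mulr1 lerD2r ler_pdivrMr//.
have := mulr_ge0 t0 (ltW h0); nra.
Qed.

Theorem corollary3p6 (R : realType) (d : measure_display)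
    (T : measurableType d) (P : probability T R) (n l k s r : nat)
    (A : 'M[R]_n) (lambda : nat -> R)
    (Omega : 'I_n -> 'I_l -> {RV P >-> R}) (ALG : T -> 'M[R]_n) :
  let gamma := lambda 1%N - lambda n in
  (0 < n)%N -> (1 <= k)%N -> (1 <= s)%N ->
  A^T = A ->
  sorted_eigenvalues A lambda ->
  standard_gaussian_matrix Omega ->
  (forall w, krylov_aware_output A (realization Omega w) k s r expR (ALG w)) ->
  (2 <= l - k)%N ->
  expR 1 * gamma <= s%:R ->
  ('E_P[fun w => frobenius_norm (matrix_fun expR A - ALG w)%R] <=
    (Num.sqrt (l%:R * s%:R) * gamma ^+ (2 * r + 2) /
        (2 ^+ (4 * r + 1) * ((2 * r + 2)`!)%:R) *
        spectral_norm (matrix_fun expR A) +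
      Num.sqrt (1 + 1 / (1 - gamma ^+ s / (s`!)%:R) ^+ 2 *
                    (5 * k%:R / (l%:R - k%:R - 1))) *
        frobenius_norm (matrix_fun expR (tail_eigenvalues n k lambda)))%:E)%E.
Proof.
move=> gamma n0 k1 s1 sA eigA [gaussO indepO] out lk gs.
pose X (ij : 'I_n * 'I_l) := Omega ij.1 ij.2.
have gaussX ij (B : set R) : measurable B -> distribution P (X ij) B = normal_prob 0 1 B.
  exact: gaussO.
have realE w : realization Omega w = mx_of (X ^~ w) by apply/matrixP => i j; rewrite !mxE.
have [U oU AE] := sorted_eigenvalues_diagonalization sA eigA.
have [_ mono] := eigA; set D := \row_(i < n) lambda i.+1 in AE.
have Dlh j : lambda n <= D 0 j <= lambda 1 by rewrite mxE !mono.
have lohi : lambda n <= lambda 1 by exact: mono.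
have le_kn := geq_minr k n; have le_kk := geq_minl k n; set k' := minn k n in le_kn le_kk *.
pose c := 1 - gamma ^+ s / s`!%:R.
have c0 : 0 < c by rewrite subr_gt0 pow_fact_lt1// subr_ge0.
pose tau := \sum_(j < n | (k' <= j)%N) expR (D 0 j) ^+ 2.
have tauE : frobenius_norm (matrix_fun expR (tail_eigenvalues n k lambda)) ^+ 2 = tau.
  by rewrite sqr_frobenius_tail_eigenvalues; apply: eq_bigr => j _; rewrite mxE.
set phi := frobenius_norm (matrix_fun expR (tail_eigenvalues n k lambda)) in tauE *.
have phi0 : 0 <= phi by exact: frobenius_norm_ge0.
have tau0 : 0 <= tau by rewrite -tauE sqr_ge0.
have lk0 : 1 <= l%:R - k%:R - 1 :> R.
  (* [l - k] is a subtraction of natural numbers; being at least 2 it forces k < l, so that k + 2 <=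
     l holds over the reals too. *)
  have kl : (k < l)%N by rewrite -subn_gt0 (leq_trans _ lk).
  have : (k + 2 <= l)%N by rewrite -leq_subRL// ltnW.
  by rewrite -(ler_nat R) natrD; lra.
pose kappa := k%:R / (l%:R - k%:R - 1) : R.
have kappa0 : 0 <= kappa by rewrite divr_ge0// (le_trans _ lk0).
pose theta := Num.sqrt (1 + 1 / c ^+ 2 * (5 * k%:R / (l%:R - k%:R - 1))) * phi.
pose a := Num.sqrt (l%:R * s%:R) * gamma ^+ (2 * r + 2) /
        (2 ^+ (4 * r + 1) * ((2 * r + 2)`!)%:R) * spectral_norm (matrix_fun expR A).
rewrite -/c -/theta -/a.
have theta0 : 0 <= theta by rewrite mulr_ge0// sqrtr_ge0.
have thetaE : theta ^+ 2 = (1 + 5 * c^-1 ^+ 2 * kappa) * tau.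
  rewrite exprMn sqr_sqrtr; first by rewrite tauE /kappa; congr (_ * _); field; rewrite !gt_eqF// (lt_le_trans _ lk0).
  by rewrite addr_ge0// mulr_ge0// divr_ge0 ?sqr_ge0// ?mulr_ge0// (le_trans _ lk0).
have spec : expR (lambda 1) <= spectral_norm (matrix_fun expR A).
  rewrite AE matrix_funE//; have := eigenvalue_le_spectral_norm (map_mx expR D) (Ordinal n0) oU.
  by rewrite !mxE.
(* An arbitrary slack h > 0 stands for the limit e -> 0, as e may be chosen after h. *)
apply/lee_addgt0Pr => h h0; rewrite -EFinD.
pose c1 := (c^-1 * expR (lambda 1)) ^+ 2.
have c10 : 0 <= c1 by exact: sqr_ge0.
(* Makes the regularization term 2 e c1 t at most h^2, since t <= kappa; the 1 keeps the denominator
   positive. *)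
pose e := h ^+ 2 / (2 * c1 * kappa + 1).
have den0 : 0 < 2 * c1 * kappa + 1 by apply: ltr_wpDl => //; exact: mulr_ge0 (mulr_ge0 _ c10) kappa0.
have e0 : 0 < e by rewrite divr_gt0 ?exprn_gt0.
pose F := tail_bound (l := l) le_kn U e (fun j => expR (D 0 j) ^+ 2) c1 (c^-1 ^+ 2).
have F0 v : 0 <= F v.
  rewrite addr_ge0// mulr_ge0// addr_ge0//.
    apply: mulr_ge0; first exact: mulr_ge0 (ltW e0) c10.
    by apply: sumr_ge0 => i _; exact: iwishart_diag_ge0.
  rewrite mulr_ge0 ?sqr_ge0//; apply: sumr_ge0 => j _.
  by rewrite mulr_ge0 ?sqr_ge0 ?sqnorm_ge0.
pose t := expect X (fun v => \tr (iwishart (head_cols le_kn U) e (mx_of v))).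
have t0 : 0 <= t by exact: expect_tr_iwishart_ge0.
(* Passing from k' to k enlarges the numerator of k / (l - k - 1) and shrinks its denominator. *)
have tk : t <= kappa.
  have := expect_tr_iwishart gaussX indepO (head_cols_orthonormal le_kn oU) e0.
  rewrite -/t => tk'; rewrite /kappa ler_pdivlMr ?(lt_le_trans _ lk0)// mulrC.
  have k'k : k'%:R <= k%:R :> R by rewrite ler_nat.
  apply: le_trans (le_trans tk' k'k); rewrite ler_wpM2r//; lra.
apply: le_trans (@expectation_sqrt_le _ _ _ P _ X gaussX _ F a (theta ^+ 2 + h ^+ 2) (theta + h) _ _ _ _ _ _) _.
- exact: ltr_wpDl.
- by move=> w; exact: frobenius_norm_ge0.
- move=> w; rewrite /= AE.
  apply: le_trans (krylov_aware_error (W := mx_of (X ^~ w)) le_kn oU le_kk s1 lohi Dlh gs e0 _) _.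
    by rewrite -AE -realE.
  apply: lerD.
    by rewrite ler_wpM2l// divr_ge0 ?mulr_ge0 ?sqrtr_ge0 ?exprn_ge0// subr_ge0//.
  rewrite ler_sqrt ?F0// lerD2l ler_wpM2l// lerD2r.
  (* One factor e of e^2 |K|^2 is spent on e |K|^2 <= tr K, which is |H|^2 >= 0. *)
  rewrite expr2 -2!mulrA -(mulrA e) ler_wpM2l//; first exact: ltW.
  by rewrite mulrCA ler_wpM2l// -subr_ge0 -sqnorm_rinverse// sqnorm_ge0.
- exact: F0.
- exact: moderate_tail_bound.
- apply: le_trans (expect_tail_bound (l := l) gaussX indepO le_kn oU e0 _ _ _) _.
  + by move=> j; exact: sqr_ge0.
  + exact: sqr_ge0.
  (* The tail enters with 2 c^-2 kappa tau, below the 5 c^-2 kappa tau inside theta^2; the remaining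
     term is at most h^2. *)
  rewrite -/t -/tau thetaE.
  have h1 : e * c1 * t * 2 <= h ^+ 2.
    apply: (@le_trans _ _ (e * (2 * c1 * kappa + 1))); last by rewrite divfK// gt_eqF.
    have := ler_wpM2l (mulr_ge0 (ltW e0) c10) tk; nra.
  have h2 : c^-1 ^+ 2 * tau * t <= c^-1 ^+ 2 * tau * kappa by rewrite ler_wpM2l// mulr_ge0// sqr_ge0.
  have h3 : 0 <= c^-1 ^+ 2 * tau * kappa by exact: mulr_ge0 (mulr_ge0 (sqr_ge0 _) tau0) kappa0.
  by nra.
- by rewrite lee_fin -addrA lerD2l sqr_sum_div_le.
Qed.
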